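(* Let $l>-\frac12$, let $q\in L^1_{\mathrm{loc}}(\mathbb{R}_+)$ be real-valued, and assume $x\,q(x)\in L^p(0,1)$ for some $p\in I_l$, where $I_l=[1,\infty]$ if $l>0$ and $I_l=[1,\frac{-1}{2l})$ if $-\frac12<l\le0$ (with $\frac{-1}{2l}=\infty$ for $l=0$). Let $\phi(z,x)$ be the solution of $\tau u=zu$ that is entire in $z$ with $\phi(z,x)=x^{l+1}(1+o(1))$ as $x\to0$. Then, for every $z_0\in\mathbb{C}$, $\phi$ admits the representation $$\phi(z,x)=x^{l+1}\sum_{k=0}^\infty\frac{x^{2k}\,\widetilde\phi_k(z_0,x)}{k!}(z-z_0)^k,\qquad \phi'(z,x)=x^{l}\sum_{k=0}^\infty\frac{x^{2k}\,\widehat\phi_k(z_0,x)}{k!}(z-z_0)^k,$$ where for all $k\in\mathbb{N}_0$: $\widetilde\phi_k(z_0,\cdot),\widehat\phi_k(z_0,\cdot)\in W^{1,p}(0,1)$, $$\widetilde\phi_k(z_0,0)=C^\phi_{l,k},\qquad \widehat\phi_k(z_0,0)=(l+1+2k)\,C^\phi_{l,k},\qquad C^\phi_{l,k}=\frac{(-1)^k}{4^k(l+\frac32)_k}.$$ Moreover, for any $z_0\in\mathbb{C}$ and $k\in\mathbb{N}_0$, $\lim_{x\to0}x\,\widetilde\phi_k'(z_0,x)=0$.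
   Context: $\tau=-\frac{d^2}{dx^2}+\frac{l(l+1)}{x^2}+q(x)$ on $\mathbb{R}_+=(0,\infty)$; primes are derivatives in $x$. $(x)_0=1$, $(x)_j=x(x+1)\cdots(x+j-1)$ is the Pochhammer symbol. $W^{1,p}(0,1)$ is the Sobolev space of absolutely continuous functions whose derivative is in $L^p(0,1)$. The solution $\phi$ exists and is uniquely determined by the stated asymptotics. *)

(* Defs.v *)
From HB Require Import structures.
From mathcomp Require Import all_boot all_order all_algebra.
From mathcomp Require Import all_classical all_reals all_analysis.
From mathcomp.real_closed Require Import complex.

Set Implicit Arguments.
Unset Strict Implicit.
Unset Printing Implicit Defensive.

Import Order.TTheory GRing.Theory Num.Theory numFieldNormedType.Exports.
Local Open Scope classical_set_scope.
Local Open Scope ring_scope.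

(* The topology and the complex differentiability on R[i] are those of the
   normed module R[i]^o over R[i]. *)
Notation cplx R := ((R[i])^o).

Section real_functions.
Context {R : realType}.
Implicit Types (a b : R) (p : \bar R) (f : R -> R).

Local Notation mu := (@lebesgue_measure R).

Definition abs_continuous a b f : Prop :=
  forall e : R, 0 < e -> exists2 d : R, 0 < d &
    forall (n : nat) (s t : 'I_n -> R),
      (forall i, [/\ a <= s i, s i <= t i & t i <= b]) ->
      trivIset [set: 'I_n] (fun i => `]s i, t i[%classic) ->
      \sum_(i < n) (t i - s i) < d ->
      \sum_(i < n) `|f (t i) - f (s i)| < e.

Definition Lp01 p f : Prop := f \_ `]0, 1[%classic \in Lfun mu p.

(* Elements of L^p are classes modulo a.e. equality, so the derivative is only
   required to coincide a.e. with an L^p function; f is its own continuous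
   representative on the closed interval [0, 1]. *)
Definition W1p01 p f : Prop :=
  abs_continuous 0 1 f /\
  exists2 g : R -> R, Lp01 p g &
    {ae mu, forall x : R, 0 < x < 1 -> is_derive x (1 : R) f (g x)}.

Definition exponent_range (l : R) : set (\bar R) :=
  if 0 < l then [set p | (1 <= p)%E]
  else if l == 0 then [set p | (1 <= p < +oo)%E]
  else [set p | (1 <= p < (- 1 / (2 * l))%:E)%E].

Definition pochhammer (x : R) (j : nat) : R := \prod_(i < j) (x + i%:R).

Definition Cphi (l : R) (k : nat) : R :=
  (- 1) ^+ k / (4 ^+ k * pochhammer (l + 3 / 2) k).

End real_functions.

(* R[i] is not a normed module over R in the library, so the notions for
   complex-valued functions of a real variable are taken componentwise. *)
Section complex_valued.
Context {R : realType}.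
Implicit Types (a b x : R) (p : \bar R) (f : R -> cplx R).

Definition cRe f : R -> R := fun x => complex.Re (f x).
Definition cIm f : R -> R := fun x => complex.Im (f x).

Definition cderivable f x : Prop :=
  derivable (cRe f) x 1 /\ derivable (cIm f) x 1.

Definition cderive f : R -> cplx R :=
  fun x => (derive1 (cRe f) x +i* derive1 (cIm f) x)%C.

Definition cabs_continuous a b f : Prop :=
  abs_continuous a b (cRe f) /\ abs_continuous a b (cIm f).

Definition cW1p01 p f : Prop := W1p01 p (cRe f) /\ W1p01 p (cIm f).

End complex_valued.

Section bessel.
Context {R : realType}.
Implicit Types (l x : R) (q : R -> R) (u : R -> cplx R).

Local Notation mu := (@lebesgue_measure R).

Definition tau l q u : R -> cplx R := fun x =>
  - cderive (cderive u) x + ((l * (l + 1) / x ^+ 2 + q x)%:C)%C * u x.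

Definition is_solution l q (z : cplx R) u : Prop :=
  [/\ forall x, 0 < x -> cderivable u x,
      forall a b : R, 0 < a -> a <= b ->
        cabs_continuous a b u /\ cabs_continuous a b (cderive u)
    & {ae mu, forall x : R, 0 < x ->
        cderivable (cderive u) x /\ tau l q u x = z * u x}].

Definition is_phi l q (phi : cplx R -> R -> cplx R) : Prop :=
  [/\ forall z, is_solution l q z (phi z),
      forall x, 0 < x -> forall z : cplx R, derivable (phi ^~ x) z 1
    & forall z, exists2 r : R -> cplx R,
        r x @[x --> 0^'+] --> (0 : cplx R) &
        forall x, 0 < x -> phi z x = ((x `^ (l + 1))%:C)%C * (1 + r x)].

End bessel.

(* Main.v *)
(* Put al = 2l + 1 > 0 and phi = x^(l+1) w.  The differential equation together
   with w -> 1 at 0 is equivalent to the Volterra equation w = 1 + J((xq - zx) w),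
   where J f(x) = \int_0^x hardy al f and hardy b f(x) = x^(-b-1) \int_0^x y^b f.
   Expanding at z0 with w = sum_k x^(2k) a_k (z - z0)^k gives the recursion
   x^(2k) a_k = J(x^(2k) m a_k - x^(2k-1) a_(k-1)), m = xq - z0 x, which is solved
   by Neumann series with a bound M^(k+1) / k! on a_k.  The remainder of the
   expansion of w(z) satisfies a Volterra equation with right-hand side
   O(c^N / N!), so it tends to 0 by Gronwall.
   For k >= 1 regularity comes from a_k = hardy (2k-1) v_k and
   v_k = x hardy (al+2k) (m a_k) - hardy (al+2k-1) a_(k-1): the operators hardy b
   are bounded on L^p(0,1) for b > 0, (x hardy b f)' = f - b hardy b f and
   (hardy b f)' = hardy (b+1) f'. *)

Require Import Defs.
From HB Require Import structures.
From mathcomp Require Import all_boot all_order all_algebra.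
From mathcomp Require Import all_classical all_reals all_analysis.
From mathcomp.real_closed Require Import complex.
From mathcomp Require Import measurable_realfun ess_sup_inf hoelder ring lra.

Import Order.TTheory GRing.Theory Num.Theory numFieldNormedType.Exports.
Local Open Scope classical_set_scope.
Local Open Scope ring_scope.

Set Implicit Arguments.
Unset Strict Implicit.
Unset Printing Implicit Defensive.

(** * Absolute continuity and Lebesgue integrals *)

Section abs_continuous_ftc.
Context {R : realType}.
Implicit Types (a b x : R) (f g F : R -> R).
Local Notation mu := (@lebesgue_measure R).

(** The power $x^{l+1}$ removes the term $l(l+1)/x^2$: the homogeneous equation for $w$ has the
    solutions $1$ and $x^{-al}$. The asymptotics exclude the second one, and since $al>0$ the
    remaining kernel is bounded by $|xq-zx|/al$, so integrability of $xq$ near 0 suffices for all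
    Volterra estimates. The obstacle is regularity. Dividing $J(\ldots)$ by $x^{2k}$ and
    differentiating produces two terms that are singular at 0 and of which only the sum is in $L^p$.
    Hardy operators avoid this: a power of $x$ pulled out of them only shifts the parameter, and the
    derivative of a weighted average is again one. Such a derivative also satisfies $x\,a_k'\to0$ at
    once, because $x$ times [hardy b g x] is at most $\int_0^x|g|$. Constants are eigenvectors:
    [hardy b] maps $c$ to $c/(b+1)$. The two operators of the recursion thus divide the value at 0
    by $al+2k$ and by $2k$, so each step multiplies it by $-1/(4k(l+\frac12+k))$; this is the origin
    of $C^\phi_{l,k}/k!$. *)

Lemma is_derive_near x f df e : is_derive x (1 : R) f df -> 0 < e ->
  exists2 d : R, 0 < d &
    forall y, `|y - x| < d -> `|f y - f x - df * (y - x)| <= e * `|y - x|.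
Proof.
move=> [fx <-] e0; move: fx => /cvg_ex[/= l fl].
have -> : 'D_1 f x = l by apply/cvg_lim.
move/cvgrPdist_le : fl => /(_ _ e0) [d /= d0 H]; exists d => // y yx.
have [->|ynx] := eqVneq y x; first by rewrite !subrr mulr0 subrr normr0 mulr0.
have yx0 : y - x != 0 by rewrite subr_eq0.
move: (H (y - x)); rewrite /= sub0r normrN => /(_ yx yx0).
rewrite /= [_ *: 1]mulr1 subrK [_ *: _]mulrC => H1.
rewrite (_ : f y - f x - l * (y - x) = (y - x) * ((f y - f x) / (y - x) - l)); last first.
  by field.
by rewrite normrM mulrC ler_wpM2r// distrC.
Qed.

(* A sup argument covers [a, b] by pieces on which either [f] varies by at most
   [e1] times the length, or which lie in an open set [U] of small measure
   containing the exceptional null set; absolute continuity handles the latter. *)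
Lemma ac_derive0 a b f : a <= b -> abs_continuous a b f ->
  {ae mu, forall x, a < x < b -> is_derive x (1 : R) f 0} -> f b = f a.
Proof.
move=> ab acf [A [mA A0 subA]]; apply/eqP; rewrite -subr_eq0 -normr_le0.
apply/ler_addgt0Pr => e e0; rewrite add0r.
have [d d0 Hd] := acf _ (divr_gt0 e0 (ltr0n R 2)).
(* The summand 1 keeps the denominator positive when [a = b]. *)
set e1 : R := e / 2 / (b - a + 1).
have ba1 : 0 < b - a + 1 by rewrite ltr_wpDl ?subr_ge0.
have e10 : 0 < e1 by rewrite divr_gt0// divr_gt0.
pose A' := A `|` [set a] `|` [set b].
have mA' : measurable A' by apply: measurableU => //; apply: measurableU.
have A'0 : mu A' = 0%E.
  have mu1 c : mu [set c] = 0%E by exact: lebesgue_measure_set1.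
  rewrite /A' measureU0; [|by apply: measurableU|by []|exact: mu1].
  by rewrite measureU0; [|by []|by []|exact: mu1].
have A'y : (mu A' < +oo)%E by rewrite A'0.
have [U [oU A'U UA']] := lebesgue_regularity_outer mA' A'y d0.
have mU : measurable U by exact: open_measurable.
have mUd : (mu U < d%:E)%E.
  have -> : mu U = mu ((U `\` A') `|` A') by rewrite setUC setDUK.
  by rewrite measureU0//; apply: measurableD.
(* The intervals inside [U] are recorded rather than estimated one by one: absolute continuity
   bounds only the sum over a whole disjoint family. *)
pose Q t := exists n (s u : 'I_n -> R),
  [/\ forall i, [/\ a <= s i, s i <= u i, u i <= t & `]s i, u i[ `<=` U],
      trivIset [set: 'I_n] (fun i => `]s i, u i[%classic) &
      `|f t - f a| <= e1 * (t - a) + \sum_(i < n) `|f (u i) - f (s i)|].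
have Qgood t t' : t <= t' -> `|f t' - f t| <= e1 * (t' - t) -> Q t -> Q t'.
  move=> tt' ftt' [n [s [u [H1 H2 H3]]]]; exists n, s, u; split => //.
    move=> i; have [? ? ut ?] := H1 i; split => //; exact: le_trans ut _.
  apply: (le_trans (ler_distD (f t) _ _)).
  by move: ftt' H3; lra.
have Qbad t t' : a <= t -> t <= t' -> `]t, t'[ `<=` U -> Q t -> Q t'.
  move=> at_ tt' tU [n [s [u [H1 H2 H3]]]].
  exists n.+1, (fun i => oapp s t (unlift ord0 i)), (fun i => oapp u t' (unlift ord0 i)).
  split.
  - move=> i; case: unliftP => [j _|_] /=; last by split.
    have [? ? ut ?] := H1 j; split => //; exact: le_trans ut _.
  - apply/trivIsetP => i j _ _ ij.
    case: (unliftP ord0 i) ij => [i' ->|->]; case: (unliftP ord0 j) => [j' ->|->] //= ij.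
    + move/trivIsetP : H2 => /(_ i' j' I I); apply.
      by apply: contra_neq ij => ->.
    + have [_ _ ut _] := H1 i'.
      apply/seteqP; split => // z [/=]; rewrite !in_itv/= => /andP[_ zu] /andP[tz _].
      by move: (lt_le_trans zu ut); rewrite ltNge (ltW tz).
    + have [_ _ ut _] := H1 j'.
      apply/seteqP; split => // z [/=]; rewrite !in_itv/= => /andP[tz _] /andP[_ zu].
      by move: (lt_le_trans zu ut); rewrite ltNge (ltW tz).
  - rewrite big_ord_recl unlift_none/=.
    under eq_bigr do rewrite liftK/=.
    apply: (le_trans (ler_distD (f t) _ _)).
    have : 0 <= e1 * (t' - t) by rewrite mulr_ge0 ?subr_ge0// ltW.
    by move: H3; lra.
(* [Q] passes across [c], from any point slightly to its left to any point slightly to its right; at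
   [c = sup S] this pushes the supremum up to [b]. *)
have gauge c : a <= c <= b -> exists2 d0 : R, 0 < d0 &
    forall t1 t2, a <= t1 -> c - d0 < t1 <= c -> c <= t2 < c + d0 -> Q t1 -> Q t2.
  move=> /andP[ac cb]; have [cU|cU] := pselect (U c).
    have /= [d' d'0 dU] := open_nbhs_nbhs (conj oU cU).
    exists d' => // t1 t2 at1 /andP[ct1 t1c] /andP[ct2 t2c].
    apply: Qbad => //; first exact: le_trans t1c ct2.
    move=> z /=; rewrite in_itv/= => /andP[z1 z2]; apply: dU => /=.
    by rewrite ltr_norml; apply/andP; split; move: ct1 t1c ct2 t2c z1 z2; lra.
  have ac' : a < c.
    rewrite lt_neqAle ac andbT; apply/eqP => E; apply: cU; apply: A'U.
    by left; right.
  have cb' : c < b.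
    rewrite lt_neqAle cb andbT; apply/eqP => E; apply: cU; apply: A'U.
    by right.
  have fc : is_derive c (1 : R) f 0.
    apply: contrapT => nfc; apply: cU; apply: A'U; left; left; apply: subA => /=.
    by apply/not_implyP; split => //; rewrite ac' cb'.
  have [d' d'0 dU] := is_derive_near fc e10.
  exists d' => // t1 t2 at1 /andP[ct1 t1c] /andP[ct2 t2c].
  apply: Qgood; first exact: le_trans t1c ct2.
  have := dU t1; have := dU t2; rewrite !mul0r !subr0 (ger0_norm (_ : 0 <= t2 - c)) ?subr_ge0//.
  rewrite (ler0_norm (_ : t1 - c <= 0)) ?subr_le0// => H1 H2.
  have {}H1 : `|f t2 - f c| <= e1 * (t2 - c) by apply: H1; lra.
  have {}H2 : `|f t1 - f c| <= e1 * - (t1 - c) by apply: H2; lra.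
  apply: (le_trans (ler_distD (f c) _ _)); rewrite (distrC (f c)).
  by move: H1 H2; lra.
have Qa : Q a.
  exists 0%N, (fun=> a), (fun=> a); split => //; first by case.
    by apply/trivIsetP; case.
  by rewrite big_ord0 !subrr normr0 mulr0 addr0.
pose S := [set t | a <= t <= b /\ Q t].
have Sa : S a by split => //; rewrite lexx.
have hS : has_sup S.
  by split; [exists a | exists b => t [/andP[]]].
have ac : a <= sup S by apply: (sup_ubound hS.2).
have cb : sup S <= b by apply: ge_sup; [exists a | move=> t [/andP[]]].
have Qb : Q b.
  have [|d' d'0 H] := gauge (sup S); first by rewrite ac cb.
  have [t1 [/andP[at1 t1b] Qt1] ct1] := sup_adherent d'0 hS.
  have t1c : t1 <= sup S by apply: (sup_ubound hS.2); split => //; rewrite at1.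
  have Q2 t2 : sup S <= t2 < sup S + d' -> Q t2 by move=> H2; apply: (H t1) => //; rewrite ct1.
  have [bc|cb'] := ltP b (sup S + d'); first by apply: Q2; rewrite cb.
  exfalso.
  have : S (sup S + d' / 2).
    split; first by move: ac cb d'0 cb'; lra.
    by apply: Q2; move: d'0; lra.
  by move=> /(sup_ubound hS.2); move: d'0; lra.
have [n [s [u [H1 H2 H3]]]] := Qb.
apply: (le_trans H3).
have H4 : \sum_(i < n) `|f (u i) - f (s i)| < e / 2.
  apply: Hd => //; first by move=> i; have [] := H1 i.
  rewrite -lte_fin; apply: le_lt_trans mUd.
  rewrite (_ : (\sum_(i < n) (u i - s i))%:E = mu (\big[setU/set0]_(i < n) `]s i, u i[%classic)).
    apply: le_measure; rewrite ?inE//.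
    - by apply: bigsetU_measurable => i _.
    - apply: (big_ind (fun X => X `<=` U)) => //.
        by move=> X Y XU YU z [/XU|/YU].
      by move=> i _; have [] := H1 i.
  rewrite measure_bigsetU_ord//= -sumEFin; apply: eq_bigr => i _.
  rewrite lebesgue_measure_itv/= lte_fin; case: ltP => //.
  by have [_ su _ _] := H1 i; move=> us; rewrite (@le_anti _ _ (s i) (u i)) ?su ?us// subrr.
have : e1 * (b - a) <= e / 2.
  by rewrite /e1 mulrAC ler_pdivrMr// ler_wpM2l ?divr_ge0 ?(ltW e0)// lerDl.
by move: H4; lra.
Qed.
End abs_continuous_ftc.

(** * Functions integrable up to the singular endpoint 0 *)

Section local_integrability.
Context {R : realType}.
Implicit Types (a b s t x X : R) (f g F : R -> R).
Local Notation mu := (@lebesgue_measure R).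

Definition locint g := forall X, mu.-integrable `]0, X] (EFin \o g).

(** A class of multipliers for [locint] that does not require a limit at 0. *)
Definition locbnd f := forall X, measurable_fun `]0, X] f /\
  exists K, forall x, 0 < x <= X -> `|f x| <= K.

(** For [x <= 0] the interval is empty and the value is 0, so absolute continuity can be stated on
    intervals that start at 0. *)
Definition prim g x := \int[mu]_(y in `]0, x]) g y.

Lemma locint_measurable g X : locint g -> measurable_fun `]0, X] g.
Proof. by move=> /(_ X) /measurable_int /measurable_EFinP. Qed.

Lemma locint_eq f g : (forall x, 0 < x -> f x = g x) -> locint f -> locint g.
Proof.
move=> fg lf X; apply: eq_integrable (lf X) => //= x.
by rewrite inE/= in_itv/= => /andP[x0 _]; rewrite fg.
Qed.

Lemma locint_le f g : (forall X, measurable_fun `]0, X] f) ->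
  (forall x, 0 < x -> `|f x| <= `|g x|) -> locint g -> locint f.
Proof.
move=> mf fg lg X; apply: le_integrable (lg X) => //=.
  by apply/measurable_EFinP; exact: mf.
by move=> x /=; rewrite in_itv/= => /andP[x0 _]; rewrite lee_fin fg.
Qed.

Lemma locintD f g : locint f -> locint g -> locint (fun x => f x + g x).
Proof. by move=> lf lg X; exact: integrableD (lf X) (lg X). Qed.

Lemma locintZ c f : locint f -> locint (fun x => c * f x).
Proof. by move=> lf X; exact: integrableZl c _ (lf X). Qed.

Lemma locintN f : locint f -> locint (fun x => - f x).
Proof.
by move=> lf; apply: locint_eq (locintZ (-1) lf) => x _; rewrite mulN1r.
Qed.

Lemma locintB f g : locint f -> locint g -> locint (fun x => f x - g x).
Proof. by move=> lf lg; apply: locintD => //; exact: locintN. Qed.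

Lemma locint_norm f : locint f -> locint (fun x => `|f x|).
Proof. by move=> lf X; apply: integrable_norm (lf X). Qed.

Lemma locintM f g : locint f -> locbnd g -> locint (fun x => f x * g x).
Proof.
move=> lf lg X; have [mg [K HK]] := lg X.
apply: le_integrable (locintZ K lf X) => //=.
- apply/measurable_EFinP; apply: measurable_funM => //.
  exact: locint_measurable.
- move=> x /=; rewrite in_itv/= => x0; rewrite lee_fin !normrM mulrC ler_wpM2r//.
  by rewrite (le_trans (HK _ x0))// ler_norm.
Qed.

Lemma locbnd_eq f g : (forall x, 0 < x -> f x = g x) -> locbnd f -> locbnd g.
Proof.
move=> fg lf X; have [mf [K HK]] := lf X; split.
  apply: eq_measurable_fun mf => x; rewrite inE/= in_itv/= => /andP[x0 _]; exact: fg.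
by exists K => x /[dup] /andP[x0 _] /HK; rewrite fg.
Qed.

Lemma locbnd_cst c : locbnd (fun=> c).
Proof. by move=> X; split => //; exists `|c|. Qed.

Lemma locbnd_id : locbnd (fun x => x).
Proof.
move=> X; split => //; exists X => x /andP[x0 xX].
by rewrite ger0_norm// ltW.
Qed.

Lemma locbndD f g : locbnd f -> locbnd g -> locbnd (fun x => f x + g x).
Proof.
move=> lf lg X; have [mf [K HK]] := lf X; have [mg [L HL]] := lg X; split.
  exact: measurable_funD.
by exists (K + L) => x xX; rewrite (le_trans (ler_normD _ _))// lerD ?HK ?HL.
Qed.

Lemma locbndM f g : locbnd f -> locbnd g -> locbnd (fun x => f x * g x).
Proof.
move=> lf lg X; have [mf [K HK]] := lf X; have [mg [L HL]] := lg X; split.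
  exact: measurable_funM.
by exists (K * L) => x xX; rewrite normrM ler_pM ?HK ?HL.
Qed.

Lemma locbndN f : locbnd f -> locbnd (fun x => - f x).
Proof.
move=> lf; apply: locbnd_eq (locbndM (locbnd_cst (-1)) lf) => x _.
by rewrite mulN1r.
Qed.

Lemma locbndB f g : locbnd f -> locbnd g -> locbnd (fun x => f x - g x).
Proof. by move=> lf lg; apply: locbndD => //; exact: locbndN. Qed.

Lemma locbndX n : locbnd (fun x => x ^+ n).
Proof.
elim: n => [|n IH]; first by apply: locbnd_eq (locbnd_cst 1) => x _; rewrite expr0.
by apply: locbnd_eq (locbndM locbnd_id IH) => x _; rewrite exprS.
Qed.

Lemma locbnd_locint f : locbnd f -> locint f.
Proof.
move=> lf X; have [mf [K HK]] := lf X.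
apply: measurable_bounded_integrable => //=.
  by rewrite lebesgue_measure_itv/=; case: ifPn => // _; exact: ltry.
exists K; split; first exact: num_real.
move=> M KM x /=; rewrite in_itv/= => xX; exact: le_trans (HK _ xX) (ltW KM).
Qed.

Lemma prim_le0 g x : x <= 0 -> prim g x = 0.
Proof.
by move=> x0; rewrite /prim set_itv_ge ?Rintegral_set0// bnd_simp -leNgt.
Qed.

Lemma eq_prim f g x : (forall y, 0 < y <= x -> f y = g y) -> prim f x = prim g x.
Proof. by move=> fg; apply: eq_Rintegral => y; rewrite inE/= in_itv/=; exact: fg. Qed.

Lemma primD f g x : locint f -> locint g ->
  prim (fun y => f y + g y) x = prim f x + prim g x.
Proof. by move=> lf lg; exact: RintegralD. Qed.

Lemma primB f g x : locint f -> locint g ->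
  prim (fun y => f y - g y) x = prim f x - prim g x.
Proof. by move=> lf lg; exact: RintegralB. Qed.

Lemma primZ c f x : locint f -> prim (fun y => c * f y) x = c * prim f x.
Proof. by move=> lf; exact: RintegralZl. Qed.

Lemma prim_ge0 f x : (forall y, 0 < y <= x -> 0 <= f y) -> 0 <= prim f x.
Proof. by move=> f0; apply: Rintegral_ge0 => y /=; rewrite in_itv/=; exact: f0. Qed.

Lemma le_prim f g x : locint f -> locint g ->
  (forall y, 0 < y <= x -> f y <= g y) -> prim f x <= prim g x.
Proof.
move=> lf lg fg; apply: le_Rintegral => // y /=; rewrite in_itv/=; exact: fg.
Qed.

Lemma prim_norm f x : locint f -> `|prim f x| <= prim (fun y => `|f y|) x.
Proof. by move=> lf; exact: le_normr_Rintegral. Qed.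

Lemma prim_sub g s t : locint g -> 0 <= s -> s <= t ->
  prim g t - prim g s = \int[mu]_(y in `]s, t]) g y.
Proof. by move=> lg s0 st; apply: Rintegral_itvB => //; rewrite bnd_simp. Qed.

Lemma locint_itv g s t : locint g -> 0 <= s -> mu.-integrable `]s, t] (EFin \o g).
Proof.
move=> lg s0; apply: integrableS (lg t) => // x /=; rewrite !in_itv/= => /andP[sx ->].
by rewrite (le_lt_trans s0).
Qed.

Lemma prim_homo g s t : locint g -> (forall x, 0 < x -> 0 <= g x) ->
  s <= t -> prim g s <= prim g t.
Proof.
move=> lg g0 st; have [s0|s0] := leP s 0.
  by rewrite prim_le0// prim_ge0// => y /andP[y0 _]; exact: g0.
rewrite -subr_ge0 prim_sub//; last exact: ltW.
by apply: Rintegral_ge0 => y /=; rewrite in_itv/= => /andP[sy _]; apply: g0; rewrite (lt_trans s0).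
Qed.

Lemma prim_cst c x : 0 <= x -> prim (fun=> c) x = c * x.
Proof.
move=> x0; rewrite /prim Rintegral_cst//= lebesgue_measure_itv/= lte_fin.
by case: ltP => [|xx0]/=; rewrite ?subr0//; have -> : x = 0 by apply/le_anti; rewrite x0 xx0.
Qed.

(** Absolute continuity of the set function $D\mapsto\int_D|g|$, applied to the union of the given
    disjoint intervals. *)
Lemma prim_ac g a b : locint g -> 0 <= a -> abs_continuous a b (prim g).
Proof.
move=> lg a0 e e0.
pose h := g \_ `]0, b].
have ih : mu.-integrable setT (EFin \o h).
  by rewrite /h -restrict_EFin; apply: (integrable_mkcond _ _).1 => //; exact: lg.
have [d [d0 Hd]] := integral_normr_continuous ih e0.
exists d => // n s t st tr sd.
pose D := \big[setU/set0]_(i <- index_enum 'I_n) `]s i, t i[%classic.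
have mD : measurable D by apply: bigsetU_measurable => i _.
have muD : (mu D < d%:E)%E.
  rewrite /D measure_bigsetU_ord//= (_ : \sum_(i < n) _ = (\sum_(i < n) (t i - s i))%:E)%E ?lte_fin//.
  rewrite -sumEFin; apply: eq_bigr => i _; rewrite lebesgue_measure_itv/= lte_fin.
  have [_ si ti] := st i; case: ltP => // ts.
  by rewrite (@le_anti _ _ (s i) (t i)) ?si ?ts// subrr.
apply: le_lt_trans (Hd _ mD muD).
have E : \int[mu]_(x in D) `|h x| = \sum_(i < n) \int[mu]_(x in `]s i, t i[) `|h x|.
  rewrite /Rintegral /D ge0_integral_bigsetU//=.
  - rewrite -sum_fine// => i _; apply: integrable_fin_num => //.
    apply: integrable_norm; exact: integrableS ih.
  - exact: index_enum_uniq.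
  - by apply: sub_trivIset tr.
  - apply: measurable_funTS; apply/measurable_EFinP; apply: measurableT_comp => //.
    by apply/measurable_EFinP; case/integrableP : ih.
rewrite E; apply: ler_sum => i _; have [si ti bi] := st i.
have s0 := le_trans a0 si.
rewrite prim_sub// (le_trans (le_normr_Rintegral _ _))//; first exact: locint_itv.
rewrite -Rintegral_itv_bndo_bndc; last first.
  apply: integrableS (locint_itv (t i) (locint_norm lg) s0) => //.
  by apply: subset_itvl; rewrite bnd_simp.
rewrite le_eqVlt; apply/orP; left; apply/eqP; apply: eq_Rintegral => y.
rewrite inE/= in_itv/= => /andP[sy yt]; rewrite /h patchE mem_set//= in_itv/=.
by rewrite (le_lt_trans s0 sy) (le_trans (ltW yt)).
Qed.

End local_integrability.

(** * Calculus of absolutely continuous functions *)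

Section absolute_continuity.
Context {R : realType}.
Implicit Types (a b s t x X : R) (f g F : R -> R).
Local Notation mu := (@lebesgue_measure R).

(** Extension by 0 turns integrability on each ]0, X] into the local integrability on the line that
    [FTC1] asks for. *)
Lemma locint_locally g : locint g -> locally_integrable setT (g \_ `]0, +oo[).
Proof.
move=> lg.
have mg : measurable_fun (`]0, +oo[ : set R) g.
  rewrite itv_bndy_bigcup_BRight; apply/measurable_fun_bigcup => // n.
  by rewrite add0r; exact: locint_measurable.
split; [by apply/(measurable_restrictT _ _).1|exact: openT|].
move=> K _ cK; have [M [_ HM]] := compact_bounded cK.
have mK : measurable K by exact: compact_measurable.
have {}HM x : K x -> x <= M + 1.
  by move=> Kx; rewrite (le_trans (ler_norm _))// HM// ltrDl.
rewrite (_ : (fun x => _) = (fun x => `|g x|%:E) \_ `]0, +oo[); last first.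
  by apply/funext => x; rewrite !patchE; case: ifPn => //; rewrite normr0.
rewrite -integral_mkcondr.
have /integrableP[_] := lg (M + 1).
apply: le_lt_trans; apply: ge0_subset_integral => //=.
- exact: measurableI.
- apply/measurable_EFinP; apply: measurableT_comp => //; exact: locint_measurable.
- by move=> x /= [Kx]; rewrite !in_itv/= => /andP[-> _]; exact: HM.
Qed.

Lemma primE_restrict g x : prim g x = prim (g \_ `]0, +oo[) x.
Proof. by apply: eq_prim => y /andP[y0 _]; rewrite patchE mem_set//= in_itv/= y0. Qed.

Lemma locint_restrict g : locint g -> locint (g \_ `]0, +oo[).
Proof. by apply: locint_eq => x x0; rewrite patchE mem_set//= in_itv/= x0. Qed.

#[global] Instance ae_mu_filter : Filter (nbhs (almost_everywhere mu)) :=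
  ae_filter_ringOfSetsType mu.

Lemma prim_derive g : locint g ->
  {ae mu, forall x, 0 < x -> is_derive x (1 : R) (prim g) (g x)}.
Proof.
move=> lg; have := FTC1 (a := BRight 0) (locint_restrict lg) (locint_locally lg).
apply: filterS => x /= H x0.
have [dF F'] := H x0.
have E : prim g = fun x => \int[mu]_(t in `]0, x]) (g \_ `]0, +oo[) t.
  by apply/funext => y; exact: primE_restrict.
rewrite E; apply: DeriveDef; first exact: dF.
by rewrite -derive1E F' patchE mem_set//= in_itv/= x0.
Qed.

Lemma prim_derive_continuous g x : locint g -> 0 < x -> {for x, continuous g} ->
  is_derive x (1 : R) (prim g) (g x).
Proof.
move=> lg x0 cg.
have xx1 : x < x + 1 by rewrite ltrDl.
have [|dF F'] := continuous_FTC1 (a := BRight 0) xx1 (lg _) _ cg.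
  exact: x0.
by apply: DeriveDef; [exact: dF|rewrite -derive1E; exact: F'].
Qed.

(** A single epsilon-delta argument behind the closure properties: sums, multiples, products and
    Lipschitz functions reduce to an inequality between increments. *)
Lemma ac_dominated a b F G H K : abs_continuous a b F -> abs_continuous a b G ->
  (forall s t, a <= s -> s <= t -> t <= b ->
     `|H t - H s| <= K * (`|F t - F s| + `|G t - G s|)) ->
  abs_continuous a b H.
Proof.
move=> aF aG HFG e e0.
have K0 : 0 < `|K| + 1 by rewrite ltr_wpDl.
have e20 : 0 < e / (`|K| + 1) / 2 by rewrite divr_gt0// divr_gt0.
have [d1 d10 Hd1] := aF _ e20; have [d2 d20 Hd2] := aG _ e20.
exists (Num.min d1 d2); first by rewrite lt_min d10.
move=> n s t st tr; rewrite lt_min => /andP[s1 s2].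
apply: (@le_lt_trans _ _ (\sum_(i < n) ((`|K| + 1) *
    (`|F (t i) - F (s i)| + `|G (t i) - G (s i)|)))).
  apply: ler_sum => i _; have [? ? ?] := st i.
  apply: (le_trans (HFG _ _ _ _ _)) => //; rewrite ler_wpM2r ?addr_ge0//.
  by rewrite (le_trans (ler_norm _))// lerDl.
rewrite -mulr_sumr big_split/= -ltr_pdivlMl// mulrC.
by rewrite (splitr (_ / _)) ltrD// ?Hd1// Hd2.
Qed.

Lemma ac_lipschitz a b H K :
  (forall s t, a <= s -> s <= t -> t <= b -> `|H t - H s| <= K * (t - s)) ->
  abs_continuous a b H.
Proof.
move=> HK.
have aid : abs_continuous a b (fun x => x).
  move=> e e0; exists e => // n s t st _; apply: le_lt_trans.
  by apply: ler_sum => i _; have [_ ? _] := st i; rewrite ger0_norm// subr_ge0.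
apply: (ac_dominated (K := `|K|) aid aid) => s t as_ st tb.
apply: (le_trans (HK _ _ _ _ _)) => //.
have st0 : 0 <= t - s by rewrite subr_ge0.
rewrite (ger0_norm st0); apply: (@le_trans _ _ (`|K| * (t - s))).
  by rewrite ler_wpM2r// ler_norm.
by rewrite ler_wpM2l// lerDl.
Qed.

Lemma ac_continuous a b F : abs_continuous a b F ->
  forall e, 0 < e -> exists2 d, 0 < d &
    forall s t, a <= s -> s <= t -> t <= b -> t - s < d -> `|F t - F s| < e.
Proof.
move=> aF e e0; have [d d0 H] := aF _ e0; exists d => // s t as_ st tb std.
have := H 1%N (fun=> s) (fun=> t); rewrite !big_ord1; apply => //.
by apply/trivIsetP => i j _ _; rewrite !ord1 eqxx.
Qed.

Lemma ac_within_continuous a b F : abs_continuous a b F ->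
  {within `[a, b], continuous F}.
Proof.
move=> aF; apply/subspace_continuousP => x /=; rewrite in_itv/= => /andP[ax xb].
apply/cvgrPdist_lt => e e0; have [d d0 H] := ac_continuous aF e0.
rewrite /prop_near1 /within/=; apply/nbhs_ballP; exists d => //= y xy.
rewrite /ball/= in xy; rewrite in_itv/= => /andP[ay yb].
have [yx|/ltW xy'] := leP y x.
  by apply: H => //; rewrite (le_lt_trans (ler_norm _)).
by rewrite distrC; apply: H => //; rewrite (le_lt_trans (ler_norm _))// distrC.
Qed.

Lemma ac_bounded a b F : abs_continuous a b F ->
  exists K, forall x, a <= x <= b -> `|F x| <= K.
Proof.
move=> /ac_within_continuous cF.
have [M [_ HM]] := compact_bounded (continuous_compact cF (@segment_compact _ a b)).
exists (M + 1) => x xab; apply: HM; first by rewrite ltrDl.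
by exists x => //=; rewrite in_itv.
Qed.

Lemma acD a b F G : abs_continuous a b F -> abs_continuous a b G ->
  abs_continuous a b (fun x => F x + G x).
Proof.
move=> aF aG; apply: (ac_dominated (K := 1) aF aG) => s t _ _ _.
by rewrite mul1r opprD addrACA ler_normD.
Qed.

Lemma acZ a b c F : abs_continuous a b F -> abs_continuous a b (fun x => c * F x).
Proof.
move=> aF; apply: (ac_dominated (K := `|c|) aF aF) => s t _ _ _.
by rewrite -mulrBr normrM ler_wpM2l// lerDl.
Qed.

Lemma acB a b F G : abs_continuous a b F -> abs_continuous a b G ->
  abs_continuous a b (fun x => F x - G x).
Proof.
move=> aF /(acZ (-1)) aG; have := acD aF aG.
by congr abs_continuous; apply/funext => x; rewrite mulN1r.
Qed.

Lemma acM a b F G : abs_continuous a b F -> abs_continuous a b G ->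
  abs_continuous a b (fun x => F x * G x).
Proof.
move=> aF aG; have [K HK] := ac_bounded aF; have [L HL] := ac_bounded aG.
apply: (ac_dominated (K := `|K| + `|L|) aF aG) => s t as_ st tb.
have -> : F t * G t - F s * G s = F t * (G t - G s) + G s * (F t - F s) by ring.
rewrite (le_trans (ler_normD _ _))// !normrM.
have h1 : `|F t| <= `|K| by rewrite (le_trans (HK _ _)) ?ler_norm// tb (le_trans as_).
have h2 : `|G s| <= `|L| by rewrite (le_trans (HL _ _)) ?ler_norm// as_ (le_trans st).
have := ler_wpM2r (normr_ge0 (G t - G s)) h1.
have := ler_wpM2r (normr_ge0 (F t - F s)) h2.
have := mulr_ge0 (normr_ge0 K) (normr_ge0 (F t - F s)).
have := mulr_ge0 (normr_ge0 L) (normr_ge0 (G t - G s)).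
by rewrite mulrDl !mulrDr; lra.
Qed.

Lemma ac_bounded_derivative a b F F' K : a <= b ->
  (forall x, a <= x <= b -> is_derive x (1 : R) F (F' x)) ->
  (forall x, a <= x <= b -> `|F' x| <= K) -> abs_continuous a b F.
Proof.
move=> ab dF HK; apply: (@ac_lipschitz _ _ _ K) => s t as_ st tb.
have [|x||c] := @MVT_segment _ F F' s t; first exact: st.
- rewrite in_itv/= => /andP[sx xt]; apply: dF.
  by rewrite (le_trans as_ (ltW sx)) (le_trans (ltW xt)).
- apply: derivable_within_continuous => x; rewrite in_itv/= => /andP[sx xt].
  have [] // : is_derive x (1 : R) F (F' x).
  by apply: dF; rewrite (le_trans as_ sx) (le_trans xt).
rewrite in_itv/= => /andP[sc ct] ->; rewrite normrM (ger0_norm (_ : 0 <= t - s)) ?subr_ge0//.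
by rewrite ler_wpM2r ?subr_ge0// HK// (le_trans as_ sc) (le_trans ct).
Qed.

(** [F - prim g] is absolutely continuous with derivative 0 almost everywhere, hence constant. *)
Lemma ac_ftc a b F g : 0 <= a -> a <= b -> locint g -> abs_continuous a b F ->
  {ae mu, forall x, a < x < b -> is_derive x (1 : R) F (g x)} ->
  F b - F a = prim g b - prim g a.
Proof.
move=> a0 ab lg aF dF.
suff : F b - prim g b = F a - prim g a by lra.
apply: (ac_derive0 ab (acB aF (prim_ac _ lg a0))).
apply: filterS2 dF (prim_derive lg) => x dF dg axb.
have x0 : 0 < x by rewrite (le_lt_trans a0)//; case/andP : axb.
have := is_deriveB (dF axb) (dg x0); rewrite subrr.
by [].
Qed.

Lemma prim_cvg0 g : locint g -> prim g x @[x --> 0^'+] --> (0 : R).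
Proof.
move=> lg; apply/cvgrPdist_lt => e e0.
have [d d0 H] := ac_continuous (prim_ac 1 lg (lexx 0)) e0.
near=> x; rewrite sub0r normrN.
have x0 : 0 < x by [].
have -> : prim g x = prim g x - prim g 0 by rewrite (prim_le0 _ (lexx 0)) subr0.
apply: H => //; first exact: ltW.
by rewrite subr0.
Unshelve. all: by end_near. Qed.

Lemma prim_continuous g x : locint g -> 0 < x -> {for x, continuous (prim g)}.
Proof.
move=> lg x0; apply/cvgrPdist_lt => e e0.
have [d d0 H] := ac_continuous (prim_ac (x + 1) lg (lexx 0)) e0.
near=> y.
have xy : `|x - y| < d by near: y; apply/nbhs_ballP; exists d.
have y0 : 0 < y by near: y; exact: lt_nbhsr.
have y1 : y < x + 1 by near: y; apply: lt_nbhsl; rewrite ltrDl.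
have [yx|/ltW yx] := leP y x.
  apply: H => //; first exact: ltW.
    by rewrite lerDl.
  by rewrite (le_lt_trans (ler_norm _)).
rewrite distrC; apply: H => //; try exact: ltW.
by rewrite (le_lt_trans (ler_norm _))// distrC.
Unshelve. all: by end_near. Qed.

Lemma locbnd_prim g : locint g -> locbnd (prim g).
Proof.
move=> lg X; split.
  apply: measurable_funS (_ : measurable_fun `[0, X] _) => //.
    by apply: subset_itvr; rewrite bnd_simp.
  apply: subspace_continuous_measurable_fun => //.
  exact/ac_within_continuous/prim_ac.
have [K HK] := ac_bounded (prim_ac X lg (lexx 0)).
by exists K => x /andP[x0 xX]; apply: HK; rewrite (ltW x0).
Qed.

End absolute_continuity.

(** * Hardy operators *)

Section hardy_operator.
Context {R : realType}.
Implicit Types (a b c e x y X : R) (f g : R -> R).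
Local Notation mu := (@lebesgue_measure R).

(** A weighted average up to normalisation: for $b\ge0$ the measure $y^b\,dy$ has mass
    $x^{b+1}/(b+1)$ on $]0,x]$. *)
Definition hardy b g x := x `^ (- b - 1) * prim (fun y => y `^ b * g y) x.

Lemma powR_norm x b : `|x `^ b| = x `^ b.
Proof. by rewrite ger0_norm// powR_ge0. Qed.

Lemma powRxN x b : 0 < x -> x `^ b * x `^ (- b) = 1.
Proof. by move=> x0; rewrite powRN mulfV// gt_eqF// powR_gt0. Qed.

Lemma powR_ler b x y : 0 <= b -> 0 < x -> x <= y -> x `^ b <= y `^ b.
Proof. by move=> b0 x0 xy; rewrite ge0_ler_powR// nnegrE (le_trans (ltW x0)). Qed.

Lemma powR_lerN b x y : 0 <= b -> 0 < x -> x <= y -> y `^ (- b) <= x `^ (- b).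
Proof.
move=> b0 x0 xy; rewrite !powRN lef_pV2 ?posrE ?powR_gt0//; first exact: powR_ler.
exact: lt_le_trans xy.
Qed.

Lemma powR_bounded b a c x : 0 < a -> a <= x <= c -> x `^ b <= a `^ b + c `^ b.
Proof.
move=> a0 /andP[ax xc]; have [b0|b0] := leP 0 b.
  by rewrite (le_trans (powR_ler b0 _ xc)) ?lerDr ?powR_ge0// (lt_le_trans a0).
have b0' : 0 <= - b by rewrite oppr_ge0 ltW.
have := powR_lerN b0' a0 ax; rewrite opprK => /le_trans; apply.
by rewrite lerDl powR_ge0.
Qed.

Lemma ac_powR b a c : 0 < a -> a <= c -> abs_continuous a c (fun x => x `^ b).
Proof.
move=> a0 ac; apply: (@ac_bounded_derivative _ _ _ _ (fun x => b * x `^ (b - 1))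
  (`|b| * (a `^ (b - 1) + c `^ (b - 1)))) => // x axc.
  by apply: is_derive1_powR; rewrite (lt_le_trans a0)//; case/andP: axc.
by rewrite normrM powR_norm ler_wpM2l// powR_bounded.
Qed.

Lemma locbnd_powR b : 0 <= b -> locbnd (fun x : R => x `^ b).
Proof.
move=> b0 X; split; first by apply: measurable_funTS; exact: measurable_powR.
by exists (X `^ b) => x /andP[x0 xX]; rewrite powR_norm powR_ler.
Qed.

Lemma locint_powRM b g : 0 <= b -> locint g -> locint (fun y => y `^ b * g y).
Proof.
move=> b0 lg; apply: locint_eq (locintM lg (locbnd_powR b0)) => x _.
by rewrite mulrC.
Qed.

Lemma eq_hardy b f g x : (forall y, 0 < y <= x -> f y = g y) ->
  hardy b f x = hardy b g x.
Proof. by move=> fg; congr (_ * _); apply: eq_prim => y /fg ->. Qed.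

Lemma hardyD b f g x : 0 <= b -> locint f -> locint g ->
  hardy b (fun y => f y + g y) x = hardy b f x + hardy b g x.
Proof.
move=> b0 lf lg; rewrite /hardy -mulrDr -primD; try exact: locint_powRM.
by congr (_ * _); apply: eq_prim => y _; rewrite mulrDr.
Qed.

Lemma hardyZ b c f x : 0 <= b -> locint f ->
  hardy b (fun y => c * f y) x = c * hardy b f x.
Proof.
move=> b0 lf; rewrite /hardy mulrCA -(primZ _ _ (locint_powRM b0 lf)).
by congr (_ * _); apply: eq_prim => y _; rewrite mulrCA.
Qed.

Lemma hardy_ge0 b f x : (forall y, 0 < y -> 0 <= f y) -> 0 <= hardy b f x.
Proof.
move=> f0; rewrite mulr_ge0 ?powR_ge0// prim_ge0// => y /andP[y0 _].
by rewrite mulr_ge0 ?powR_ge0 ?f0.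
Qed.

Lemma le_hardy b f g x : 0 <= b -> locint f -> locint g ->
  (forall y, 0 < y <= x -> f y <= g y) -> hardy b f x <= hardy b g x.
Proof.
move=> b0 lf lg fg; rewrite ler_wpM2l ?powR_ge0//.
by apply: le_prim; [exact: locint_powRM..|] => y /fg yx; rewrite ler_wpM2l ?powR_ge0.
Qed.

Lemma hardy_norm b f x : 0 <= b -> locint f ->
  `|hardy b f x| <= hardy b (fun y => `|f y|) x.
Proof.
move=> b0 lf; rewrite normrM powR_norm ler_wpM2l ?powR_ge0//.
rewrite (le_trans (prim_norm _ (locint_powRM b0 lf)))//.
by under eq_fun do rewrite normrM powR_norm.
Qed.

Lemma mulr_hardy b g x : 0 < x ->
  x * hardy b g x = x `^ (- b) * prim (fun y => y `^ b * g y) x.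
Proof.
move=> x0; rewrite /hardy mulrA; congr (_ * _).
rewrite powRB; last by rewrite (gt_eqF x0) implybT.
by rewrite powRr1 1?ltW// mulrC divfK// gt_eqF.
Qed.

(** The weight $(y/x)^b$ is at most 1 on $]0,x]$. *)
Lemma mulr_hardy_norm b g x : 0 <= b -> locint g -> 0 < x ->
  `|x * hardy b g x| <= prim (fun y => `|g y|) x.
Proof.
move=> b0 lg x0; rewrite mulr_hardy// normrM powR_norm.
rewrite (le_trans (ler_wpM2l (powR_ge0 _ _) (prim_norm _ (locint_powRM b0 lg))))//.
apply: (@le_trans _ _ (x `^ (- b) * (x `^ b * prim (fun y => `|g y|) x))); last first.
  by rewrite mulrA mulrC [_ `^ (- b) * _]mulrC powRxN// mulr1.
have lg' := locint_norm lg.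
rewrite ler_wpM2l ?powR_ge0// -primZ//; apply: le_prim.
- exact/locint_norm/locint_powRM.
- exact: locintZ.
- move=> y /andP[y0 yx]; rewrite normrM powR_norm ler_wpM2r//.
  exact: powR_ler.
Qed.

(** Provides the vanishing boundary term at 0 in [mulr_hardyE]. *)
Lemma mulr_hardy_cvg0 b g : 0 <= b -> locint g ->
  x * hardy b g x @[x --> 0^'+] --> (0 : R).
Proof.
move=> b0 lg; apply/norm_cvg0P.
apply: (squeeze_cvgr (f := fun=> 0) (h := prim (fun y => `|g y|))).
- near=> x; rewrite normr_ge0/= mulr_hardy_norm//.
- exact: cvg_cst.
- exact/prim_cvg0/locint_norm.
Unshelve. all: by end_near. Qed.

Lemma continuous_hardy b g x : 0 <= b -> locint g -> 0 < x ->
  {for x, continuous (hardy b g)}.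
Proof.
move=> b0 lg x0; rewrite /hardy; apply: continuousM.
  apply: differentiable_continuous; apply/derivable1_diffP.
  by have [] := is_derive1_powR (- b - 1) x0.
by apply: prim_continuous => //; exact: locint_powRM.
Qed.

Lemma measurable_hardy b g X : 0 <= b -> locint g ->
  measurable_fun `]0, X] (hardy b g).
Proof.
move=> b0 lg; apply: measurable_funM.
  by apply: measurable_funTS; exact: measurable_powR.
by have [] := locbnd_prim (locint_powRM b0 lg) X.
Qed.

(** By [mulr_hardy] the function is $t$ times [hardy b g t]; in this form it is a power times a
    primitive, and the product rule applies. *)
Lemma hardy_ae_derive b g : 0 <= b -> locint g ->
  {ae mu, forall x, 0 < x ->
    is_derive x (1 : R) (fun t => t `^ (- b) * prim (fun y => y `^ b * g y) t)
      (g x - b * hardy b g x)}.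
Proof.
move=> b0 lg; apply: filterS (prim_derive (locint_powRM b0 lg)) => x H x0.
apply: (is_derive_eq (is_deriveM (is_derive1_powR (- b) x0) (H x0))).
rewrite /GRing.scale/= /hardy.
have E : x `^ (- b) * x `^ b = 1 by rewrite mulrC powRxN.
by rewrite (mulrA _ _ (g x)) E; ring.
Qed.

Lemma ac_mulr_hardy b g a c : 0 <= b -> locint g -> 0 < a -> a <= c ->
  abs_continuous a c (fun t => t `^ (- b) * prim (fun y => y `^ b * g y) t).
Proof.
move=> b0 lg a0 ac; apply: acM; first exact: ac_powR.
by apply: prim_ac; [exact: locint_powRM|exact: ltW].
Qed.

(** The identity [mulr_hardyE] presupposes integrability at 0, so [hardy b g] is first cut off below
    [e]. Integrating the derivative of [x * hardy b g x] over [e, X] bounds the integral by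
    [prim g X / b] uniformly in [e], and monotone convergence removes the cutoff. *)
Lemma locint_hardy_ge0 b g : 0 < b -> locint g -> (forall y, 0 < y -> 0 <= g y) ->
  locint (hardy b g).
Proof.
move=> b0 lg g0; have b0' := ltW b0.
have H0 x : 0 <= hardy b g x by exact: hardy_ge0.
pose Hcut e x := if e < x then hardy b g x else 0.
have mHcut e X : measurable_fun `]0, X] (Hcut e).
  by apply: measurable_fun_if => //;
    [exact: measurable_fun_ltr|apply: measurable_funS (@measurable_hardy b g X b0' lg)].
have lcut e : 0 < e -> locint (Hcut e).
  move=> e0; apply: locbnd_locint => X; split; first exact: mHcut.
  exists (e `^ (- b - 1) * prim (fun y => y `^ b * g y) X) => x /andP[x0 xX].
  have p0 y : 0 < y -> 0 <= y `^ b * g y by move=> y0; rewrite mulr_ge0 ?powR_ge0 ?g0.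
  rewrite /Hcut; case: ifPn => ex; last first.
    by rewrite normr0 mulr_ge0 ?powR_ge0// prim_ge0// => y /andP[/p0].
  rewrite ger0_norm// /hardy ler_pM ?powR_ge0//.
  - by apply: prim_ge0 => y /andP[/p0].
  - rewrite -opprD; apply: powR_lerN => //; last exact: ltW.
    by rewrite addr_ge0.
  - by apply: prim_homo => //; exact: locint_powRM.
have cut_bound e X : 0 < e -> prim (Hcut e) X <= prim g X / b.
  move=> e0; have [Xe|eX] := leP X e.
    rewrite (@eq_prim _ _ (fun=> 0)).
      have [X0|X0] := leP X 0; first by rewrite !prim_le0// mul0r.
      by rewrite prim_cst ?(ltW X0)// mul0r divr_ge0// prim_ge0// => y /andP[/g0].
    by move=> y /andP[_ yX]; rewrite /Hcut ltNge (le_trans yX Xe).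
  have X0 : 0 < X by exact: lt_trans eX.
  have := ac_ftc (ltW e0) (ltW eX) (locintB lg (locintZ b (lcut e e0)))
    (ac_mulr_hardy b0' lg e0 (ltW eX)) _.
  move=> H; have {}H := H _.
  rewrite -!mulr_hardy// !primB ?primZ in H => //; try exact: lcut; try exact/locintZ/lcut.
  have E : prim (Hcut e) e = 0.
    rewrite (@eq_prim _ _ (fun=> 0)) ?prim_cst ?mul0r ?(ltW e0)//.
    by move=> y /andP[_ yX]; rewrite /Hcut ltNge yX.
  rewrite ler_pdivlMr// mulrC.
  have h1 : 0 <= X * hardy b g X by rewrite mulr_ge0// ltW.
  (* The boundary term at [e] is compensated by the part [prim g e] that is missing from the
     integral of [g] over [e, X]. *)
  have h2 : e * hardy b g e <= prim g e.
    rewrite (le_trans (ler_norm _))// (le_trans (mulr_hardy_norm b0' lg e0))//.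
    rewrite le_eqVlt (@eq_prim _ _ g) ?eqxx// => y /andP[y0 _].
    by rewrite ger0_norm// g0.
  have {}H : X * hardy b g X - e * hardy b g e =
      prim g X - b * prim (Hcut e) X - (prim g e - b * prim (Hcut e) e).
    apply: H; apply: filterS (hardy_ae_derive b0' lg) => x H /andP[ex _].
    by rewrite /Hcut ex; apply: H; exact: lt_trans ex.
  by move: H; rewrite E mulr0; lra.
move=> X; apply/integrableP; split.
  by apply/measurable_EFinP; exact: measurable_hardy.
under eq_integral do rewrite /= ger0_norm//.
apply: (@le_lt_trans _ _ (prim g X / b)%:E); last exact: ltry.
pose F n := `]n.+1%:R^-1, X]%classic : set R.
have FU : \bigcup_n F n = `]0, X]%classic.
  apply/seteqP; split => [x [n _]|x] /=; rewrite /F/= !in_itv/= => /andP[nx xX].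
    by rewrite xX (lt_trans _ nx)// invr_gt0.
  have [n _ /= nx'] := near_infty_natSinv_lt (PosNum nx).
  by exists n => //=; rewrite in_itv/= xX andbT; apply: nx' => /=.
rewrite -FU.
have ndF : nondecreasing_seq F.
  move=> m n mn; rewrite subsetEset => x /=; rewrite /F/= !in_itv/= => /andP[nx ->].
  by rewrite andbT (le_lt_trans _ nx)// lef_pV2 ?posrE// ler_nat ltnS.
have mF n : measurable (F n : set R) by exact: measurable_itv.
have mHF n : measurable_fun (F n) (EFin \o hardy b g).
  apply/measurable_EFinP; apply: measurable_funS (@measurable_hardy b g X b0' lg) => //.
  by rewrite -FU; exact: bigcup_sup.
have HF0 n x : F n x -> (0 <= (EFin \o hardy b g) x)%E by move=> _; rewrite lee_fin.
have cvgH := @ge0_nondecreasing_set_cvg_integral _ (measurableTypeR R) R F _ mu ndF mF mHF HF0.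
apply: (cvge_to_le cvgH); apply: nearW => n /=.
have n0 : 0 < n.+1%:R^-1 :> R by rewrite invr_gt0.
apply: (@le_trans _ _ (prim (Hcut n.+1%:R^-1) X)%:E); last by rewrite lee_fin cut_bound.
rewrite /prim /Rintegral fineK; last exact: integrable_fin_num (lcut _ n0 X).
rewrite (_ : F n = `]0, X]%classic `&` `]n.+1%:R^-1, +oo[).
  rewrite integral_mkcondr le_eqVlt; apply/orP; left; apply/eqP.
  apply: eq_integral => x _.
  by rewrite patchE /Hcut /= mem_setE in_itv/= andbT; case: ifP.
apply/seteqP; split => x /=; rewrite /F /= !in_itv/= andbT.
  by move=> /andP[nx ->]; rewrite nx (lt_trans n0).
by move=> [/andP[_ ->] ->].
Qed.

Lemma locint_hardy b g : 0 < b -> locint g -> locint (hardy b g).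
Proof.
move=> b0 lg; have b0' := ltW b0.
apply: locint_le (locint_hardy_ge0 b0 (locint_norm lg) _) => //.
- by move=> X; exact: measurable_hardy.
- move=> x x0; rewrite (le_trans (hardy_norm _ b0' lg))// ler_norm//.
Qed.

(** [F - prim g] is constant on every [e, x] and tends to 0 at 0, so absolute continuity is required
    only away from the singular endpoint. *)
Lemma ac_ftc0 F g x : locint g -> 0 < x ->
  (forall e, 0 < e -> e <= x -> abs_continuous e x F) ->
  {ae mu, forall t : R, 0 < t -> is_derive t (1 : R) F (g t)} ->
  F t @[t --> 0^'+] --> (0 : R) -> F x = prim g x.
Proof.
move=> lg x0 aF dF F0; apply/eqP; rewrite -subr_eq0; apply/eqP.
have cst e : 0 < e -> e <= x -> F e - prim g e = F x - prim g x.
  move=> e0 ex; have H := ac_ftc (ltW e0) ex lg (aF e e0 ex).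
  suff : F x - F e = prim g x - prim g e by lra.
  apply: H; apply: filterS dF => y H /andP[ey _].
  by apply: H; exact: lt_trans ey.
have c0 : (F e - prim g e) @[e --> 0^'+] --> (0 : R).
  rewrite -[X in _ --> X](subr0 0); apply: cvgB => //; exact: prim_cvg0.
have c1 : (F e - prim g e) @[e --> 0^'+] --> (F x - prim g x).
  apply: cvg_near_cst; near=> e; apply/cst => //.
  by near: e; exact: nbhs_right_le.
exact: (cvg_unique _ c1 c0).
Unshelve. all: by end_near. Qed.

Lemma mulr_hardyE b g x : 0 < b -> locint g -> 0 < x ->
  x * hardy b g x = prim (fun y => g y - b * hardy b g y) x.
Proof.
move=> b0 lg x0; have b0' := ltW b0; have lh := locint_hardy b0 lg.
rewrite mulr_hardy//.
apply: (@ac_ftc0 (fun t => t `^ (- b) * prim (fun y => y `^ b * g y) t)) => //.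
- by apply: locintB => //; exact: locintZ.
- by move=> e e0 ex; exact: ac_mulr_hardy.
- exact: hardy_ae_derive.
- apply: cvg_trans (mulr_hardy_cvg0 b0' lg); apply: near_eq_cvg; near=> t.
  by rewrite mulr_hardy.
Unshelve. all: by end_near. Qed.

(** Hardy's inequality in $L^1$ with constant $1/b$, read off [mulr_hardyE] by dropping the
    nonnegative left-hand side. *)
Lemma prim_hardy_le b g x : 0 < b -> locint g -> (forall y, 0 < y -> 0 <= g y) ->
  0 < x -> prim (hardy b g) x <= prim g x / b.
Proof.
move=> b0 lg g0 x0; have lh := locint_hardy b0 lg.
rewrite ler_pdivlMr// mulrC -subr_ge0 -primZ// -primB//; last exact: locintZ.
by rewrite -mulr_hardyE// mulr_ge0 ?hardy_ge0// ltW.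
Qed.

(** This is how the factors $x^{2k}$ are divided out without leaving negative powers of $x$. *)
Lemma mulr_hardyXn b n f x : 0 < x ->
  hardy b (fun y => y ^+ n * f y) x = x ^+ n * hardy (b + n%:R) f x.
Proof.
move=> x0; rewrite /hardy mulrA; congr (_ * _).
  rewrite -powR_mulrn ?ltW// -powRD; last by rewrite (gt_eqF x0) implybT.
  by congr (_ `^ _); ring.
apply: eq_prim => y /andP[y0 _].
rewrite mulrA; congr (_ * _); rewrite powRD; last by rewrite (gt_eqF y0) implybT.
by rewrite powR_mulrn// ltW.
Qed.

(* Integrating [y^b f] by parts gives
   [(b + 1) hardy b f = f - x hardy (b + 1) g], and [mulr_hardyE] applies. *)
Lemma hardy_prim b c f g x : 0 < b -> locint g ->
  (forall y, 0 < y -> f y = c + prim g y) -> 0 < x ->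
  hardy b f x = c / (b + 1) + prim (hardy (b + 1) g) x.
Proof.
move=> b0 lg fE x0; have b1 : 0 < b + 1 by rewrite addr_gt0.
have b1n0 : b + 1 != 0 by rewrite gt_eqF.
have lpg := locbnd_prim lg.
have lf : locbnd f.
  by apply: locbnd_eq (locbndD (locbnd_cst c) lpg) => y y0; rewrite fE.
have lh := locint_hardy b1 lg.
have lbf : locint (fun y => y `^ b * f y).
  by apply: locint_powRM; [exact: ltW|exact: locbnd_locint].
have lbg : locint (fun y => y `^ (b + 1) * g y) by apply: locint_powRM => //; exact: ltW.
have parts : x `^ (b + 1) * (c + prim g x) =
    prim (fun y => (b + 1) * (y `^ b * f y) + y `^ (b + 1) * g y) x.
  apply: (@ac_ftc0 (fun t => t `^ (b + 1) * (c + prim g t))) => //.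
  - by apply: locintD => //; exact: locintZ.
  - move=> e e0 ex; apply: acM; first exact: ac_powR.
    apply: acD; last by apply: prim_ac => //; exact: ltW.
    by apply: (@ac_lipschitz _ _ _ _ 0) => s t _ _ _; rewrite subrr normr0 mul0r.
  - apply: filterS (prim_derive lg) => y H y0.
    apply: (is_derive_eq (is_deriveM (is_derive1_powR (b + 1) y0)
      (is_deriveD (is_derive_cst c y 1) (H y0)))).
    by rewrite /GRing.scale/= fE// addrK -[(cst c + prim g) y]/(c + prim g y); ring.
  - rewrite -[X in _ --> X](mul0r (c + 0)); apply: cvgM; first exact: powR_cvg0.
    by apply: cvgD; [exact: cvg_cst|exact: prim_cvg0].
rewrite primD// in parts; last exact: locintZ.
rewrite primZ// in parts.
have E : (b + 1) * hardy b f x = (c + prim g x) - x * hardy (b + 1) g x.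
  rewrite mulr_hardy// /hardy (_ : - b - 1 = - (b + 1)); last by ring.
  have -> : c + prim g x = x `^ (- (b + 1)) * (x `^ (b + 1) * (c + prim g x)).
    by rewrite mulrA [_ `^ (- _) * _]mulrC powRxN// mul1r.
  by rewrite parts; ring.
rewrite mulr_hardyE// primB ?primZ// in E; last exact: locintZ.
by apply: (mulfI b1n0); rewrite E; field.
Qed.

End hardy_operator.

(** * Gronwall's lemma and Volterra equations *)

Section gronwall.
Context {R : realType}.
Implicit Types (a b c x y X : R) (k u : R -> R).
Local Notation mu := (@lebesgue_measure R).

Lemma expR_sub_le a b : expR b - expR a <= expR b * (b - a).
Proof.
have := expR_ge1Dx (a - b); rewrite expRD expRN => H.
have := ler_wpM2l (ltW (expR_gt0 b)) H.
by rewrite mulrCA mulfV ?gt_eqF ?expR_gt0// mulr1; lra.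
Qed.

(** A weight of Bielecki type: the factor 2 in the exponent produces the factor 1/2 in
    [prim_expprim]. *)
Definition expprim k x := expR (2 * prim k x).

Lemma expprim_gt0 k x : 0 < expprim k x. Proof. exact: expR_gt0. Qed.

Lemma expprim_ge1 k x : (forall y, 0 < y -> 0 <= k y) -> 1 <= expprim k x.
Proof.
move=> k0; rewrite -expR0 ler_expR mulr_ge0// prim_ge0// => y /andP[/k0//].
Qed.

Lemma expprim_homo k x y : locint k -> (forall y, 0 < y -> 0 <= k y) ->
  x <= y -> expprim k x <= expprim k y.
Proof. by move=> lk k0 xy; rewrite ler_expR ler_wpM2l// prim_homo. Qed.

Lemma locbnd_expprim k : locint k -> (forall y, 0 < y -> 0 <= k y) ->
  locbnd (expprim k).
Proof.
move=> lk k0 X; split.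
  apply: measurableT_comp => //; apply: measurable_funM => //.
  by have [] := locbnd_prim lk X.
exists (expprim k X) => x /andP[_ xX].
rewrite ger0_norm; last exact/ltW/expprim_gt0.
exact: expprim_homo.
Qed.

(** The integrand is almost everywhere the derivative of [expprim k / 2], which is absolutely
    continuous because its increments on [0, x] are dominated by those of [prim k]. *)
Lemma prim_expprim k x : locint k -> (forall y, 0 < y -> 0 <= k y) -> 0 < x ->
  prim (fun y => k y * expprim k y) x <= expprim k x / 2.
Proof.
move=> lk k0 x0.
have lkE : locint (fun y => k y * expprim k y).
  by apply: locintM => //; exact: locbnd_expprim.
have aE : abs_continuous 0 x (fun y => expprim k y / 2).
  have aQ := prim_ac x lk (lexx 0).
  apply: (ac_dominated (K := expprim k x) aQ aQ) => s t s0 st tx.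
  have Qst : prim k s <= prim k t by exact: prim_homo.
  rewrite -mulrBl ger0_norm; last first.
    by rewrite mulr_ge0// subr_ge0 ler_expR ler_wpM2l.
  rewrite ger0_norm ?subr_ge0//.
  have := expR_sub_le (2 * prim k s) (2 * prim k t); rewrite -!/(expprim k _).
  have := expprim_homo lk k0 tx.
  rewrite -(ler_pM2r (_ : 0 < 2^-1))// => h1 h2.
  have h3 : expprim k t * (prim k t - prim k s) <= expprim k x * (prim k t - prim k s).
    by apply: ler_wpM2r; [rewrite subr_ge0|exact: expprim_homo].
  have h4 : 0 <= expprim k x * (prim k t - prim k s).
    by rewrite mulr_ge0 ?subr_ge0// ltW// expprim_gt0.
  move: h2 h3 h4; move: (expprim k t) (expprim k s) (expprim k x) (prim k t) (prim k s).
  by move=> et es ex pt ps; lra.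
have -> : prim (fun y => k y * expprim k y) x = expprim k x / 2 - expprim k 0 / 2.
  have := ac_ftc (lexx 0) (ltW x0) lkE aE; rewrite (prim_le0 _ (lexx 0)) subr0.
  move=> -> //; apply: filterS (prim_derive lk) => y H /andP[y0 _].
  have d1 := is_deriveZ 2 (H y0).
  have d2 := is_derive1_comp (is_derive_expR _) d1.
  have d3 := is_deriveZ 2^-1 d2.
  rewrite (_ : (fun _ => _) = 2^-1 \*: (expR \o 2 \*: prim k)); last first.
    by apply/funext => t; rewrite /= mulrC.
  by apply: (is_derive_eq d3); rewrite /GRing.scale/= /GRing.scale/= /expprim; field.
by rewrite gerBl divr_ge0// ltW// expprim_gt0.
Qed.

(** Iteration replaces the integrating factor: with $E$ = [expprim k], the bound $u\le cE$ implies
    $u\le(G+c/2)E$, and the constants tend to the fixed point $2G$. *)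
Lemma gronwall k u G X x : locint k -> (forall y, 0 < y -> 0 <= k y) ->
  locbnd u -> 0 <= G ->
  (forall y, 0 < y <= X -> u y <= G + prim (fun t => k t * u t) y) ->
  0 < x <= X -> u x <= 2 * G * expprim k x.
Proof.
move=> lk k0 lu G0 Hu x0X.
have [_ [K HK]] := lu X.
have K0 : 0 <= K by rewrite (le_trans _ (HK _ x0X)).
have lE := locbnd_expprim lk k0.
have it n : forall y, 0 < y <= X -> u y <= (2 * G + K * 2^-1 ^+ n) * expprim k y.
  elim: n => [|n IH] y yX.
    have h1 : u y <= K by rewrite (le_trans (ler_norm _))// HK.
    rewrite expr0 mulr1 (le_trans h1)//.
    have := ler_wpM2l K0 (expprim_ge1 y k0); rewrite mulr1 => /le_trans; apply.
    by rewrite ler_wpM2r ?lerDr ?(ltW (expprim_gt0 _ _))// mulr_ge0.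
  set c := 2 * G + K * 2^-1 ^+ n in IH.
  have c0 : 0 <= c by rewrite addr_ge0// mulr_ge0// exprn_ge0.
  have h : prim (fun t => k t * u t) y <= c * (expprim k y / 2).
    have yX' : 0 < y by case/andP: yX.
    apply: (@le_trans _ _ (prim (fun t => c * (k t * expprim k t)) y)).
      apply: le_prim; [exact: locintM|exact/locintZ/locintM|].
      move=> t /andP[t0 ty]; rewrite mulrCA ler_wpM2l ?k0// IH// t0 (le_trans ty)//.
      by case/andP: yX.
    by rewrite primZ ?ler_wpM2l ?prim_expprim//; exact: locintM.
  have := Hu _ yX; rewrite exprS => h1.
  have h2 : G <= G * expprim k y by rewrite ler_peMr// expprim_ge1.
  by move: h h1 h2; rewrite /c; lra.
have cv : (2 * G + K * 2^-1 ^+ n) * expprim k x @[n --> \oo] --> (2 * G + K * 0) * expprim k x.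
  apply: cvgM; last exact: cvg_cst.
  apply: cvgD; first exact: cvg_cst.
  apply: cvgM; first exact: cvg_cst.
  by apply: cvg_expr; rewrite ger0_norm// invf_lt1// ltr1n.
rewrite mulr0 addr0 in cv.
by apply: (cvgr_to_ge cv); apply: nearW => n; exact: it.
Qed.

End gronwall.

(** * Complex-valued functions of a real variable *)

Section complex_functions.
Context {R : realType}.
Implicit Types (x y X : R) (z w c : cplx R) (f g : R -> cplx R).

(* A norm on R[i] that is submultiplicative and splits over the components. *)
Definition norm1 z : R := `|complex.Re z| + `|complex.Im z|.

Lemma norm1_ge0 z : 0 <= norm1 z. Proof. by rewrite addr_ge0. Qed.

Lemma norm1_eq0 z : norm1 z <= 0 -> z = 0.
Proof.
case: z => a b; rewrite /norm1/= => ab0; have := normr_ge0 a; have := normr_ge0 b => b0 a0.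
have /eqP : `|a| = 0 by lra.
have /eqP : `|b| = 0 by lra.
by rewrite !normr_eq0 => /eqP -> /eqP ->.
Qed.

Lemma norm10 : norm1 0 = 0. Proof. by rewrite /norm1/= !normr0 addr0. Qed.

Lemma norm1N z : norm1 (- z) = norm1 z.
Proof. by case: z => a b; rewrite /norm1/= !normrN. Qed.

Lemma norm1D z w : norm1 (z + w) <= norm1 z + norm1 w.
Proof.
by case: z => a b; case: w => c d; rewrite /norm1/= addrACA lerD// ler_normD.
Qed.

Lemma norm1B z w : norm1 (z - w) <= norm1 z + norm1 w.
Proof. by rewrite (le_trans (norm1D _ _))// norm1N. Qed.

Lemma norm1M z w : norm1 (z * w) <= norm1 z * norm1 w.
Proof.
case: z => a b; case: w => c d; rewrite /norm1/=.
have h1 := ler_normB (a * c) (b * d); have h2 := ler_normD (a * d) (b * c).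
by rewrite !normrM in h1 h2; move: h1 h2; nra.
Qed.

Lemma norm1_real (a : R) : norm1 (a%:C)%C = `|a|.
Proof. by rewrite /norm1/= normr0 addr0. Qed.

Lemma norm1_Zreal (a : R) z : norm1 ((a%:C)%C * z) = `|a| * norm1 z.
Proof. by case: z => b c; rewrite /norm1/= !mul0r subr0 addr0 !normrM mulrDr. Qed.

Lemma norm1X z n : norm1 (z ^+ n) <= norm1 z ^+ n.
Proof.
elim: n => [|n IH]; first by rewrite !expr0 /norm1/= normr1 normr0 addr0.
by rewrite !exprS (le_trans (norm1M _ _))// ler_wpM2l// norm1_ge0.
Qed.

Lemma complex_ReIm z : z = (complex.Re z +i* complex.Im z)%C.
Proof. by case: z. Qed.

Definition clocint f := locint (cRe f) /\ locint (cIm f).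
Definition clocbnd f := locbnd (cRe f) /\ locbnd (cIm f).

Lemma cReD f g : cRe (fun x => f x + g x) = fun x => cRe f x + cRe g x.
Proof. by apply/funext => x; rewrite /cRe; case: (f x); case: (g x). Qed.

Lemma cImD f g : cIm (fun x => f x + g x) = fun x => cIm f x + cIm g x.
Proof. by apply/funext => x; rewrite /cIm; case: (f x); case: (g x). Qed.

Lemma cReB f g : cRe (fun x => f x - g x) = fun x => cRe f x - cRe g x.
Proof. by apply/funext => x; rewrite /cRe; case: (f x); case: (g x). Qed.

Lemma cImB f g : cIm (fun x => f x - g x) = fun x => cIm f x - cIm g x.
Proof. by apply/funext => x; rewrite /cIm; case: (f x); case: (g x). Qed.

Lemma cReM f g : cRe (fun x => f x * g x) = fun x => cRe f x * cRe g x - cIm f x * cIm g x.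
Proof. by apply/funext => x; rewrite /cRe/cIm; case: (f x); case: (g x). Qed.

Lemma cImM f g : cIm (fun x => f x * g x) = fun x => cRe f x * cIm g x + cIm f x * cRe g x.
Proof. by apply/funext => x; rewrite /cRe/cIm; case: (f x); case: (g x). Qed.

Lemma clocint_eq f g : (forall x, 0 < x -> f x = g x) -> clocint f -> clocint g.
Proof.
by move=> fg [lf1 lf2]; split; [apply: locint_eq lf1|apply: locint_eq lf2] => x x0;
  rewrite /cRe /cIm fg.
Qed.

Lemma clocbnd_eq f g : (forall x, 0 < x -> f x = g x) -> clocbnd f -> clocbnd g.
Proof.
by move=> fg [lf1 lf2]; split; [apply: locbnd_eq lf1|apply: locbnd_eq lf2] => x x0;
  rewrite /cRe /cIm fg.
Qed.

Lemma clocintD f g : clocint f -> clocint g -> clocint (fun x => f x + g x).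
Proof. by move=> [? ?] [? ?]; split; rewrite ?cReD ?cImD; exact: locintD. Qed.

Lemma clocintB f g : clocint f -> clocint g -> clocint (fun x => f x - g x).
Proof. by move=> [? ?] [? ?]; split; rewrite ?cReB ?cImB; exact: locintB. Qed.

Lemma clocbndD f g : clocbnd f -> clocbnd g -> clocbnd (fun x => f x + g x).
Proof. by move=> [? ?] [? ?]; split; rewrite ?cReD ?cImD; exact: locbndD. Qed.

Lemma clocbndB f g : clocbnd f -> clocbnd g -> clocbnd (fun x => f x - g x).
Proof. by move=> [? ?] [? ?]; split; rewrite ?cReB ?cImB; exact: locbndB. Qed.

Lemma clocbnd_cst c : clocbnd (fun=> c).
Proof. by split; exact: locbnd_cst. Qed.

Lemma clocbnd_real (h : R -> R) : locbnd h -> clocbnd (fun x => (h x)%:C%C : cplx R).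
Proof. by move=> lh; split => //; exact: locbnd_cst. Qed.

Lemma clocint_real (h : R -> R) : locint h -> clocint (fun x => (h x)%:C%C : cplx R).
Proof. by move=> lh; split => //; exact/locbnd_locint/locbnd_cst. Qed.

Lemma clocbnd_clocint f : clocbnd f -> clocint f.
Proof. by move=> [? ?]; split; exact: locbnd_locint. Qed.

Lemma clocbndM f g : clocbnd f -> clocbnd g -> clocbnd (fun x => f x * g x).
Proof.
move=> [? ?] [? ?]; split; rewrite ?cReM ?cImM.
  by apply: locbndB; exact: locbndM.
by apply: locbndD; exact: locbndM.
Qed.

Lemma clocintM f g : clocint f -> clocbnd g -> clocint (fun x => f x * g x).
Proof.
move=> [? ?] [? ?]; split; rewrite ?cReM ?cImM.
  by apply: locintB; exact: locintM.
by apply: locintD; exact: locintM.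
Qed.

Lemma clocintZ c f : clocint f -> clocint (fun x => c * f x).
Proof.
move=> lf; apply: clocint_eq (clocintM lf (clocbnd_cst c)) => x _.
by rewrite mulrC.
Qed.

Lemma locint_norm1 f : clocint f -> locint (fun x => norm1 (f x)).
Proof. by move=> [? ?]; apply: locintD; exact: locint_norm. Qed.

Lemma locbnd_norm (h : R -> R) : locbnd h -> locbnd (fun x => `|h x|).
Proof.
move=> lh X; have [mh [K HK]] := lh X; split; first exact: measurableT_comp.
by exists K => x xX; rewrite normr_id HK.
Qed.

Lemma locbnd_norm1 f : clocbnd f -> locbnd (fun x => norm1 (f x)).
Proof. by move=> [? ?]; apply: locbndD; exact: locbnd_norm. Qed.

Lemma clocbnd_sum (F : nat -> R -> cplx R) n : (forall i, clocbnd (F i)) ->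
  clocbnd (fun x => \sum_(0 <= i < n) F i x).
Proof.
move=> lF; elim: n => [|n IH].
  by apply: clocbnd_eq (clocbnd_cst 0) => x _; rewrite big_geq.
by apply: clocbnd_eq (clocbndD IH (lF n)) => x _; rewrite big_nat_recr.
Qed.

End complex_functions.

(** * Series with a geometric majorant *)

Section geometric_series.
Context {R : realType}.

Lemma geometric_cvg (u : nat -> R) C : (forall n, `|u n| <= C * 2^-1 ^+ n) ->
  cvgn (series u).
Proof.
move=> uC; have C0 : 0 <= C by have := uC 0%N; rewrite expr0 mulr1; exact: le_trans.
apply: normed_cvg; apply: (series_le_cvg _ _ uC).
- by move=> i; exact: normr_ge0.
- by move=> i; rewrite mulr_ge0// exprn_ge0.
- by apply: is_cvg_geometric_series; rewrite ger0_norm// invf_lt1// ltr1n.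
Qed.

Lemma geometric_tail (u : nat -> R) C : (forall n, `|u n| <= C * 2^-1 ^+ n) ->
  forall n, `|limn (series u) - \sum_(0 <= i < n) u i| <= 2 * C * 2^-1 ^+ n.
Proof.
move=> uC n.
have C0 : 0 <= C by have := uC 0%N; rewrite expr0 mulr1; exact: le_trans.
(* The factor $1-2^{-k}$ makes the induction on [k] close exactly; it is dropped in the limit. *)
have tail k : `|\sum_(0 <= i < n + k) u i - \sum_(0 <= i < n) u i| <=
    2 * C * 2^-1 ^+ n * (1 - 2^-1 ^+ k).
  elim: k => [|k IH]; first by rewrite addn0 subrr normr0 expr0 subrr mulr0.
  rewrite addnS big_nat_recr//= addrAC (le_trans (ler_normD _ _))//.
  have := uC (n + k)%N; rewrite exprD exprS => h.
  by move: IH h; lra.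
have cu := geometric_cvg uC.
have cv : `|series u (n + k)%N - \sum_(0 <= i < n) u i| @[k --> \oo] -->
    `|limn (series u) - \sum_(0 <= i < n) u i|.
  apply: cvg_norm; apply: cvgB; last exact: cvg_cst.
  rewrite (_ : (fun k => _) = fun k => series u (k + n)%N); last first.
    by apply/funext => k; rewrite addnC.
  by rewrite (cvg_shiftn n (series u)); exact: cu.
apply: (cvgr_to_le cv); apply: nearW => k; rewrite /series/=.
rewrite (le_trans (tail k))// ler_piMr ?mulr_ge0 ?exprn_ge0//.
Qed.

End geometric_series.

(** * Abstract Volterra equations *)

Section volterra.
Context {R : realType}.
Implicit Types (x y X : R) (f g : R -> cplx R).

Variables (k : R -> R) (T : (R -> cplx R) -> R -> cplx R).
Hypotheses (lk : locint k) (k0 : forall y, 0 < y -> 0 <= k y).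
Hypothesis T_bnd : forall f, clocbnd f -> clocbnd (T f).
Hypothesis TD : forall f g x, 0 < x -> clocbnd f -> clocbnd g ->
  T (fun y => f y + g y) x = T f x + T g x.
Hypothesis TB : forall f g x, 0 < x -> clocbnd f -> clocbnd g ->
  T (fun y => f y - g y) x = T f x - T g x.
Hypothesis T_le : forall f x, 0 < x -> clocbnd f ->
  norm1 (T f x) <= prim (fun y => k y * norm1 (f y)) x.

Lemma T_expprim f x c : clocbnd f -> 0 < x ->
  (forall y, 0 < y <= x -> norm1 (f y) <= c * expprim k y) ->
  norm1 (T f x) <= c * expprim k x / 2.
Proof using lk k0 T_le.
move=> lf x0 fc; rewrite (le_trans (T_le x0 lf))//.
have lE := locbnd_expprim lk k0; have lkE := locintM lk lE.
have c0 : 0 <= c.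
  have := fc x; rewrite x0 lexx => /(_ isT) h.
  have := le_trans (norm1_ge0 _) h; rewrite pmulr_lge0//; exact: expprim_gt0.
apply: (@le_trans _ _ (prim (fun t => c * (k t * expprim k t)) x)).
  apply: le_prim; [|exact/locintZ|].
    by apply: locintM => //; exact: locbnd_norm1.
  by move=> t /andP[t0 tx]; rewrite mulrCA ler_wpM2l ?k0// fc// t0.
by rewrite primZ// -mulrA ler_wpM2l ?prim_expprim.
Qed.

(* Neumann series: the weight [expprim k] makes [T] a contraction of factor 1/2. *)
Lemma volterra_exists g (G : R -> R) : clocbnd g ->
  (forall x y, 0 < x -> x <= y -> G x <= G y) ->
  (forall x, 0 < x -> norm1 (g x) <= G x) ->
  exists w, [/\ clocbnd w, forall x, 0 < x -> w x = g x + T w x &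
    forall x, 0 < x -> norm1 (w x) <= 2 * G x * expprim k x].
Proof using lk k0 T_bnd TD TB T_le.
move=> lg Gh gG; pose u n := iter n T g.
have lu n : clocbnd (u n) by elim: n => //= n; exact: T_bnd.
have G0 x : 0 < x -> 0 <= G x by move=> x0; rewrite (le_trans (norm1_ge0 _) (gG x x0)).
have E0 x := ltW (expprim_gt0 k x).
(* Monotonicity of [G] turns the bounds at all [y <= x] into one with the constant [G x], as
   [T_expprim] requires. *)
have uG n x : 0 < x -> norm1 (u n x) <= G x * 2^-1 ^+ n * expprim k x.
  elim: n x => [|n IH] x x0.
    rewrite expr0 mulr1 (le_trans (gG _ x0))// ler_peMr ?G0//.
    exact: expprim_ge1.
  rewrite (le_trans (T_expprim (c := G x * 2^-1 ^+ n) (lu n) x0 _))//.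
    move=> y /andP[y0 yx]; rewrite (le_trans (IH _ y0))// ler_wpM2r//.
    by rewrite ler_wpM2r ?exprn_ge0// Gh.
  by rewrite exprS le_eqVlt; apply/orP; left; apply/eqP; field.
pose S n x := \sum_(0 <= i < n) u i x.
have lS n : clocbnd (S n) by exact: clocbnd_sum.
have SRe n x : complex.Re (S n x) = \sum_(0 <= i < n) complex.Re (u i x).
  elim: n => [|n IH]; first by rewrite /S !big_geq.
  rewrite [RHS]big_nat_recr//= -IH /S big_nat_recr//= -/(S n x).
  by case: (u n x) => ? ?; case: (S n x).
have SIm n x : complex.Im (S n x) = \sum_(0 <= i < n) complex.Im (u i x).
  elim: n => [|n IH]; first by rewrite /S !big_geq.
  rewrite [RHS]big_nat_recr//= -IH /S big_nat_recr//= -/(S n x).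
  by case: (u n x) => ? ?; case: (S n x).
pose w x : cplx R := (limn (series (fun i => complex.Re (u i x)))
  +i* limn (series (fun i => complex.Im (u i x))))%C.
have uRe x : 0 < x -> forall i, `|complex.Re (u i x)| <= G x * expprim k x * 2^-1 ^+ i.
  by move=> x0 i; rewrite mulrAC (le_trans _ (uG i x x0))// lerDl.
have uIm x : 0 < x -> forall i, `|complex.Im (u i x)| <= G x * expprim k x * 2^-1 ^+ i.
  by move=> x0 i; rewrite mulrAC (le_trans _ (uG i x x0))// lerDr.
(* The constant is 4 because the geometric tail bound, with its factor 2, is used once for each
   component. *)
have wS n x : 0 < x -> norm1 (w x - S n x) <= 4 * G x * 2^-1 ^+ n * expprim k x.
  move=> x0; have := geometric_tail (uRe x x0) n; have := geometric_tail (uIm x x0) n.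
  rewrite -SRe -SIm /norm1 /w; case: (S n x) => a b /=; lra.
have w_le x : 0 < x -> norm1 (w x) <= 2 * G x * expprim k x.
  move=> x0; have h1 i : `|complex.Re (u i x)| + `|complex.Im (u i x)| <= G x * expprim k x * 2^-1 ^+ i.
    by rewrite mulrAC; exact: uG.
  (* Bounding the partial sums in [norm1] keeps the constant 2, where componentwise tails would give
     4; [coef_bound] relies on this 2. *)
  have Sle n : norm1 (S n x) <= 2 * G x * expprim k x.
    apply: (@le_trans _ _ (2 * G x * expprim k x * (1 - 2^-1 ^+ n))); last first.
      by rewrite ler_piMr ?mulr_ge0 ?G0// lerBlDr lerDl exprn_ge0.
    elim: n => [|n IH]; first by rewrite /S big_geq// norm10 expr0 subrr mulr0.
    rewrite /S big_nat_recr//= (le_trans (norm1D _ _))// -/(S n x).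
    by have := uG n x x0; rewrite exprS; move: IH; lra.
  have cv : 2 * G x * expprim k x + 4 * G x * 2^-1 ^+ n * expprim k x @[n --> \oo]
      --> 2 * G x * expprim k x + 4 * G x * 0 * expprim k x.
    apply: cvgD; first exact: cvg_cst.
    apply: cvgM; last exact: cvg_cst.
    apply: cvgM; first exact: cvg_cst.
    by apply: cvg_expr; rewrite ger0_norm// invf_lt1// ltr1n.
  rewrite mulr0 mul0r addr0 in cv.
  apply: (cvgr_to_ge cv); apply: nearW => n.
  by rewrite -(subrK (S n x) (w x)) addrC (le_trans (norm1D _ _))// lerD// wS.
have lw : clocbnd w.
  have bnd X : exists K, forall x, 0 < x <= X -> norm1 (w x) <= K.
    exists (2 * G X * expprim k X) => x /andP[x0 xX].
    apply: le_trans (w_le x x0) _; apply: ler_pM; [|exact: E0| |exact: expprim_homo].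
      by apply: mulr_ge0; [exact: ler0n|exact: G0].
    by apply: ler_wpM2l; [exact: ler0n|exact: Gh].
  split=> X; have [K HK] := bnd X.
  - split; last by exists K => x xX; rewrite (le_trans _ (HK x xX))// lerDl.
    apply: (@measurable_fun_cvg _ _ _ _ (fun n => cRe (S n))).
      by move=> n; have [/(_ X)[]] := lS n.
    move=> x; rewrite /= in_itv/= => /andP[x0 _].
    by rewrite /cRe; under eq_fun do rewrite SRe; exact: geometric_cvg (uRe x x0).
  - split; last by exists K => x xX; rewrite (le_trans _ (HK x xX))// lerDr.
    apply: (@measurable_fun_cvg _ _ _ _ (fun n => cIm (S n))).
      by move=> n; have [_ /(_ X)[]] := lS n.
    move=> x; rewrite /= in_itv/= => /andP[x0 _].
    by rewrite /cIm; under eq_fun do rewrite SIm; exact: geometric_cvg (uIm x x0).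
exists w; split => // x x0.
apply/eqP; rewrite -subr_eq0; apply/eqP; apply: norm1_eq0.
(* The partial sums satisfy the equation with a shifted index; the equation for [w] follows in the
   limit because [T] halves the weighted tails. *)
have TS n : S n.+1 x = g x + T (S n) x.
  elim: n => [|n IH].
    have -> : S 0%N = fun=> 0 by apply/funext => y; rewrite /S big_geq.
    have := TB x0 (clocbnd_cst 0) (clocbnd_cst 0); rewrite !subrr => ->.
    by rewrite /S big_nat1 addr0.
  have -> : S n.+1 = fun y => S n y + u n y.
    by apply/funext => y; rewrite /S big_nat_recr.
  by rewrite TD// addrA -IH [LHS]/S big_nat_recr.
have cv : 4 * G x * 2^-1 ^+ n * expprim k x @[n --> \oo]
    --> 4 * G x * 0 * expprim k x.
  apply: cvgM; last exact: cvg_cst.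
  apply: cvgM; first exact: cvg_cst.
  by apply: cvg_expr; rewrite ger0_norm// invf_lt1// ltr1n.
rewrite mulr0 mul0r in cv.
apply: (cvgr_to_ge cv); apply: nearW => n.
have -> : w x - (g x + T w x) = (w x - S n.+1 x) - (T (fun y => w y - S n y) x).
  by rewrite TB// TS; ring.
rewrite (le_trans (norm1B _ _))//.
have h1 := wS n.+1 x x0.
have h2 : norm1 (T (fun y => w y - S n y) x) <= 4 * G x * 2^-1 ^+ n * expprim k x / 2.
  apply: (T_expprim (clocbndB lw (lS n)) x0) => y /andP[y0 yx].
  apply: le_trans (wS n y y0) _; apply: ler_wpM2r; first exact: E0.
  apply: ler_wpM2r; first by rewrite exprn_ge0.
  by apply: ler_wpM2l; [exact: ler0n|exact: Gh].
by rewrite exprS in h1; move: h1 h2; lra.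
Qed.

End volterra.

(** * The recursion for the coefficients *)

(** The next coefficient is constructed only from one already known to be bounded, so the invariant
    [P] travels with the choice. *)
Lemma nat_dependent_choice (T : Type) (P : nat -> T -> Prop)
    (Q : nat -> T -> T -> Prop) t0 : P 0%N t0 ->
  (forall k t, P k t -> exists t', P k.+1 t' /\ Q k t t') ->
  exists a : nat -> T, a 0%N = t0 /\ forall k, P k (a k) /\ Q k (a k) (a k.+1).
Proof.
move=> P0 H.
have /choice[F HF] : forall kt : nat * T, exists t',
    P kt.1 kt.2 -> P kt.1.+1 t' /\ Q kt.1 kt.2 t'.
  move=> [k t]; have [Pkt|nP] := pselect (P k t); last by exists t.
  by have [t' ?] := H k t Pkt; exists t'.
pose a := fix a k := if k is k'.+1 then F (k', a k') else t0.
exists a; split => //.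
have aP k : P k (a k).
  by elim: k => // k IH; have [] := HF (k, a k) IH.
by move=> k; split => //; have [] := HF (k, a k) (aP k).
Qed.

(** * Hardy and Volterra operators on complex-valued functions *)

Section componentwise_operators.
Context {R : realType}.
Implicit Types (b x X : R) (c : cplx R) (f g : R -> cplx R).
Local Notation mu := (@lebesgue_measure R).

Definition capp (A : (R -> R) -> R -> R) f : R -> cplx R :=
  fun x => (A (cRe f) x +i* A (cIm f) x)%C.

Section linear.
Variable A : (R -> R) -> R -> R.
Hypothesis AD : forall (f g : R -> R) x, locint f -> locint g ->
  A (fun y => f y + g y) x = A f x + A g x.
Hypothesis AZ : forall a (f : R -> R) x, locint f -> A (fun y => a * f y) x = a * A f x.

Lemma cappD f g x : clocint f -> clocint g ->
  capp A (fun y => f y + g y) x = capp A f x + capp A g x.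
Proof using AD. by move=> [? ?] [? ?]; rewrite /capp cReD cImD !AD. Qed.

Lemma cappZ c f x : clocint f -> capp A (fun y => c * f y) x = c * capp A f x.
Proof using AD AZ.
case: c => c d [l1 l2]; rewrite /capp cReM cImM.
have -> : (fun y => cRe (fun=> (c +i* d)%C) y * cRe f y - cIm (fun=> (c +i* d)%C) y * cIm f y)
  = fun y => c * cRe f y + (- d) * cIm f y by apply/funext => y; rewrite mulNr.
rewrite AD; [|exact: locintZ..]; rewrite AZ// AZ//.
rewrite AD; [|exact: locintZ..]; rewrite AZ// AZ//.
by apply/eqP; rewrite eq_complex /= mulNr !eqxx.
Qed.

Lemma cappB f g x : clocint f -> clocint g ->
  capp A (fun y => f y - g y) x = capp A f x - capp A g x.
Proof using AD AZ.
move=> lf lg; have lg' := clocintZ (-1) lg.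
have -> : (fun y => f y - g y) = fun y => f y + -1 * g y.
  by apply/funext => y; rewrite mulN1r.
by rewrite cappD// cappZ// mulN1r.
Qed.

End linear.

Definition chardy b := capp (hardy b).
Definition cprim := capp prim.

Lemma chardyD b f g x : 0 <= b -> clocint f -> clocint g ->
  chardy b (fun y => f y + g y) x = chardy b f x + chardy b g x.
Proof. by move=> b0; apply: cappD => *; exact: hardyD. Qed.

Lemma chardyB b f g x : 0 <= b -> clocint f -> clocint g ->
  chardy b (fun y => f y - g y) x = chardy b f x - chardy b g x.
Proof. by move=> b0; apply: cappB => *; [exact: hardyD|exact: hardyZ]. Qed.

Lemma chardyZ b c f x : 0 <= b -> clocint f ->
  chardy b (fun y => c * f y) x = c * chardy b f x.
Proof. by move=> b0; apply: cappZ => *; [exact: hardyD|exact: hardyZ]. Qed.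

Lemma cprimD f g x : clocint f -> clocint g ->
  cprim (fun y => f y + g y) x = cprim f x + cprim g x.
Proof. by apply: cappD => *; exact: primD. Qed.

Lemma cprimB f g x : clocint f -> clocint g ->
  cprim (fun y => f y - g y) x = cprim f x - cprim g x.
Proof. by apply: cappB => *; [exact: primD|exact: primZ]. Qed.

Lemma cprimZ c f x : clocint f -> cprim (fun y => c * f y) x = c * cprim f x.
Proof. by apply: cappZ => *; [exact: primD|exact: primZ]. Qed.

Lemma eq_chardy b f g x : (forall y, 0 < y <= x -> f y = g y) ->
  chardy b f x = chardy b g x.
Proof.
by move=> fg; congr Complex; apply: eq_hardy => y /fg; rewrite /cRe /cIm => ->.
Qed.

Lemma eq_cprim f g x : (forall y, 0 < y <= x -> f y = g y) -> cprim f x = cprim g x.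
Proof.
by move=> fg; congr Complex; apply: eq_prim => y /fg; rewrite /cRe /cIm => ->.
Qed.

Lemma clocint_chardy b f : 0 < b -> clocint f -> clocint (chardy b f).
Proof. by move=> b0 [? ?]; split; exact: locint_hardy. Qed.

Lemma clocbnd_cprim f : clocint f -> clocbnd (cprim f).
Proof. by move=> [? ?]; split; exact: locbnd_prim. Qed.

Lemma norm1_cprim f x : clocint f -> norm1 (cprim f x) <= prim (fun y => norm1 (f y)) x.
Proof.
move=> [l1 l2]; rewrite primD; [|exact: locint_norm..].
by rewrite lerD// prim_norm.
Qed.

Lemma norm1_chardy b f x : 0 <= b -> clocint f ->
  norm1 (chardy b f x) <= hardy b (fun y => norm1 (f y)) x.
Proof.
move=> b0 [l1 l2]; rewrite hardyD//; [|exact: locint_norm..].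
by rewrite lerD// hardy_norm.
Qed.

Lemma norm1_mulr_chardy b f x : 0 <= b -> clocint f -> 0 < x ->
  norm1 ((x%:C)%C * chardy b f x) <= prim (fun y => norm1 (f y)) x.
Proof.
move=> b0 lf x0; rewrite norm1_Zreal (ger0_norm (ltW x0)).
rewrite (le_trans (ler_wpM2l (ltW x0) (norm1_chardy _ b0 lf)))//.
rewrite (le_trans (ler_norm _))// (le_trans (mulr_hardy_norm b0 (locint_norm1 lf) x0))//.
by rewrite le_eqVlt (@eq_prim _ _ (fun y => norm1 (f y))) ?eqxx// => y _; rewrite ger0_norm ?norm1_ge0.
Qed.

Lemma cRe_Zreal (h : R -> R) f : cRe (fun x => (h x)%:C%C * f x) = fun x => h x * cRe f x.
Proof. by rewrite cReM; apply/funext => x /=; rewrite mul0r subr0. Qed.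

Lemma cIm_Zreal (h : R -> R) f : cIm (fun x => (h x)%:C%C * f x) = fun x => h x * cIm f x.
Proof. by rewrite cImM; apply/funext => x /=; rewrite mul0r addr0. Qed.

Lemma chardyXn b n f x : 0 < x ->
  chardy b (fun y => (y ^+ n)%:C%C * f y) x = (x ^+ n)%:C%C * chardy (b + n%:R) f x.
Proof.
move=> x0; rewrite /chardy /capp cRe_Zreal cIm_Zreal !mulr_hardyXn//.
by apply/eqP; rewrite eq_complex/= !mul0r subr0 addr0 !eqxx.
Qed.

Lemma locbnd_exprVM n f : clocbnd f ->
  (forall X, exists K, forall x, 0 < x <= X -> norm1 ((x ^- n)%:C%C * f x) <= K) ->
  clocbnd (fun x => (x ^- n)%:C%C * f x).
Proof.
move=> [l1 l2] H.
have mV X : measurable_fun `]0, X] (fun x : R => x ^- n).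
  apply: (eq_measurable_fun (fun x : R => x `^ (- n%:R))).
    by move=> x; rewrite inE/= in_itv/= => /andP[x0 _]; rewrite powR_invn// ltW.
  by apply: measurable_funTS; exact: measurable_powR.
split=> X; have [K HK] := H X; split.
- by rewrite cRe_Zreal; apply: measurable_funM => //; have [] := l1 X.
- by exists K => x /HK; apply: le_trans; rewrite lerDl.
- by rewrite cIm_Zreal; apply: measurable_funM => //; have [] := l2 X.
- by exists K => x /HK; apply: le_trans; rewrite lerDr.
Qed.

Lemma hardy_cst b a x : 0 < b -> 0 < x -> hardy b (fun=> a) x = a / (b + 1).
Proof.
move=> b0 x0; have l0 : locint (fun _ : R => 0 : R) by exact/locbnd_locint/locbnd_cst.
have p0 y : 0 < y -> prim (fun _ : R => 0) y = 0.
  by move=> y0; rewrite prim_cst ?mul0r// ltW.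
rewrite (@hardy_prim _ b a (fun=> a) (fun=> 0))//; last first.
  by move=> y y0; rewrite p0// addr0.
rewrite (@eq_prim _ _ (fun=> 0)) ?p0 ?addr0// => y /andP[y0 _].
by rewrite /hardy (@eq_prim _ _ (fun=> 0)) ?p0 ?mulr0// => t _; rewrite mulr0.
Qed.

Lemma prim_expr n a x : 0 < x ->
  prim (fun y => y ^+ n.+1 * a) x = a * x ^+ n.+2 / n.+2%:R.
Proof.
move=> x0; have := @hardy_cst n.+1%:R a x (ltr0Sn _ _) x0; rewrite /hardy.
rewrite (@eq_prim _ _ (fun y => y ^+ n.+1 * a)); last first.
  by move=> y /andP[y0 _]; rewrite powR_mulrn// ltW.
rewrite (_ : - n.+1%:R - 1 = - n.+2%:R); last by rewrite -opprD natr1.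
rewrite powR_invn ?ltW// natr1 => H.
by apply: (mulfI (_ : x ^- n.+2 != 0)); rewrite ?invr_neq0 ?expf_neq0 ?gt_eqF// H; field;
  rewrite ?expf_neq0 ?gt_eqF.
Qed.

Variable al : R.
Hypothesis al0 : 0 < al.

(* [w = J f] solves [x^(-al-1) (x^(al+1) w')' = f / x] with [w(0) = 0]. *)
Definition J f := cprim (chardy al f).

Lemma clocbnd_J f : clocint f -> clocbnd (J f).
Proof using al0. by move=> lf; apply: clocbnd_cprim; exact: clocint_chardy. Qed.

Lemma JD f g x : clocint f -> clocint g -> J (fun y => f y + g y) x = J f x + J g x.
Proof using al0.
move=> lf lg; rewrite /J -cprimD; try exact: clocint_chardy.
by apply: eq_cprim => y _; rewrite chardyD// ltW.
Qed.

Lemma JB f g x : clocint f -> clocint g -> J (fun y => f y - g y) x = J f x - J g x.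
Proof using al0.
move=> lf lg; rewrite /J -cprimB; try exact: clocint_chardy.
by apply: eq_cprim => y _; rewrite chardyB// ltW.
Qed.

Lemma JZ c f x : clocint f -> J (fun y => c * f y) x = c * J f x.
Proof using al0.
move=> lf; rewrite /J -cprimZ; last exact: clocint_chardy.
by apply: eq_cprim => y _; rewrite chardyZ// ltW.
Qed.

Lemma eq_J f g x : (forall y, 0 < y <= x -> f y = g y) -> J f x = J g x.
Proof.
move=> fg; apply: eq_cprim => y /andP[y0 yx]; apply: eq_chardy => t /andP[t0 ty].
by rewrite fg// t0 (le_trans ty).
Qed.

Lemma norm1_J f x : clocint f -> 0 < x ->
  norm1 (J f x) <= prim (fun y => norm1 (f y)) x / al.
Proof using al0.
move=> lf x0; rewrite (le_trans (norm1_cprim _ (clocint_chardy al0 lf)))//.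
apply: le_trans (prim_hardy_le al0 (locint_norm1 lf) _ x0).
  apply: le_prim; [exact/locint_norm1/clocint_chardy|exact/locint_hardy/locint_norm1|].
  by move=> y _; exact: norm1_chardy (ltW al0) lf.
by move=> y _; exact: norm1_ge0.
Qed.

(** Integrating $y^{n+1}$ gains the factor $1/(n+2)$, which builds up the factorial in [coef_bound];
    the inner average contributes $1/(al+n+2)$, estimated by 1. *)
Lemma norm1_J_expr n f B x : clocbnd f -> 0 < x ->
  (forall y, 0 < y <= x -> norm1 (f y) <= B) ->
  norm1 (J (fun y => (y ^+ n.+1)%:C%C * f y) x) <= B * x ^+ n.+2 / n.+2%:R.
Proof using al0.
move=> lf x0 fB; have lf' := clocbnd_clocint lf.
have lX : clocint (fun y => (y ^+ n.+1)%:C%C * f y).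
  by apply: clocbnd_clocint; apply: clocbndM => //; apply: clocbnd_real; exact: locbndX.
have B0 : 0 <= B by rewrite (le_trans (norm1_ge0 _) (fB x _))// x0 lexx.
have lB : locint (fun _ : R => B) by exact/locbnd_locint/locbnd_cst.
rewrite (le_trans (norm1_cprim _ (clocint_chardy al0 lX)))// -prim_expr//.
apply: le_prim; first exact/locint_norm1/clocint_chardy.
  by apply: locbnd_locint; apply: locbndM; [exact: locbndX|exact: locbnd_cst].
move=> y /andP[y0 yx]; rewrite chardyXn// norm1_Zreal ger0_norm ?exprn_ge0 ?(ltW y0)//.
have an0 : 0 < al + n.+1%:R by rewrite addr_gt0.
rewrite ler_wpM2l ?exprn_ge0 ?(ltW y0)// (le_trans (norm1_chardy _ (ltW an0) lf'))//.
apply: (@le_trans _ _ (hardy (al + n.+1%:R) (fun=> B) y)).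
  apply: le_hardy; [exact: ltW|exact: locint_norm1|exact: lB|] => t /andP[t0 ty].
  by rewrite fB// t0 (le_trans ty).
by rewrite hardy_cst// ler_pdivrMr ?addr_gt0// ler_peMr// lerDr ltW.
Qed.

End componentwise_operators.

(** * Existence and growth of the coefficients *)

Section coefficients.
Context {R : realType}.
Implicit Types (x y X : R) (f g : R -> cplx R).
Variables (al : R) (m : R -> cplx R).
Hypotheses (al0 : 0 < al) (lm : clocint m).

Definition kernel_weight y := norm1 (m y) / al.

Lemma locint_kernel_weight : locint kernel_weight.
Proof using lm.
apply: locint_eq (locintZ al^-1 (locint_norm1 lm)) => x _; exact: mulrC.
Qed.

Lemma kernel_weight_ge0 y : 0 <= kernel_weight y.
Proof using al0. by rewrite divr_ge0 ?norm1_ge0// ltW. Qed.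

(** The map $f\mapsto J(mf)$ conjugated by $x^n$: with $n=2k$ it is the operator in the equation for
    $a_k$ after division by $x^{2k}$. *)
Definition volterra_op n f x : cplx R :=
  (x ^- n)%:C%C * J al (fun y => (y ^+ n)%:C%C * (m y * f y)) x.

Lemma clocint_expM n f : clocint f -> clocint (fun y => (y ^+ n)%:C%C * f y).
Proof.
move=> lf; apply: clocint_eq (clocintM lf (clocbnd_real (locbndX n))) => x _.
by rewrite mulrC.
Qed.

Lemma clocbnd_expM n f : clocbnd f -> clocbnd (fun y => (y ^+ n)%:C%C * f y).
Proof. by move=> lf; apply: clocbndM => //; exact/clocbnd_real/locbndX. Qed.

(** Since $(y/x)^n\le1$ on $]0,x]$, the bound is uniform in [n], and one weight serves all
    coefficients. *)
Lemma norm1_volterra_op n f x : 0 < x -> clocbnd f ->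
  norm1 (volterra_op n f x) <= prim (fun y => kernel_weight y * norm1 (f y)) x.
Proof using al0 lm.
move=> x0 lf; have lmf := clocintM lm lf; have lX := clocint_expM n lmf.
have lmn : locint (fun y => norm1 (m y) * norm1 (f y)).
  by apply: locintM; [exact: locint_norm1|exact: locbnd_norm1].
rewrite norm1_Zreal ger0_norm ?invr_ge0 ?exprn_ge0 ?(ltW x0)//.
rewrite ler_pdivrMl ?exprn_gt0// (le_trans (norm1_J al0 lX x0))//.
rewrite (_ : (fun y => kernel_weight y * _) = fun y => al^-1 * (norm1 (m y) * norm1 (f y))); last first.
  by apply/funext => y; rewrite /kernel_weight mulrAC mulrC.
rewrite (primZ _ _ lmn) mulrCA mulrC ler_wpM2l ?invr_ge0 ?(ltW al0)//.
rewrite -primZ//; apply: le_prim; [exact: locint_norm1|exact: locintZ|].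
move=> y /andP[y0 yx]; rewrite norm1_Zreal ger0_norm ?exprn_ge0 ?(ltW y0)//.
rewrite ler_pM ?norm1_ge0 ?exprn_ge0 ?(ltW y0) ?norm1M//.
by rewrite lerXn2r// nnegrE ltW.
Qed.

Lemma clocbnd_volterra_op n f : clocbnd f -> clocbnd (volterra_op n f).
Proof using al0 lm.
move=> lf; apply: locbnd_exprVM.
  by apply: clocbnd_J => //; apply: clocint_expM; exact: clocintM.
move=> X; have lkf : locint (fun y => kernel_weight y * norm1 (f y)).
  by apply: locintM; [exact: locint_kernel_weight|exact: locbnd_norm1].
exists (prim (fun y => kernel_weight y * norm1 (f y)) X) => x /andP[x0 xX].
rewrite (le_trans (norm1_volterra_op n x0 lf))// prim_homo// => y _.
by rewrite mulr_ge0 ?kernel_weight_ge0 ?norm1_ge0.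
Qed.

Lemma volterra_opD n f g x : 0 < x -> clocbnd f -> clocbnd g ->
  volterra_op n (fun y => f y + g y) x = volterra_op n f x + volterra_op n g x.
Proof using al0 lm.
move=> x0 lf lg; have lf' := clocint_expM n (clocintM lm lf).
have lg' := clocint_expM n (clocintM lm lg).
rewrite {1}/volterra_op (@eq_J R al _ (fun y =>
  (y ^+ n)%:C%C * (m y * f y) + (y ^+ n)%:C%C * (m y * g y))).
  by rewrite (JD al0 x lf' lg') mulrDr.
by move=> y _; rewrite (mulrDr (m y)) mulrDr.
Qed.

Lemma volterra_opB n f g x : 0 < x -> clocbnd f -> clocbnd g ->
  volterra_op n (fun y => f y - g y) x = volterra_op n f x - volterra_op n g x.
Proof using al0 lm.
move=> x0 lf lg; have lf' := clocint_expM n (clocintM lm lf).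
have lg' := clocint_expM n (clocintM lm lg).
rewrite {1}/volterra_op (@eq_J R al _ (fun y =>
  (y ^+ n)%:C%C * (m y * f y) - (y ^+ n)%:C%C * (m y * g y))).
  by rewrite (JB al0 x lf' lg') mulrBr.
by move=> y _; rewrite (mulrBr (m y)) mulrBr.
Qed.

Local Notation E := (expprim kernel_weight).

(** Each Neumann series contributes a factor $2E$, and the integration of each source contributes
    $1/(k+1)$. *)
Definition coef_bound n x : R := (2 * E x) ^+ n.+1 / n`!%:R.

Lemma coef_bound_homo n x y : x <= y -> coef_bound n x <= coef_bound n y.
Proof using al0 lm.
move=> xy; have E0 t : 0 <= 2 * E t by rewrite mulr_ge0// ltW// expprim_gt0.
apply: ler_wpM2r; first by rewrite invr_ge0 ler0n.
apply: lerXn2r; [rewrite nnegrE; exact: E0|rewrite nnegrE; exact: E0|].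
apply: ler_wpM2l; first exact: ler0n.
by apply: (expprim_homo locint_kernel_weight _ xy) => t _; exact: kernel_weight_ge0.
Qed.

Definition recursion_source k (a a' : R -> cplx R) (y : R) : cplx R :=
  (y ^+ (2 * k.+1))%:C%C * (m y * a' y) - (y ^+ (2 * k).+1)%:C%C * a y.

Lemma clocint_recursion_source k a a' : clocbnd a -> clocbnd a' -> clocint (recursion_source k a a').
Proof using lm.
move=> la la'; apply: clocintB; first by apply: clocint_expM; exact: clocintM.
by apply: clocint_expM; exact: clocbnd_clocint.
Qed.

(* [x^(2k) a_k] is the coefficient of [(z - z0)^k] in [x^(-l-1) phi(z, x)]. *)
Lemma coef_exists : exists a : nat -> R -> cplx R,
  [/\ forall k, clocbnd (a k),
      forall k x, 0 < x -> norm1 (a k x) <= coef_bound k x,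
      forall x, 0 < x -> a 0%N x = 1 + J al (fun y => m y * a 0%N y) x
    & forall k x, 0 < x ->
        (x ^+ (2 * k.+1))%:C%C * a k.+1 x = J al (recursion_source k (a k) (a k.+1)) x].
Proof using al0 lm.
have lk := locint_kernel_weight; have k0 y (_ : 0 < y) := kernel_weight_ge0 y.
have vol n := volterra_exists lk k0 (@clocbnd_volterra_op n) (@volterra_opD n) (@volterra_opB n) (@norm1_volterra_op n).
have [|||a0 [la0 a0E a0b]] := vol 0%N (fun=> 1) (fun=> 1).
- exact: clocbnd_cst.
- by [].
- by move=> x _; rewrite (norm1_real 1) normr1.
pose P k a := clocbnd a /\ forall x, 0 < x -> norm1 (a x) <= coef_bound k x.
pose Q k (a a' : R -> cplx R) := forall x, 0 < x ->
  (x ^+ (2 * k.+1))%:C%C * a' x = J al (recursion_source k a a') x.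
have P0 : P 0%N a0.
  split => // x x0; rewrite (le_trans (a0b x x0))//.
  by rewrite /coef_bound expr1 fact0 divr1 mulr1.
have step k a : P k a -> exists a', P k.+1 a' /\ Q k a a'.
  move=> [la ab]; pose n := (2 * k.+1)%N.
  have nE : n = (2 * k).+2 by rewrite /n mulnS.
  (* The inhomogeneity of the equation for the next coefficient: the part of the source that
     involves the known [a], after division by $x^n$. *)
  pose g x : cplx R := (x ^- n)%:C%C * (- J al (fun y => (y ^+ (2 * k).+1)%:C%C * a y) x).
  have lJ : clocbnd (J al (fun y => (y ^+ (2 * k).+1)%:C%C * a y)).
    by apply: clocbnd_J => //; exact/clocbnd_clocint/clocbnd_expM.
  (* [norm1_J_expr] gives the factor $1/(2k+2)$, which is weakened to $1/(k+1)$. *)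
  have gb x : 0 < x -> norm1 (g x) <= coef_bound k x / k.+1%:R.
    move=> x0; have xn0 : 0 < x ^+ n by rewrite exprn_gt0.
    rewrite norm1_Zreal norm1N ger0_norm; last by rewrite invr_ge0 ltW.
    rewrite (ler_pdivrMl _ _ xn0).
    apply: le_trans (@norm1_J_expr R al al0 (2 * k)%N a (coef_bound k x) x la x0 _) _.
      by move=> y /andP[y0 yx]; exact: le_trans (ab y y0) (coef_bound_homo k yx).
    rewrite -nE mulrAC mulrC; apply: ler_wpM2l; first exact: ltW.
    apply: ler_wpM2l; first exact: le_trans (norm1_ge0 _) (ab x x0).
    by rewrite lef_pV2 ?posrE ?ltr0n ?nE// ler_nat -nE /n leq_pmull.
  have [|||a' [la' a'E a'b]] := vol n g (fun x => coef_bound k x / k.+1%:R).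
  - apply: locbnd_exprVM.
      by apply: clocbnd_eq (clocbndB (clocbnd_cst 0) lJ) => x _; rewrite sub0r.
    move=> X; exists (coef_bound k X / k.+1%:R) => x /andP[x0 xX].
    apply: le_trans (gb x x0) _; apply: ler_wpM2r; first by rewrite invr_ge0 ler0n.
    exact: coef_bound_homo.
  - move=> x y _ xy; apply: ler_wpM2r; first by rewrite invr_ge0 ler0n.
    exact: coef_bound_homo.
  - exact: gb.
  exists a'; split.
    split => // x x0; rewrite (le_trans (a'b x x0))// /coef_bound.
    rewrite factS natrM [_ ^+ k.+2]exprS le_eqVlt; apply/orP; left; apply/eqP.
    have : k`!%:R != 0 :> R by rewrite pnatr_eq0 -lt0n fact_gt0.
    have : k.+1%:R != 0 :> R by rewrite pnatr_eq0.
    move: (k.+1%:R : R) (k`!%:R : R) (expprim _ _) (_ ^+ _) => r s t v r0 s0.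
    by field; rewrite r0 s0.
  move=> x x0; have xn : (x ^+ n)%:C%C != 0 :> cplx R.
    by apply/eqP => -[] /eqP; rewrite expf_eq0 (gt_eqF x0) andbF.
  have xV : (x ^+ n)%:C%C * (x ^- n)%:C%C = 1 :> cplx R.
    by rewrite -rmorphM/= mulfV// expf_neq0// gt_eqF.
  have l1 := clocint_expM n (clocintM lm la').
  have l2 := clocbnd_clocint (clocbnd_expM (2 * k).+1 la).
  by rewrite (a'E x x0) mulrDr /g /volterra_op !mulrA xV !mul1r addrC (JB al0 x l1 l2).
have [a [a0' H]] := nat_dependent_choice P0 step.
exists a; split.
- by move=> k; have [[]] := H k.
- by move=> k x x0; have [[_ /(_ x x0)]] := H k.
- move=> x x0; rewrite a0' a0E//; congr (_ + _).
  rewrite /volterra_op expr0 invr1 mul1r; apply: eq_J => y _.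
  by rewrite expr0 mul1r.
- by move=> k x x0; have [_ ->] := H k.
Qed.

End coefficients.

(** * The radial equation as a Volterra equation *)

Section radial_ode.
Context {R : realType}.
Implicit Types (a b c x y : R) (f g u w : R -> R).
Local Notation mu := (@lebesgue_measure R).

Lemma powR_l1 l x : 0 < x -> x `^ (l + 1) = x `^ l * x.
Proof.
move=> x0; rewrite powRD; last by rewrite (gt_eqF x0) implybT.
by rewrite powRr1// ltW.
Qed.

Lemma derivable_is_derive f x : derivable f x 1 -> is_derive x (1 : R) f (derive1 f x).
Proof. by rewrite derive1E => fx; exact: DeriveDef. Qed.

Lemma is_derive_derive1 f x a : is_derive x (1 : R) f a -> derive1 f x = a.
Proof. by move=> fx; rewrite derive1E; exact: derive_val. Qed.

Lemma derive0_constant f : (forall x, 0 < x -> is_derive x (1 : R) f 0) ->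
  forall x y, 0 < x -> 0 < y -> f x = f y.
Proof.
move=> df; suff H x y : 0 < x -> x <= y -> f x = f y.
  move=> x y x0 y0; have [xy|/ltW yx] := leP x y; first exact: H.
  by apply/esym/H.
move=> x0 xy; apply/esym/(ac_derive0 xy).
  apply: (@ac_bounded_derivative _ _ _ _ (fun=> 0) 0) => // t /andP[xt _].
    by apply: df; exact: lt_le_trans xt.
  by rewrite normr0.
by apply: aeW => t /andP[xt _]; apply: df; exact: lt_trans xt.
Qed.

(* With [P = x^(l+1) u' - (l+1) x^l u], [P' = x^(2l+1) g] and
   [(x^(-l-1) u)' = x^(-2l-2) P]; the integration constant of [P] vanishes since
   otherwise [x^(-l-1) u] would be of size [x^(-2l-1)] at [0]. *)
Lemma radial_ode_volterra l u w g c : - (1 / 2) < l ->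
  (forall x, 0 < x -> derivable u x 1) ->
  (forall a b, 0 < a -> a <= b ->
    abs_continuous a b u /\ abs_continuous a b (derive1 u)) ->
  {ae mu, forall x : R, 0 < x -> derivable (derive1 u) x 1 /\
    derive1 (derive1 u) x = l * (l + 1) / x ^+ 2 * u x + x `^ l * g x} ->
  locint g ->
  (forall x, 0 < x -> u x = x `^ (l + 1) * w x) -> w x @[x --> 0^'+] --> c ->
  forall x, 0 < x -> w x = c + prim (hardy (2 * l + 1) g) x /\
    derive1 u x = x `^ l * (x * hardy (2 * l + 1) g x + (l + 1) * w x).
Proof.
move=> l12 du acu ode lg uw wc.
set al := 2 * l + 1; have al0 : 0 < al by rewrite /al; lra.
have al0' := ltW al0.
have pl0 x : 0 < x -> x `^ l != 0 by move=> x0; rewrite gt_eqF// powR_gt0.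
have pal x : 0 < x -> x `^ al = x `^ l ^+ 2 * x.
  move=> x0; rewrite /al powR_l1// expr2 -powRD ?(gt_eqF x0) ?implybT//.
  by congr (_ `^ _ * _); ring.
have pal1 x : 0 < x -> x `^ (- al - 1) = (x `^ l ^+ 2 * x ^+ 2)^-1.
  by move=> x0; rewrite -opprD powRN powR_l1// pal// expr2 mulrA -expr2.
have pl1 x : 0 < x -> x `^ (l - 1) = x `^ l / x.
  move=> x0; apply: (mulIf (_ : x != 0)); first by rewrite gt_eqF.
  by rewrite -powR_l1// subrK divfK// gt_eqF.
have lag : locint (fun y => y `^ al * g y) by exact: locint_powRM.
pose P x := x `^ (l + 1) * derive1 u x - (l + 1) * (x `^ l * u x).
pose Q := prim (fun y => y `^ al * g y).
have PQ a b : 0 < a -> a <= b -> P b - P a = Q b - Q a.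
  move=> a0 ab; have [au au'] := acu a b a0 ab.
  apply: (ac_ftc (ltW a0) ab lag).
    apply: acB; first by apply: acM => //; exact: ac_powR.
    by apply: acZ; apply: acM => //; exact: ac_powR.
  apply: filterS ode => x H /andP[ax _]; have x0 := lt_trans a0 ax.
  have [dd E] := H x0.
  have d1 := is_deriveM (is_derive1_powR (l + 1) x0) (derivable_is_derive dd).
  have d2 := is_deriveM (is_derive1_powR l x0) (derivable_is_derive (du x x0)).
  apply: (is_derive_eq (is_deriveB d1 (is_deriveZ (l + 1) d2))).
  rewrite /GRing.scale/= /GRing.scale/= E addrK pl1// powR_l1// pal//.
  by field; rewrite gt_eqF.
pose c0 := P 1 - Q 1.
have PE x : 0 < x -> P x = c0 + Q x.
  move=> x0; rewrite /c0; have [x1|/ltW x1] := leP x 1.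
    by have := PQ x 1 x0 x1; lra.
  by have := PQ 1 x ltr01 x1; lra.
have wE x : 0 < x -> w x = x `^ (- (l + 1)) * u x.
  by move=> x0; rewrite uw// mulrA [_ `^ (- _) * _]mulrC powRxN// mul1r.
have dw x : 0 < x -> is_derive x (1 : R) w (c0 * (x `^ l ^+ 2 * x ^+ 2)^-1 + hardy al g x).
  move=> x0.
  have d1 := is_deriveM (is_derive1_powR (- (l + 1)) x0) (derivable_is_derive (du x x0)).
  have d2 : is_derive x (1 : R) w (x `^ (- (l + 1)) *: derive1 u x +
      u x *: (- (l + 1) * x `^ (- (l + 1) - 1))).
    apply: near_eq_is_derive d1; near=> y.
    by rewrite /= wE//; near: y; exact: lt_nbhsr.
  have -> : c0 * (x `^ l ^+ 2 * x ^+ 2)^-1 + hardy al g x = (x `^ l ^+ 2 * x ^+ 2)^-1 * P x.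
    by rewrite PE// /hardy -/Q pal1// mulrDr (mulrC c0).
  apply: (is_derive_eq d2); rewrite /P.
  rewrite /GRing.scale/= -opprD !powRN !powR_l1//.
  by field; rewrite pl0// gt_eqF.
(* The last term cancels the antiderivative $-c_0x^{-al}/al$ of the part $c_0x^{-al-1}$ of $w'$, so
   [V] is constant. *)
pose V x := w x - prim (hardy al g) x + c0 / al * x `^ (- al).
have lh := locint_hardy al0 lg.
have dV x : 0 < x -> is_derive x (1 : R) V 0.
  move=> x0.
  have d1 := prim_derive_continuous lh x0 (continuous_hardy al0' lg x0).
  have d2 := is_derive1_powR (- al) x0.
  apply: (is_derive_eq (is_deriveD (is_deriveB (dw x x0) d1) (is_deriveZ (c0 / al) d2))).
  rewrite /GRing.scale/= pal1//; field.
  by rewrite pl0// !gt_eqF.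
have Vc x : 0 < x -> V x = V 1 by move=> x0; exact: (derive0_constant dV).
(* Two limits of the same function at 0: as a multiple of $x^{al}$ it tends to 0, while the
   definition of [V] makes it tend to $c_0/al$. Hence $c_0=0$. *)
have V0 : x `^ al * V 1 @[x --> 0^'+] --> (0 : R).
  rewrite -[X in _ --> X](mul0r (V 1)); apply: cvgM; last exact: cvg_cst.
  exact: powR_cvg0.
have prim0 := prim_cvg0 lh.
have V1 : x `^ al * V 1 @[x --> 0^'+] --> (0 * (c - 0) + c0 / al).
  apply: cvg_trans (cvgD (cvgM (powR_cvg0 al0) (cvgB wc prim0)) (cvg_cst (c0 / al))).
  apply: near_eq_cvg; near=> x.
  have x0 : 0 < x by [].
  rewrite -(Vc x x0) /V /= mulrDr; congr (_ + _).
  by rewrite mulrCA powRxN// mulr1.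
have c00 : c0 = 0.
  have /eqP : 0 * (c - 0) + c0 / al = 0 by exact: (cvg_unique _ V1 V0).
  rewrite mul0r add0r.
  by rewrite mulf_eq0 invr_eq0 (gt_eqF al0) orbF => /eqP.
have Vw x : 0 < x -> w x - prim (hardy al g) x = V 1.
  by move=> x0; rewrite -(Vc x x0) /V c00 mul0r mul0r addr0.
have cV : c = V 1.
  have h1 : w x - prim (hardy al g) x @[x --> 0^'+] --> c - 0 by exact: cvgB.
  have h2 : w x - prim (hardy al g) x @[x --> 0^'+] --> V 1.
    by apply: cvg_near_cst; near=> x; exact: Vw.
  by rewrite -[LHS]subr0; exact: (cvg_unique _ h1 h2).
move=> x x0; split; first by rewrite cV -(Vw x x0) subrK.
have := PE x x0; rewrite c00 add0r => H.
have -> : x * hardy al g x = x * (x `^ (- al - 1) * Q x) by [].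
rewrite -H /P (uw x x0) pal1// powR_l1//.
by field; rewrite pl0// gt_eqF.
Unshelve. all: by end_near. Qed.

End radial_ode.

(** * Hardy operators on L^p(0,1) and regularity of the coefficients *)

Section Lp_unit_interval.
Context {R : realType}.
Implicit Types (b c x y X r : R) (f g : R -> R) (p : \bar R).
Local Notation mu := (@lebesgue_measure R).

Local Notation I01 := (`]0, 1[%classic : set R).

Lemma Lp01_finP r f : 1 <= r -> Lp01 r%:E f <->
  measurable_fun I01 f /\ mu.-integrable I01 (EFin \o (fun x => `|f x| `^ r)).
Proof.
move=> r1; have r0 : r != 0 by rewrite gt_eqF// (lt_le_trans ltr01).
have cutE : (fun x => (`|(f \_ `]0, 1[) x| `^ r)%:E) =
    (EFin \o (fun x => `|f x| `^ r)) \_ `]0, 1[%classic.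
  apply/funext => x; rewrite !patchE; case: ifPn => // _.
  by rewrite normr0 powR0.
rewrite /Lp01; split.
  move=> Lf; split.
    apply/(measurable_restrictT _ _).2 => //.
    by move: Lf; rewrite inE => /andP[/[!inE]].
  by apply: (integrable_mkcond _ _).2 => //; rewrite -cutE; exact: Lfun_integrable Lf.
move=> [mf If]; apply/andP; split; rewrite inE/=.
  exact/(measurable_restrictT _ _).1.
rewrite /finite_norm unlock; apply: poweR_lty.
have : mu.-integrable setT ((EFin \o (fun x => `|f x| `^ r)) \_ I01).
  by apply: (integrable_mkcond _ _).1.
rewrite -cutE => /integrableP[_]; apply: le_lt_trans; rewrite le_eqVlt; apply/orP; left; apply/eqP.
by apply: eq_integral => x _ /=; rewrite powR_norm.
Qed.

Lemma Lp01_inftyP f : Lp01 +oo%E f <-> measurable_fun I01 f /\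
  exists M, {ae mu, forall x : R, 0 < x < 1 -> `|f x| <= M}.
Proof.
have muT : (0 < mu setT)%E.
  by rewrite -set_itvNyy lebesgue_measure_itv/= ltry.
rewrite /Lp01; split.
  move=> /andP[] /[!inE]/= mf; rewrite /finite_norm unlock muT => fin; split.
    exact/(measurable_restrictT _ _).2.
  have [M HM] := @ess_supr_bounded _ (measurableTypeR R) R lebesgue_measure
    (@Num.norm R R \o (f \_ `]0, 1[)) fin.
  exists M; apply: filterS HM => x /= + x01.
  by rewrite patchE mem_set//= in_itv.
move=> [mf [M HM]]; apply/andP; split; rewrite inE/=.
  exact/(measurable_restrictT _ _).1.
rewrite /finite_norm unlock muT.
apply: (@le_lt_trans _ _ (`|M|)%:E); last exact: ltry.
apply/ess_supP; apply: filterS HM => x H.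
rewrite /= lee_fin patchE; case: ifPn => [|_]; last by rewrite normr0.
by rewrite inE/= in_itv/= => /H /le_trans; apply; exact: ler_norm.
Qed.

Lemma ge1_cases p : (1 <= p)%E -> p = +oo%E \/ exists2 r, p = r%:E & 1 <= r.
Proof.
case: p => [r| |//]; last by left.
by rewrite lee_fin => r1; right; exists r.
Qed.

Lemma Lp01_measurable p f : Lp01 p f -> measurable_fun I01 f.
Proof. by move=> /andP[] /[!inE]/= mf _; exact/(measurable_restrictT _ _).2. Qed.

Lemma Lp01_le p f g : (1 <= p)%E -> measurable_fun I01 f ->
  (forall x, 0 < x < 1 -> `|f x| <= `|g x|) -> Lp01 p g -> Lp01 p f.
Proof.
move=> p1 mf fg; have [->|[r -> r1]] := ge1_cases p1.
  move=> /Lp01_inftyP[_ [M HM]]; apply/Lp01_inftyP; split => //; exists M.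
  by apply: filterS HM => x H x01; exact: le_trans (fg x x01) (H x01).
move=> /(Lp01_finP _ r1)[_ Ig]; apply/(Lp01_finP _ r1); split => //.
apply: le_integrable Ig => //.
  apply/measurable_EFinP; apply: (measurableT_comp (measurable_powR _)).
  exact: measurableT_comp.
move=> x /=; rewrite in_itv/= => x01; rewrite lee_fin !powR_norm.
by rewrite ge0_ler_powR ?nnegrE// ?fg// (le_trans _ r1).
Qed.

Lemma Lp01_cst p c : (1 <= p)%E -> Lp01 p (fun=> c).
Proof.
move=> p1; have [->|[r -> r1]] := ge1_cases p1.
  by apply/Lp01_inftyP; split => //; exists `|c|; exact: aeW.
apply/(Lp01_finP _ r1); split => //.
apply: measurable_bounded_integrable => //=.
  by rewrite lebesgue_measure_itv/= lte_fin ltr01 -EFinD ltry.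
exists (`|c| `^ r); split; first exact: num_real.
by move=> M KM x _; rewrite powR_norm ltW.
Qed.

Lemma Lp01Z p c f : (1 <= p)%E -> Lp01 p f -> Lp01 p (fun x => c * f x).
Proof.
move=> p1 Lf; have [L0 LZ] := @Lfun_submod_closed _ (measurableTypeR R) R lebesgue_measure p p1.
have := LZ c (f \_ `]0, 1[) 0 Lf L0; rewrite addr0 /Lp01.
rewrite (_ : c *: _ = (fun x => c * f x) \_ `]0, 1[)//.
apply/funext => x; transitivity (c * (f \_ `]0, 1[) x) => //.
by rewrite !patchE; case: ifPn => // _; rewrite mulr0.
Qed.

Lemma Lp01D p f g : (1 <= p)%E -> Lp01 p f -> Lp01 p g -> Lp01 p (fun x => f x + g x).
Proof.
move=> p1 Lf Lg; have [_ H] := @Lfun_addr_closed _ (measurableTypeR R) R lebesgue_measure p p1.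
have := H _ _ Lf Lg; rewrite /Lp01 (_ : _ + _ = (fun x => f x + g x) \_ `]0, 1[)//.
apply/funext => x; transitivity ((f \_ `]0, 1[) x + (g \_ `]0, 1[) x) => //.
by rewrite !patchE; case: ifPn => // _; rewrite addr0.
Qed.

Lemma Lp01B p f g : (1 <= p)%E -> Lp01 p f -> Lp01 p g -> Lp01 p (fun x => f x - g x).
Proof.
move=> p1 Lf /(Lp01Z (-1) p1) Lg; have := Lp01D p1 Lf Lg.
by congr Lp01; apply/funext => x; rewrite mulN1r.
Qed.

Lemma Lp01M p f g : (1 <= p)%E -> Lp01 p f -> locbnd g -> Lp01 p (fun x => f x * g x).
Proof.
move=> p1 Lf lg; have [mg [K HK]] := lg 1.
apply: Lp01_le (Lp01Z K p1 Lf) => //.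
  apply: measurable_funM; first exact: Lp01_measurable Lf.
  by apply: measurable_funS mg => //; apply: subset_itvl; rewrite bnd_simp.
move=> x /andP[x0 x1]; rewrite !normrM mulrC ler_wpM2r//.
by rewrite (le_trans (HK x _)) ?ler_norm// x0 ltW.
Qed.

Lemma Lp01_locbnd p f : (1 <= p)%E -> locbnd f -> Lp01 p f.
Proof.
move=> p1 lf; have := Lp01M p1 (Lp01_cst 1 p1) lf.
by congr Lp01; apply/funext => x; rewrite mul1r.
Qed.

Lemma Lp01_integrable p f : (1 <= p)%E -> Lp01 p f ->
  mu.-integrable I01 (EFin \o f).
Proof.
move=> p1; have [->|[r -> r1]] := ge1_cases p1.
  move=> /Lp01_inftyP[mf [M HM]]; apply/integrableP; split.
    exact/measurable_EFinP.
  apply: (@le_lt_trans _ _ (`|M|%:E * mu I01)%E).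
    apply: integral_le_bound => //; first exact/measurable_EFinP.
    apply: filterS HM => x H /=; rewrite in_itv/= lee_fin => /H /le_trans; apply.
    exact: ler_norm.
  by rewrite /= lebesgue_measure_itv/= lte_fin ltr01 -EFinD -EFinM ltry.
move=> /(Lp01_finP _ r1)[mf If].
have I1 : mu.-integrable I01 (EFin \o (fun=> 1 : R)).
  have /(Lp01_finP _ (lexx 1))[_] := Lp01_cst 1 (lexx 1%E).
  by apply: eq_integrable => // x _ /=; rewrite normr1 powR1.
apply: le_integrable (integrableD _ I1 If) => //; first exact/measurable_EFinP.
move=> x _; rewrite /= lee_fin [leRHS]ger0_norm ?addr_ge0 ?powR_ge0//.
have [f1|/ltW f1] := leP `|f x| 1; first by rewrite (le_trans f1)// lerDl powR_ge0.
by rewrite (le_trans (le1r_powR f1 r1))// lerDr.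
Qed.

(* Young's inequality plays the role of Jensen's for the measure
   [y^b dy] on [0, x], whose total mass after normalisation is [1 / (b + 1)]. *)
Lemma hardy_powR b r g x : 0 < b -> 1 <= r -> locint g ->
  locint (fun y => `|g y| `^ r) -> 0 < x ->
  `|hardy b g x| `^ r <= hardy b (fun y => `|g y| `^ r) x.
Proof.
move=> b0 r1 lg lgr x0; have b0' := ltW b0; have lg' := locint_norm lg.
have r0 : 0 < r by exact: lt_le_trans ltr01 r1.
set s := hardy b (fun y => `|g y|) x.
have s0 : 0 <= s by exact: hardy_ge0.
apply: (@le_trans _ _ (s `^ r)).
  by rewrite ge0_ler_powR ?nnegrE ?(ltW r0)//; exact: hardy_norm.
move: r1; rewrite le_eqVlt => /predU1P[r1|r1].
  rewrite -r1 powRr1// /s le_eqVlt; apply/orP; left; apply/eqP.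
  by apply: eq_hardy => y _; rewrite powRr1.
move: s0; rewrite le_eqVlt => /predU1P[s0|s0].
  rewrite -s0 powR0 ?gt_eqF//; apply: hardy_ge0 => y _; exact: powR_ge0.
have r10 : 0 < r - 1 by rewrite subr_gt0.
pose q := r / (r - 1).
have q0 : 0 < q by rewrite divr_gt0.
have pq : r^-1 + q^-1 = 1 by rewrite /q; field; rewrite !gt_eqF.
(* The choice for which Young's inequality for $t|g|$ is an equality at $|g|=s$. Averaging yields
   $s^r\le A/r+s^r/q$ with [A] the average of $|g|^r$, that is, $s^r\le A$. *)
pose t := s `^ (r - 1).
have tq : t `^ q = s `^ r.
  by rewrite /t -powRrM /q mulrCA mulfV ?mulr1// gt_eqF.
have st : s * t = s `^ r.
  rewrite /t -{1}(powRr1 (ltW s0)) -powRD; last by rewrite (gt_eqF s0) implybT.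
  by congr (_ `^ _); ring.
have lc c : locint (fun _ : R => c) by exact/locbnd_locint/locbnd_cst.
have H : hardy b (fun y => t * `|g y|) x <=
    hardy b (fun y => r^-1 * (`|g y| `^ r) + s `^ r / q) x.
  apply: le_hardy => //; [exact: locintZ|by apply: locintD => //; exact: locintZ|].
  move=> y _; rewrite mulrC [r^-1 * _]mulrC -tq; apply: conjugate_powR => //.
  exact: powR_ge0.
rewrite hardyZ// -/s mulrC st hardyD// in H; last exact: locintZ.
rewrite hardy_cst// hardyZ// in H.
set A := hardy b _ x in H *; set S := s `^ r in H *.
have S0 : 0 <= S by exact: powR_ge0.
have h : S / q / (b + 1) <= S / q.
  have Sq : 0 <= S / q by rewrite divr_ge0// ltW.
  by rewrite ler_pdivrMr ?addr_gt0// ler_peMr// lerDr.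
have qE : q^-1 = 1 - r^-1 by rewrite -pq addrAC subrr add0r.
rewrite qE in h H.
have : r^-1 * S <= r^-1 * A by move: h H; lra.
by rewrite ler_pM2l ?invr_gt0.
Qed.

Lemma hardy_ae_bound b (M : R) g x : 0 < b -> locint g -> 0 < x -> 0 <= M ->
  {ae mu, forall y : R, 0 < y < x -> `|g y| <= M} -> `|hardy b g x| <= M.
Proof.
move=> b0 lg x0 M0 gM; have b0' := ltW b0; have lg' := locint_norm lg.
rewrite (le_trans (hardy_norm x b0' lg))//.
have lM : locint (fun _ : R => M) by exact/locbnd_locint/locbnd_cst.
apply: (@le_trans _ _ (hardy b (fun=> M) x)); last first.
  by rewrite hardy_cst// ler_pdivrMr ?addr_gt0// ler_peMr// lerDr.
apply: ler_wpM2l; first exact: powR_ge0.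
have l1 := locint_powRM b0' lg'; have l2 := locint_powRM b0' lM.
rewrite /prim /Rintegral fine_le//; try exact: integrable_fin_num.
have i1 := @locint_measurable _ _ x l1; have i2 := @locint_measurable _ _ x l2.
apply: ae_ge0_le_integral => //.
- by move=> y _; rewrite lee_fin mulr_ge0 ?powR_ge0.
- exact/measurable_EFinP.
- by move=> y _; rewrite lee_fin mulr_ge0 ?powR_ge0.
- exact/measurable_EFinP.
have nx : {ae mu, forall y : R, y != x}.
  exists [set x]; split => //; first exact: lebesgue_measure_set1.
  by move=> y /= /negP; rewrite negbK => /eqP.
apply: filterS2 gM nx => y H yx /=; rewrite in_itv/= => /andP[y0 yx'].
by rewrite lee_fin ler_wpM2l ?powR_ge0// H// y0 lt_neqAle yx.
Qed.

(** For $p=\infty$ the average inherits the essential bound. For finite exponents [hardy_powR]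
    reduces the claim to the $L^1$ bound for [hardy b] applied to $|g|^r$. *)
Lemma Lp01_hardy p b g : (1 <= p)%E -> 0 < b -> locint g -> Lp01 p g ->
  Lp01 p (hardy b g).
Proof.
move=> p1 b0 lg Lg; have b0' := ltW b0.
have mh : measurable_fun I01 (hardy b g).
  apply: measurable_funS (@measurable_hardy _ b g 1 b0' lg) => //.
  by apply: subset_itvl; rewrite bnd_simp.
have [pE|[r pE r1]] := ge1_cases p1; rewrite pE in Lg *.
  move/Lp01_inftyP : Lg => [mg [M HM]]; apply/Lp01_inftyP; split => //.
  exists `|M|; apply: aeW => x /andP[x0 x1]; apply: hardy_ae_bound => //.
  apply: filterS HM => y H /andP[y0 yx]; apply: (le_trans (H _)); last exact: ler_norm.
  by rewrite y0 (lt_trans yx).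
move/(Lp01_finP _ r1) : Lg => [mg Ig]; apply/(Lp01_finP _ r1); split => //.
have r0 : r != 0 by rewrite gt_eqF// (lt_le_trans ltr01).
(* $|g|^r$ is integrable only on ]0, 1[, whereas the $L^1$ result asks for [locint]; on ]0, 1[ the
   value of [hardy b g] depends on [g] there alone. *)
pose g1 := g \_ `]0, 1[.
have lg1 : locint g1.
  apply: locint_le lg => [X|x x0].
    apply: measurable_funTS; exact/(measurable_restrictT _ _).1.
  by rewrite /g1 patchE; case: ifPn => // _; rewrite normr0.
have lg1r : locint (fun y => `|g1 y| `^ r).
  have : mu.-integrable setT (EFin \o (fun y => `|g1 y| `^ r)).
    have : mu.-integrable setT ((EFin \o (fun x => `|g x| `^ r)) \_ I01).
      by apply: (integrable_mkcond _ _).1.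
    rewrite (_ : _ \_ _ = EFin \o (fun y => `|(g \_ `]0, 1[) y| `^ r)); first exact.
    apply/funext => x; rewrite /= !patchE; case: ifPn => // _.
    by rewrite normr0 powR0.
  by move=> I X; apply: integrableS I.
have Ih : mu.-integrable I01 (EFin \o hardy b (fun y => `|g1 y| `^ r)).
  apply: integrableS (locint_hardy b0 lg1r 1) => //.
  by apply: subset_itvl; rewrite bnd_simp.
apply: le_integrable Ih => //.
  apply/measurable_EFinP; apply: (measurableT_comp (measurable_powR _)).
  exact: measurableT_comp.
move=> x /=; rewrite in_itv/= => /andP[x0 x1]; rewrite lee_fin powR_norm.
apply: le_trans (ler_norm _); apply: le_trans (hardy_powR b0 r1 lg1 lg1r x0).
rewrite (@eq_hardy _ b g g1)// => y /andP[y0 yx].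
by rewrite /g1 patchE mem_set//= in_itv/= y0 (le_lt_trans yx).
Qed.

Lemma W1p01_prim p f c g : locint g -> Lp01 p g ->
  (forall x, 0 <= x <= 1 -> f x = c + prim g x) -> W1p01 p f.
Proof.
move=> lg Lg fE; split.
  have aP := prim_ac 1 lg (lexx 0); apply: (ac_dominated (K := 1) aP aP) => s t s0 st t1.
  rewrite !fE ?s0 ?t1 ?(le_trans s0)// ?(le_trans st)//.
  by rewrite opprD addrACA subrr add0r mul1r lerDl.
exists g => //; apply: filterS (prim_derive lg) => x H /andP[x0 x1].
have d := is_deriveD (is_derive_cst c x 1) (H x0); rewrite add0r in d.
apply: near_eq_is_derive d; near=> y.
rewrite /= fE//; apply/andP; split.
  by near: y; exact: lt_le_nbhsr.
by apply/ltW; near: y; exact: lt_nbhsl.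
Unshelve. all: by end_near. Qed.

End Lp_unit_interval.

(** * Complex-valued $L^p$ functions and Hardy operators *)

Section componentwise_Lp.
Context {R : realType}.
Implicit Types (b x : R) (c : cplx R) (f g : R -> cplx R) (p : \bar R).

Definition cLp01 p f := Lp01 p (cRe f) /\ Lp01 p (cIm f).

Lemma cLp01B p f g : (1 <= p)%E -> cLp01 p f -> cLp01 p g ->
  cLp01 p (fun x => f x - g x).
Proof. by move=> p1 [? ?] [? ?]; split; rewrite ?cReB ?cImB; exact: Lp01B. Qed.

Lemma cLp01M p f g : (1 <= p)%E -> cLp01 p f -> clocbnd g ->
  cLp01 p (fun x => f x * g x).
Proof.
move=> p1 [? ?] [? ?]; split; rewrite ?cReM ?cImM.
  by apply: Lp01B => //; exact: Lp01M.
by apply: Lp01D => //; exact: Lp01M.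
Qed.

Lemma cLp01_locbnd p f : (1 <= p)%E -> clocbnd f -> cLp01 p f.
Proof. by move=> p1 [? ?]; split; exact: Lp01_locbnd. Qed.

Lemma cLp01Z p c f : (1 <= p)%E -> cLp01 p f -> cLp01 p (fun x => c * f x).
Proof.
move=> p1 Lf; have [] := cLp01M p1 Lf (clocbnd_cst c).
by rewrite (_ : (fun x => _ * _) = fun x => c * f x)//; apply/funext => x; rewrite mulrC.
Qed.

Lemma cLp01D p f g : (1 <= p)%E -> cLp01 p f -> cLp01 p g ->
  cLp01 p (fun x => f x + g x).
Proof. by move=> p1 [? ?] [? ?]; split; rewrite ?cReD ?cImD; exact: Lp01D. Qed.

Lemma cLp01_chardy p b f : (1 <= p)%E -> 0 < b -> clocint f -> cLp01 p f ->
  cLp01 p (chardy b f).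
Proof. by move=> p1 b0 [? ?] [? ?]; split; exact: Lp01_hardy. Qed.

Lemma mulr_chardyE b f x : 0 < b -> clocint f -> 0 < x ->
  x%:C%C * chardy b f x = cprim (fun y => f y - b%:C%C * chardy b f y) x.
Proof.
move=> b0 [l1 l2] x0; apply/eqP; rewrite eq_complex/= !mul0r subr0 addr0.
rewrite !mulr_hardyE//; apply/andP; split; apply/eqP; apply: eq_prim => y _.
  by rewrite /cRe /=; case: (f y) => ? ?; rewrite /= mul0r subr0.
by rewrite /cIm /=; case: (f y) => ? ?; rewrite /= mul0r addr0.
Qed.

Lemma chardy_prim b a f g x : 0 < b -> clocint g ->
  (forall y, 0 < y -> f y = a%:C%C + cprim g y) -> 0 < x ->
  chardy b f x = (a / (b + 1))%:C%C + cprim (chardy (b + 1) g) x.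
Proof.
move=> b0 [l1 l2] fE x0; apply/eqP; rewrite eq_complex/= add0r.
have fRe y : 0 < y -> cRe f y = a + prim (cRe g) y by move=> /fE; rewrite /cRe => ->.
have fIm y : 0 < y -> cIm f y = 0 + prim (cIm g) y by move=> /fE; rewrite /cIm => ->.
rewrite (hardy_prim b0 l1 fRe x0) (hardy_prim b0 l2 fIm x0) mul0r add0r.
by rewrite !eqxx.
Qed.

Lemma chardyE b f x : chardy b f x =
  (x `^ (- b - 1))%:C%C * cprim (fun y => (y `^ b)%:C%C * f y) x.
Proof.
apply/eqP; rewrite eq_complex /cprim /capp cRe_Zreal cIm_Zreal /= !mul0r subr0 addr0.
by rewrite !eqxx.
Qed.

Lemma cprim_expr_hardy n f x : 0 < x ->
  cprim (fun y => (y ^+ n)%:C%C * f y) x = (x ^+ n.+1)%:C%C * chardy n%:R f x.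
Proof.
move=> x0; rewrite chardyE mulrA.
rewrite (_ : - n%:R - 1 = - n.+1%:R :> R); last by rewrite -opprD natr1.
rewrite powR_invn ?ltW// -rmorphM/= mulfV ?expf_neq0 ?gt_eqF// mul1r.
by apply: eq_cprim => y /andP[y0 _]; rewrite powR_mulrn// ltW.
Qed.

End componentwise_Lp.

(** * Regularity of the coefficients *)

Section coefficient_regularity.
Context {R : realType}.
Implicit Types (x y : R).
Variables (al : R) (m : R -> cplx R) (p : \bar R) (a : nat -> R -> cplx R).
Hypotheses (al0 : 0 < al) (lm : clocint m) (p1 : (1 <= p)%E) (Lm : cLp01 p m).
Hypothesis la : forall k, clocbnd (a k).
Hypothesis a0E : forall x, 0 < x -> a 0%N x = 1 + J al (fun y => m y * a 0%N y) x.
Hypothesis aE : forall k x, 0 < x ->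
  (x ^+ (2 * k.+1))%:C%C * a k.+1 x = J al (recursion_source m k (a k) (a k.+1)) x.

(** The value of $a_k$ at 0. Two Hardy operators, of parameters $al+2k-1$ and $2k-1$, act on the
    constant part of $a_{k-1}$, whence the two divisors; the term with $m\,a_k$ vanishes at 0. *)
Fixpoint coef0 k : R :=
  if k is k'.+1 then - coef0 k' / (al + (2 * k).-1%:R + 1) / (2 * k)%:R else 1.

Definition coef_source k : R -> cplx R :=
  if k is k'.+1 then recursion_source m k' (a k') (a k) else fun y => m y * a 0%N y.

(** This is $x^{1-2k}(x^{2k}a_k)'$, since $(x^{2k}a_k)'$ is [chardy al (coef_source k)]. It enters
    the expansion of $\phi'$ next to $(l+1)a_k$. *)
Definition dcoef k x : cplx R := (x ^- (2 * k))%:C%C * (x%:C%C * chardy al (coef_source k) x).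

Lemma clocint_coef_source k : clocint (coef_source k).
Proof using lm la. by case: k => [|k]; [exact: clocintM|exact: clocint_recursion_source]. Qed.

Lemma clocint_ma k : clocint (fun y => m y * a k y).
Proof using lm la. exact: clocintM. Qed.

(** Each power of $y$ in the source is absorbed into a Hardy parameter, which cancels all negative
    powers of $x$. *)
Lemma dcoefS k x : 0 < x -> dcoef k.+1 x =
  x%:C%C * chardy (al + (2 * k.+1)%:R) (fun y => m y * a k.+1 y) x -
  chardy (al + (2 * k.+1).-1%:R) (a k) x.
Proof using al0 lm la.
move=> x0; have nE : (2 * k.+1 = (2 * k).+2)%N by rewrite mulnS.
have l1 := clocint_expM (2 * k.+1) (clocint_ma k.+1).
have l2 := clocint_expM (2 * k).+1 (clocbnd_clocint (la k)).
rewrite /dcoef -[coef_source k.+1]/(recursion_source m k (a k) (a k.+1)) /recursion_source.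
rewrite (chardyB x (ltW al0) l1 l2) !chardyXn//.
rewrite nE -pred_Sn.
set A := chardy _ _ x; set B := chardy _ _ x.
have x0' : x%:C%C != 0 :> cplx R by apply/eqP => -[] /eqP; rewrite (gt_eqF x0).
rewrite (fmorphV (real_complex R)) !(rmorphXn (real_complex R)) /=.
have xn0 : (x%:C%C : cplx R) ^+ (2 * k) != 0 by rewrite expf_neq0.
rewrite !exprS; move: x%:C%C x0' (_ ^+ _) xn0 => X X0 Y Y0.
by field; rewrite X0 Y0.
Qed.

Lemma coef_dcoef k x : 0 < x -> a k.+1 x = chardy (2 * k.+1).-1%:R (dcoef k.+1) x.
Proof using al0 aE.
move=> x0; have nE : (2 * k.+1 = (2 * k).+2)%N by rewrite mulnS.
have xn0 : (x ^+ (2 * k.+1))%:C%C != 0 :> cplx R.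
  by apply/eqP => -[] /eqP; rewrite expf_eq0 (gt_eqF x0) andbF.
apply: (mulfI xn0); rewrite aE// {1}nE nE /= -cprim_expr_hardy//.
apply: eq_cprim => y /andP[y0 _]; rewrite /dcoef nE -[coef_source k.+1]/(recursion_source m k (a k) (a k.+1)).
have E : y ^+ (2 * k).+1 * y ^- (2 * k).+2 * y = 1.
  by rewrite mulrAC -exprSr mulfV// expf_neq0// gt_eqF.
by rewrite mulrA mulrA -!rmorphM/= E mul1r.
Qed.

(** The derivative of $a_k$ is carried in the form [chardy b g], which is more than membership in
    $L^p$: it also gives differentiability at every [x > 0] and the limit of $x\,a_k'$ at 0. *)
Lemma coef_regular k :
  (exists b g, [/\ 0 < b, clocint g, cLp01 p g &
    forall x, 0 < x -> a k x = (coef0 k)%:C%C + cprim (chardy b g) x]) /\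
  (exists e, [/\ clocint e, cLp01 p e &
    forall x, 0 < x -> dcoef k x = ((2 * k)%:R * coef0 k)%:C%C + cprim e x]).
Proof using al0 lm p1 Lm la a0E aE.
elim: k => [|k [[b [g [b0 lg Lg akE]]] _]].
  have L0 : cLp01 p (fun y => m y * a 0%N y) by exact: cLp01M.
  have l0 := clocint_ma 0; split.
    by exists al, (fun y => m y * a 0%N y); split => // x x0; rewrite a0E.
  exists (fun y => m y * a 0%N y - al%:C%C * chardy al (fun y => m y * a 0%N y) y).
  split.
  - by apply: clocintB => //; apply: clocintZ; exact: clocint_chardy.
  - by apply: cLp01B => //; apply: cLp01Z => //; exact: cLp01_chardy.
  - move=> x x0; rewrite -mulr_chardyE// muln0 mul0r add0r /dcoef muln0 expr0 invr1.
    by rewrite mul1r.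
pose n := (2 * k.+1)%N; have nE : n = (2 * k).+2 by rewrite /n mulnS.
have aln : 0 < al + n%:R by rewrite addr_gt0// ltr0n nE.
have aln1 : 0 < al + n.-1%:R by rewrite ltr_wpDr.
have ld : clocint (chardy b g) by exact: clocint_chardy.
have Ld : cLp01 p (chardy b g) by exact: cLp01_chardy.
set M := fun y => m y * a k.+1 y.
have lM : clocint M by exact: clocint_ma.
have LM : cLp01 p M by exact: cLp01M.
(* The derivative of [dcoef k.+1]: by [dcoefS], the bracket comes from [mulr_chardyE] and the last
   term from [chardy_prim] applied to [a k]. *)
pose e y := (M y - (al + n%:R)%:C%C * chardy (al + n%:R) M y)
  - chardy (al + n.-1%:R + 1) (chardy b g) y.
have aln1' : 0 < al + n.-1%:R + 1 by rewrite addr_gt0.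
have le1 : clocint (fun y => M y - (al + n%:R)%:C%C * chardy (al + n%:R) M y).
  by apply: clocintB => //; apply: clocintZ; exact: clocint_chardy.
have le2 : clocint (chardy (al + n.-1%:R + 1) (chardy b g)) by exact: clocint_chardy.
have le : clocint e by exact: clocintB.
have Le : cLp01 p e.
  apply: cLp01B => //; last exact: cLp01_chardy.
  by apply: cLp01B => //; apply: cLp01Z => //; exact: cLp01_chardy.
have dE x : 0 < x -> dcoef k.+1 x =
    (- coef0 k / (al + n.-1%:R + 1))%:C%C + cprim e x.
  move=> x0; rewrite dcoefS// -/n mulr_chardyE//.
  rewrite (chardy_prim aln1 ld akE x0) (cprimB x le1 le2) mulNr rmorphN/=.
  by rewrite opprD addrA [RHS]addrA; congr (_ - _); rewrite addrC.
have n0 : (n%:R : R) != 0 by rewrite pnatr_eq0 nE.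
split.
  have n1 : 0 < n.-1%:R :> R by rewrite nE.
  (* By [coef_dcoef], one more Hardy operator of parameter $n-1$ acts on [dcoef]: it divides the
     constant by $n$ and its derivative has parameter $n$. *)
  exists (n.-1%:R + 1), e; split; [by rewrite addr_gt0|exact: le|exact: Le|].
  move=> x x0; rewrite coef_dcoef// (chardy_prim n1 le dE x0); congr (_ + _).
  by rewrite natr1 {2}nE -nE.
exists e; split => // x x0; rewrite dE//; congr (_%:C%C + _).
by rewrite /= -/n mulrCA mulfV// mulr1.
Qed.

End coefficient_regularity.

(** * Convergence of the expansion *)

Section complex_limits.
Context {R : realType}.
Implicit Types (z : cplx R).

Lemma norm_le_norm1 z : `|z| <= (norm1 z)%:C%C :> R[i].
Proof.
rewrite normc_def lecR /norm1; case: z => a b /=.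
rewrite -(ger0_norm (addr_ge0 (normr_ge0 a) (normr_ge0 b))) -sqrtr_sqr ler_sqrt ?sqr_ge0//.
rewrite -[a ^+ 2]real_normK ?num_real// -[b ^+ 2]real_normK ?num_real// sqrrD.
by rewrite lerD2r lerDl mulrn_wge0// mulr_ge0.
Qed.

Lemma norm1_le_norm z : (norm1 z)%:C%C <= 2 * `|z| :> R[i].
Proof.
rewrite normc_def /norm1; case: z => a b /=.
have h1 : `|a| <= Num.sqrt (a ^+ 2 + b ^+ 2).
  by rewrite -sqrtr_sqr ler_sqrt ?addr_ge0 ?sqr_ge0// lerDl sqr_ge0.
have h2 : `|b| <= Num.sqrt (a ^+ 2 + b ^+ 2).
  by rewrite -sqrtr_sqr ler_sqrt ?addr_ge0 ?sqr_ge0// lerDr sqr_ge0.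
rewrite mulr_natl -rmorphMn/= lecR mulr2n; exact: lerD.
Qed.

Lemma cvg_norm1 {T : Type} (F : set_system T) (f : T -> cplx R) z : Filter F ->
  norm1 (f x - z) @[x --> F] --> (0 : R) -> f x @[x --> F] --> z.
Proof.
move=> FF H; apply/cvgrPdist_lt => e e0.
have [er ei] : 0 < complex.Re e /\ complex.Im e = 0.
  by move: e0; rewrite ltcE/= => /andP[/eqP ei er].
have eE : e = (complex.Re e)%:C%C by rewrite [LHS]complex_ReIm ei.
move/cvgrPdist_lt : H => /(_ _ er); apply: filterS => x.
rewrite sub0r normrN ger0_norm ?norm1_ge0// => H.
rewrite distrC eE; apply: (le_lt_trans (norm_le_norm1 _)).
by rewrite ltcR.
Qed.

Lemma norm1_cvg0 {T : Type} (F : set_system T) (f : T -> cplx R) : Filter F ->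
  f x @[x --> F] --> (0 : cplx R) -> norm1 (f x) @[x --> F] --> (0 : R).
Proof.
move=> FF H; apply/cvgrPdist_lt => e e0.
have e20 : (0 : R[i]) < (e / 2)%:C%C by rewrite ltcR divr_gt0.
move/cvgrPdist_lt : H => /(_ _ e20); apply: filterS => x.
rewrite sub0r normrN sub0r normrN (ger0_norm (norm1_ge0 _)) => H.
rewrite -ltcR; apply: (le_lt_trans (norm1_le_norm _)).
rewrite (_ : e%:C%C = 2 * (e / 2)%:C%C :> R[i]).
  by rewrite ltr_pM2l// ltr0n.
by rewrite mulr_natl -rmorphMn/= -mulr_natl mulrCA mulfV ?mulr1.
Qed.

Lemma norm1_squeeze {T : Type} (F : set_system T) (f g : T -> R) : Filter F ->
  (\forall x \near F, 0 <= f x <= g x) -> g x @[x --> F] --> (0 : R) ->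
  f x @[x --> F] --> (0 : R).
Proof.
by move=> FF fg g0; apply: (squeeze_cvgr (f := fun=> 0) (h := g)) => //; exact: cvg_cst.
Qed.

End complex_limits.

Section local_boundedness.
Context {R : realType}.
Implicit Types (f : R -> R).

Lemma continuous_locbnd f (c : R) : (forall x, 0 < x -> {for x, continuous f}) ->
  f x @[x --> 0^'+] --> c -> locbnd f.
Proof.
move=> cf f0 X; split.
  apply: measurable_funS (_ : measurable_fun (`]0, +oo[%classic : set R) _) => //.
    by move=> x /=; rewrite !in_itv/= andbT => /andP[].
  apply: open_continuous_measurable_fun; first exact: interval_open.
  by move=> x; rewrite inE/= in_itv/= andbT; exact: cf.
move/cvgrPdist_lt : f0 => /(_ _ ltr01)[d /= d0 Hd].
have [K HK] : exists K, forall x, d / 2 <= x <= X -> `|f x| <= K.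
  have cw : {within `[d / 2, X], continuous f}.
    apply: continuous_in_subspaceT => x; rewrite inE/= in_itv/= => /andP[dx _].
    by apply: cf; rewrite (lt_le_trans _ dx)// divr_gt0.
  have [M [_ HM]] := compact_bounded (continuous_compact cw (@segment_compact _ (d / 2) X)).
  exists (M + 1) => x xX; apply: HM; first by rewrite ltrDl.
  by exists x => //=; rewrite in_itv.
exists (Num.max K (`|c| + 1)) => x /andP[x0 xX].
have [dx|xd] := leP (d / 2) x; first by rewrite le_max HK ?dx.
rewrite le_max; apply/orP; right.
have := Hd x; rewrite /= sub0r normrN (gtr0_norm x0) => /(_ _ x0) H.
have {}H : `|c - f x| < 1 by apply: H; rewrite (lt_trans xd)// ltr_pdivrMr// ltr_pMr// ltr1n.
have := ler_normB c (c - f x); rewrite opprB addrCA subrr addr0.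
by move: H; lra.
Qed.

End local_boundedness.

(** * Remainder estimates *)

Section expansion_convergence.
Context {R : realType}.
Implicit Types (x y X : R).
Variables (al : R) (m mz : R -> cplx R) (zeta : cplx R) (W : R -> cplx R).
Variable a : nat -> R -> cplx R.
Hypotheses (al0 : 0 < al) (lm : clocint m) (lW : clocbnd W).
Hypothesis mzE : forall y, mz y = m y - zeta * y%:C%C.
Hypothesis WE : forall x, 0 < x -> W x = 1 + J al (fun y => mz y * W y) x.
Hypothesis la : forall k, clocbnd (a k).
Hypothesis ab : forall k x, 0 < x -> norm1 (a k x) <= coef_bound al m k x.
Hypothesis a0E : forall x, 0 < x -> a 0%N x = 1 + J al (fun y => m y * a 0%N y) x.
Hypothesis aE : forall k x, 0 < x ->
  (x ^+ (2 * k.+1))%:C%C * a k.+1 x = J al (recursion_source m k (a k) (a k.+1)) x.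

Let monomial k y : cplx R := (y ^+ (2 * k))%:C%C * a k y.
Let remainder n y : cplx R := W y - \sum_(0 <= k < n) zeta ^+ k * monomial k y.
(** The function whose image under [J] is [remainder n]. This holds only from [n = 1] on
    ([remainder_J]), because the constant 1 in [WE] cancels against that in [a0E]; hence the index
    [n.+1] below. *)
Let residual n y : cplx R := mz y * W y - \sum_(0 <= k < n) zeta ^+ k * coef_source m a k y.

Lemma clocint_shifted : clocint mz.
Proof using lm mzE.
have lX : clocint (fun y => zeta * y%:C%C).
  by apply: clocintZ; apply: clocint_real; exact/locbnd_locint/locbnd_id.
by apply: clocint_eq (clocintB lm lX) => x _; rewrite mzE.
Qed.

Lemma clocint_sources k : clocint (coef_source m a k).
Proof using lm la. exact: clocint_coef_source. Qed.

Lemma coef_sourceS k y : 0 < y -> coef_source m a k.+1 y = m y * monomial k.+1 y - y%:C%C * monomial k y.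
Proof using.
move=> y0; rewrite -[coef_source m a k.+1]/(recursion_source m k (a k) (a k.+1)) /recursion_source /monomial mulrCA.
by congr (_ - _); rewrite mulrA -rmorphM/= -exprS.
Qed.

Lemma clocbnd_remainder n : clocbnd (remainder n).
Proof using lW la.
apply: clocbndB => //; apply: clocbnd_sum => k.
by apply: clocbndM; [exact: clocbnd_cst|exact: clocbnd_expM].
Qed.

Lemma clocint_residual n : clocint (residual n).
Proof using lW la lm mzE.
elim: n => [|n IH].
  by apply: clocint_eq (clocintM clocint_shifted lW) => y _; rewrite /residual big_geq// subr0.
apply: clocint_eq (clocintB IH (clocintZ (zeta ^+ n) (clocint_sources n))) => y _.
by rewrite /residual big_nat_recr//= opprD addrA.
Qed.

Lemma remainderS n y : remainder n.+1 y = remainder n y - zeta ^+ n * monomial n y.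
Proof using. by rewrite /remainder big_nat_recr//= opprD addrA. Qed.

Lemma residualS n : residual n.+1 = fun y => residual n y - zeta ^+ n * coef_source m a n y.
Proof using. by apply/funext => y; rewrite /residual big_nat_recr//= opprD addrA. Qed.

Lemma residual0 : residual 0 = fun y => mz y * W y.
Proof using. by apply/funext => y; rewrite /residual big_geq// subr0. Qed.

(** Telescoping: with $m_z=m-\zeta y$, the term $\zeta y$ times the $k$-th monomial cancels against
    the source of index $k+1$, and only the last one survives. *)
Lemma residualE n y : 0 < y -> residual n.+1 y = mz y * remainder n.+1 y - zeta ^+ n.+1 * (y%:C%C * monomial n y).
Proof using mzE.
move=> y0; elim: n => [|n IH].
  rewrite residualS residual0 remainderS /remainder big_geq// /= /monomial muln0 expr0 !mul1r subr0 expr1 mzE.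
  by ring.
by rewrite residualS IH (remainderS n.+1) coef_sourceS// (exprS _ n.+1) mzE; ring.
Qed.

Lemma remainder_J n x : 0 < x -> remainder n.+1 x = J al (residual n.+1) x.
Proof using al0 lW la lm mzE WE a0E aE.
move=> x0; elim: n => [|n IH].
  rewrite residualS residual0 remainderS /remainder big_geq// subr0 expr0 mul1r.
  have := clocint_sources 0; rewrite /coef_source => l0.
  rewrite (_ : (fun y => _ - _) = fun y => mz y * W y - m y * a 0%N y); last first.
    by apply/funext => y; rewrite mul1r.
  rewrite (JB al0 x (clocintM clocint_shifted lW) l0) WE// /monomial muln0 expr0 mul1r a0E//.
  by rewrite opprD addrACA subrr add0r.
rewrite remainderS residualS (JB al0 x (clocint_residual n.+1) (clocintZ _ (clocint_sources n.+1))) IH.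
by rewrite (JZ al0 _ _ (clocint_sources n.+1)) /monomial (aE _ x0).
Qed.

(** Bound on $]0,X]$ for the surviving term $\zeta^{N+1}y^{2N+1}a_N$ of [residualE]. *)
Let eps N X : R := norm1 zeta ^+ N.+1 * (X * (X ^+ (2 * N) * coef_bound al m N X)).

Lemma eps_ge0 N X : 0 < X -> 0 <= eps N X.
Proof using ab.
move=> X0; have h := le_trans (norm1_ge0 _) (ab N X0).
apply: mulr_ge0; first by rewrite exprn_ge0// norm1_ge0.
apply: mulr_ge0; first exact: ltW.
by apply: mulr_ge0 h; rewrite exprn_ge0// ltW.
Qed.

Lemma norm1_residual N X y : 0 < y <= X ->
  norm1 (residual N.+1 y) <= norm1 (mz y) * norm1 (remainder N.+1 y) + eps N X.
Proof using al0 lm mzE ab.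
move=> /andP[y0 yX]; rewrite residualE//; apply: le_trans (norm1B _ _) _.
apply: lerD; first exact: norm1M.
apply: le_trans (norm1M _ _) _.
apply: ler_pM; [exact: norm1_ge0|exact: norm1_ge0|exact: norm1X|].
have X0 := lt_le_trans y0 yX.
rewrite norm1_Zreal (ger0_norm (ltW y0)) norm1_Zreal ger0_norm; last by rewrite exprn_ge0// ltW.
apply: ler_pM => //; [exact: ltW|by rewrite mulr_ge0 ?norm1_ge0// exprn_ge0// ltW|].
apply: ler_pM; [by rewrite exprn_ge0// ltW|exact: norm1_ge0| |].
  by rewrite lerXn2r// nnegrE ltW.
exact: le_trans (ab N y0) (coef_bound_homo al0 lm N yX).
Qed.

Let Ez := expprim (kernel_weight al mz).

(** Gronwall for the Volterra equation of the remainder; its inhomogeneity is at most [eps N X]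
    integrated over an interval of length at most [X] and divided by [al]. *)
Lemma norm1_remainder N X y : 0 < y <= X ->
  norm1 (remainder N.+1 y) <= 2 * (eps N X * X / al) * Ez X.
Proof using al0 lW la lm mzE WE a0E aE ab.
move=> yX; have /andP[y0 yX'] := yX; have X0 := lt_le_trans y0 yX'.
have e0 := eps_ge0 N X0.
have lk : locint (kernel_weight al mz) := locint_kernel_weight al clocint_shifted.
have k0 (t : R) (_ : 0 < t) := kernel_weight_ge0 mz al0 t.
have lnD := locbnd_norm1 (clocbnd_remainder N.+1).
have G0 : 0 <= eps N X * X / al.
  by apply: divr_ge0; [apply: mulr_ge0 => //; exact: ltW|exact: ltW].
apply: le_trans (gronwall (X := X) lk k0 lnD G0 _ yX) _; last first.
  apply: ler_wpM2l; first by rewrite mulr_ge0.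
  exact: expprim_homo.
move=> t /andP[t0 tX]; rewrite remainder_J//.
apply: le_trans (norm1_J al0 (clocint_residual N.+1) t0) _.
have le : locint (fun _ : R => eps N X) by exact/locbnd_locint/locbnd_cst.
have lmD : locint (fun y => norm1 (mz y) * norm1 (remainder N.+1 y)).
  exact: locintM (locint_norm1 clocint_shifted) lnD.
have h : prim (fun y => norm1 (residual N.+1 y)) t <=
    prim (fun y => norm1 (mz y) * norm1 (remainder N.+1 y) + eps N X) t.
  apply: le_prim; [exact: locint_norm1 (clocint_residual N.+1)|exact: locintD|].
  by move=> s /andP[s0 st]; apply: norm1_residual; rewrite s0 (le_trans st).
rewrite ler_pdivrMr//; apply: le_trans h _.
rewrite primD// prim_cst ?(ltW t0)// mulrDl addrC; apply: lerD.
  by rewrite divfK ?gt_eqF//; apply: ler_wpM2l.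
rewrite (_ : (fun t => kernel_weight al mz t * _) = fun t => al^-1 * (norm1 (mz t) * norm1 (remainder N.+1 t))).
  by rewrite primZ// mulrC mulrA mulfV ?mul1r// gt_eqF.
by apply/funext => s; rewrite /kernel_weight mulrAC mulrC.
Qed.

(** [eps N X] is a fixed multiple of the $N$-th term of an exponential series. *)
Lemma eps_cvg0 X : 0 < X -> eps N X @[N --> \oo] --> (0 : R).
Proof using.
move=> X0; pose b := norm1 zeta * X ^+ 2 * (2 * expprim (kernel_weight al m) X).
pose c := norm1 zeta * X * (2 * expprim (kernel_weight al m) X).
have E N : eps N X = c * exp_coeff b N.
  rewrite /eps /exp_coeff /coef_bound /= /b /c !exprMn mul2n -addnn exprD !exprS.
  set F : R := N`!%:R; have F0 : F != 0 by rewrite pnatr_eq0 -lt0n fact_gt0.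
  by move: F F0 => F F0; field.
have H : c * exp_coeff b N @[N --> \oo] --> c * 0.
  apply: cvgM; first exact: cvg_cst.
  by apply: cvg_series_cvg_0; exact: is_cvg_series_exp_coeff.
by rewrite mulr0 in H; rewrite (eq_cvg _ _ E).
Qed.

Lemma expansion_cvg x : 0 < x -> norm1 (remainder n x) @[n --> \oo] --> (0 : R).
Proof using al0 lW la lm mzE WE a0E aE ab.
move=> x0; rewrite -(cvg_shiftS (fun n => norm1 (remainder n x))).
have H : 2 * (eps n x * x / al) * Ez x @[n --> \oo] --> 2 * (0 * x / al) * Ez x.
  apply: cvgM; last exact: cvg_cst.
  apply: cvgM; first exact: cvg_cst.
  apply: cvgM; last exact: cvg_cst.
  by apply: cvgM; [exact: eps_cvg0|exact: cvg_cst].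
rewrite !mul0r mulr0 mul0r in H.
apply: norm1_squeeze H; apply: nearW => n.
by rewrite norm1_ge0/= norm1_remainder// x0 lexx.
Qed.

(** No termwise differentiation is involved: the difference is $x$ times [chardy al] of the
    residual, hence at most the integral of the residual. *)
Lemma expansion_derive_cvg x : 0 < x ->
  norm1 (x%:C%C * chardy al (fun y => mz y * W y) x -
    \sum_(0 <= k < n) zeta ^+ k * (x%:C%C * chardy al (coef_source m a k) x))
  @[n --> \oo] --> (0 : R).
Proof using al0 lW la lm mzE WE a0E aE ab.
move=> x0; have al0' := ltW al0.
have E n : x%:C%C * chardy al (fun y => mz y * W y) x -
    \sum_(0 <= k < n) zeta ^+ k * (x%:C%C * chardy al (coef_source m a k) x) =
    x%:C%C * chardy al (residual n) x.
  elim: n => [|n IH]; first by rewrite big_geq// subr0 residual0.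
  rewrite big_nat_recr//= opprD addrA IH residualS.
  rewrite (chardyB x al0' (clocint_residual n) (clocintZ _ (clocint_sources n))).
  by rewrite (chardyZ _ x al0' (clocint_sources n)) mulrBr [in RHS](mulrCA x%:C%C).
rewrite (eq_cvg _ _ (fun n => congr1 norm1 (E n))).
rewrite -(cvg_shiftS (fun n => norm1 (x%:C%C * chardy al (residual n) x))).
pose K := 2 * (x / al) * Ez x * prim (fun y => norm1 (mz y)) x + x.
have lnm := locint_norm1 clocint_shifted.
have H : eps n x * K @[n --> \oo] --> 0 * K.
  by apply: cvgM; [exact: eps_cvg0|exact: cvg_cst].
rewrite mul0r in H; apply: norm1_squeeze H; apply: nearW => n.
rewrite norm1_ge0/=; apply: le_trans (norm1_mulr_chardy al0' (clocint_residual n.+1) x0) _.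
have le : locint (fun _ : R => eps n x) by exact/locbnd_locint/locbnd_cst.
set d := 2 * (eps n x * x / al) * Ez x.
apply: (@le_trans _ _ (prim (fun y => d * norm1 (mz y) + eps n x) x)).
  apply: le_prim; [exact: locint_norm1 (clocint_residual n.+1)|by apply: locintD => //; exact: locintZ|].
  move=> y yx; apply: le_trans (norm1_residual n yx) _; rewrite lerD2r mulrC.
  by apply: ler_wpM2r; [exact: norm1_ge0|exact: norm1_remainder].
rewrite (primD x (locintZ d lnm) le) (primZ d x lnm) (prim_cst _ (ltW x0)) /K /d le_eqVlt; apply/orP; left; apply/eqP.
by ring.
Qed.

End expansion_convergence.

(** * From the differential equation to the Volterra equation *)

Section solution_to_volterra.
Context {R : realType}.
Implicit Types (l x : R) (q : R -> R) (p : \bar R).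
Local Notation mu := (@lebesgue_measure R).

(** On ]0, 1[ this comes from the $L^p$ hypothesis, on the compact interval [[1, Num.max 1 X]] from
    local integrability of [q]. *)
Lemma locint_potential q p : (1 <= p)%E ->
  locally_integrable (`]0, +oo[%classic : set R) q ->
  Lp01 p (fun x : R => x * q x) -> locint (fun x => x * q x).
Proof.
move=> p1 [mq _ qK] /(Lp01_integrable p1)/integrableP[_ I1] X.
have mh A : measurable A -> A `<=` (`]0, +oo[%classic : set R) ->
    measurable_fun A (fun x => x * q x).
  by move=> mA A0; apply: measurable_funM => //; exact: measurable_funS mq.
have mh1 : measurable_fun (`]0, X]%classic : set R) (fun x => x * q x).
  by apply: mh => // x /=; rewrite !in_itv/= andbT => /andP[].
apply/integrableP; split; first exact/measurable_EFinP.
pose A : set R := `]0, 1[%classic; pose B : set R := `[1, Num.max 1 X]%classic.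
have mA : measurable A by exact: measurable_itv.
have mB : measurable B by exact: measurable_itv.
have AB : A `|` B `<=` (`]0, +oo[%classic : set R).
  move=> x []; rewrite /A /B /= !in_itv/= andbT => /andP[]// x1 _.
  exact: lt_le_trans x1.
have mAB : measurable_fun (A `|` B) (fun x => x * q x).
  by apply: mh => //; exact: measurableU.
apply: (@le_lt_trans _ _ (\int[mu]_(x in A `|` B) `|(x * q x)%:E|)%E).
  apply: ge0_subset_integral => //=; first exact: measurableU.
    by apply/measurable_EFinP; exact: measurableT_comp.
  move=> x; rewrite /A /B /= !in_itv/= => /andP[x0 xX].
  by have [x1|x1] := ltP x 1; [left; rewrite x0|right; rewrite le_max xX orbT].
rewrite ge0_integral_setU//=; first last.
- apply/disj_setPS => x [/=]; rewrite /A /B /= !in_itv/= => /andP[_ x1] /andP[].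
  by rewrite leNgt x1.
- by apply/measurable_EFinP; exact: measurableT_comp.
rewrite lte_add_pinfty//.
have BK : B `<=` (`]0, +oo[%classic : set R) by apply: subset_trans AB; right.
have := qK B BK (@segment_compact _ _ _).
set Y := Num.max 1 X; have Y0 : 0 <= Y by rewrite le_max ler01.
have mqB : measurable_fun B q by exact: measurable_funS mq.
move=> qB; apply: (@le_lt_trans _ _ (\int[mu]_(x in B) (Y%:E * `|q x|%:E))%E).
  apply: ge0_le_integral => //=.
  - by apply/measurable_EFinP; apply: measurableT_comp => //; exact: mh.
  - apply/measurable_EFinP; apply: measurable_funM => //.
    exact: measurableT_comp.
  - move=> x; rewrite /B /= in_itv/= => /andP[x1 xY].
    rewrite lee_fin normrM ler_wpM2r// ger0_norm// (le_trans ler01)//.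
rewrite ge0_integralZl//=; first by apply: lte_mul_pinfty => //; rewrite lee_fin.
by apply/measurable_EFinP; exact: measurableT_comp.
Qed.

Definition shifted_potential q (z : cplx R) (y : R) : cplx R := (y * q y)%:C%C - z * y%:C%C.

Lemma clocint_shifted_potential q z : locint (fun x => x * q x) -> clocint (shifted_potential q z).
Proof.
move=> lh; apply: clocintB; first exact: clocint_real.
by apply: clocintZ; apply: clocint_real; exact/locbnd_locint/locbnd_id.
Qed.

Lemma cLp01_shifted_potential q z p : (1 <= p)%E -> Lp01 p (fun x : R => x * q x) -> cLp01 p (shifted_potential q z).
Proof.
move=> p1 Lh; apply: cLp01B => //.
  by split => //; apply: Lp01_locbnd => //; exact: locbnd_cst.
apply: cLp01Z => //; apply: cLp01_locbnd => //; apply: clocbnd_real; exact: locbnd_id.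
Qed.

Lemma Re_addc (z w : cplx R) : complex.Re (z + w) = complex.Re z + complex.Re w.
Proof. by case: z; case: w. Qed.

Lemma Im_addc (z w : cplx R) : complex.Im (z + w) = complex.Im z + complex.Im w.
Proof. by case: z; case: w. Qed.

Lemma Re_Zreal (b : R) (z : cplx R) : complex.Re (b%:C%C * z) = b * complex.Re z.
Proof. by case: z => ? ?; rewrite /= mul0r subr0. Qed.

Lemma Im_Zreal (b : R) (z : cplx R) : complex.Im (b%:C%C * z) = b * complex.Im z.
Proof. by case: z => ? ?; rewrite /= mul0r addr0. Qed.

(** The complex [z] couples real and imaginary part only through the product of potential and [W].
    With this product taken as a given source, [radial_ode_volterra] applies to each component. *)
Lemma solution_volterra l q z (u : R -> cplx R) (r : R -> cplx R) :
  - (1 / 2) < l -> locint (fun x => x * q x) ->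
  is_solution l q z u -> r x @[x --> 0^'+] --> (0 : cplx R) ->
  (forall x, 0 < x -> u x = (x `^ (l + 1))%:C%C * (1 + r x)) ->
  let W := fun x => (x `^ (- (l + 1)))%:C%C * u x in
  [/\ clocbnd W,
    forall x, 0 < x -> u x = (x `^ (l + 1))%:C%C * W x,
    forall x, 0 < x -> W x = 1 + J (2 * l + 1) (fun y => shifted_potential q z y * W y) x &
    forall x, 0 < x -> cderive u x = (x `^ l)%:C%C *
      (x%:C%C * chardy (2 * l + 1) (fun y => shifted_potential q z y * W y) x + (l + 1)%:C%C * W x)].
Proof.
move=> l12 lh [du acu ode] r0 ur W.
have Wr x : 0 < x -> W x = 1 + r x.
  by move=> x0; rewrite /W ur// mulrA -rmorphM/= mulrC [_ `^ (- _) * _]mulrC powRxN// mulr1.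
have uW x : 0 < x -> u x = (x `^ (l + 1))%:C%C * W x by move=> x0; rewrite Wr// ur.
have n1r : norm1 (r x) @[x --> 0^'+] --> (0 : R) by exact: norm1_cvg0 r0.
have rRe : complex.Re (r x) @[x --> 0^'+] --> (0 : R).
  apply/norm_cvg0P; apply: norm1_squeeze n1r; apply: nearW => x.
  by rewrite normr_ge0/= lerDl.
have rIm : complex.Im (r x) @[x --> 0^'+] --> (0 : R).
  apply/norm_cvg0P; apply: norm1_squeeze n1r; apply: nearW => x.
  by rewrite normr_ge0/= lerDr.
have WRe : cRe W x @[x --> 0^'+] --> (1 : R).
  have H : 1 + complex.Re (r x) @[x --> 0^'+] --> (1 + 0 : R).
    by apply: cvgD => //; exact: cvg_cst.
  rewrite addr0 in H; apply: cvg_trans H; apply: near_eq_cvg; near=> x.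
  by rewrite /cRe Wr//; case: (r x).
have WIm : cIm W x @[x --> 0^'+] --> (0 : R).
  apply: cvg_trans rIm; apply: near_eq_cvg; near=> x.
  by rewrite /cIm Wr//; case: (r x) => ? ?; rewrite /= add0r.
have WReE : cRe W = fun x => x `^ (- (l + 1)) * cRe u x by exact: cRe_Zreal.
have WImE : cIm W = fun x => x `^ (- (l + 1)) * cIm u x by exact: cIm_Zreal.
have derc (f : R -> R) x : derivable f x 1 -> {for x, continuous f}.
  by move=> fx; apply: differentiable_continuous; exact/derivable1_diffP.
(* Near 0 boundedness comes from the prescribed asymptotics, elsewhere from continuity. *)
have lW : clocbnd W.
  split; [apply: continuous_locbnd WRe|apply: continuous_locbnd WIm] => x x0.
    rewrite WReE; apply: continuousM; last by apply: derc; have [] := du x x0.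
    by apply: derc; have [] := is_derive1_powR (- (l + 1)) x0.
  rewrite WImE; apply: continuousM; last by apply: derc; have [] := du x x0.
  by apply: derc; have [] := is_derive1_powR (- (l + 1)) x0.
have lmW : clocint (fun y => shifted_potential q z y * W y).
  by apply: clocintM => //; exact: clocint_shifted_potential.
(* One factor $x$ of $u=x^{l+1}W$ turns $q-z$ into $xq-zx$. *)
have key x : 0 < x -> (x `^ l)%:C%C * (shifted_potential q z x * W x) = (q x)%:C%C * u x - z * u x.
  move=> x0; rewrite (uW x x0) powR_l1// /shifted_potential !rmorphM/=; ring.
have ode2 x : 0 < x -> tau l q u x = z * u x -> cderive (cderive u) x =
    (l * (l + 1) / x ^+ 2)%:C%C * u x + (x `^ l)%:C%C * (shifted_potential q z x * W x).
  by move=> x0 E; rewrite (key x x0) -E /tau rmorphD/=; ring.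
have eqRe : {ae mu, forall x : R, 0 < x -> derivable (derive1 (cRe u)) x 1 /\
    derive1 (derive1 (cRe u)) x =
    l * (l + 1) / x ^+ 2 * cRe u x + x `^ l * cRe (fun y => shifted_potential q z y * W y) x}.
  apply: filterS ode => x H x0; have [[d1 d2] E] := H x0; split; first exact: d1.
  rewrite -[LHS]/(complex.Re (cderive (cderive u) x)) (ode2 x x0 E).
  by rewrite Re_addc !Re_Zreal.
have eqIm : {ae mu, forall x : R, 0 < x -> derivable (derive1 (cIm u)) x 1 /\
    derive1 (derive1 (cIm u)) x =
    l * (l + 1) / x ^+ 2 * cIm u x + x `^ l * cIm (fun y => shifted_potential q z y * W y) x}.
  apply: filterS ode => x H x0; have [[d1 d2] E] := H x0; split; first exact: d2.
  rewrite -[LHS]/(complex.Im (cderive (cderive u) x)) (ode2 x x0 E).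
  by rewrite Im_addc !Im_Zreal.
have uRe x : 0 < x -> cRe u x = x `^ (l + 1) * cRe W x.
  by move=> x0; rewrite /cRe (uW x x0) Re_Zreal.
have uIm x : 0 < x -> cIm u x = x `^ (l + 1) * cIm W x.
  by move=> x0; rewrite /cIm (uW x x0) Im_Zreal.
have duRe x : 0 < x -> derivable (cRe u) x 1 by move=> /du[].
have duIm x : 0 < x -> derivable (cIm u) x 1 by move=> /du[].
have acRe a b : 0 < a -> a <= b ->
    abs_continuous a b (cRe u) /\ abs_continuous a b (derive1 (cRe u)).
  by move=> a0 ab; have [[? _] [? _]] := acu a b a0 ab.
have acIm a b : 0 < a -> a <= b ->
    abs_continuous a b (cIm u) /\ abs_continuous a b (derive1 (cIm u)).
  by move=> a0 ab; have [[_ ?] [_ ?]] := acu a b a0 ab.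
have HRe := radial_ode_volterra l12 duRe acRe eqRe lmW.1 uRe WRe.
have HIm := radial_ode_volterra l12 duIm acIm eqIm lmW.2 uIm WIm.
split; [exact: lW|exact: uW| |].
  move=> x x0; have [E1 _] := HRe x x0; have [E2 _] := HIm x x0.
  rewrite [LHS]complex_ReIm -/(cRe W x) -/(cIm W x) E1 E2.
  by rewrite [RHS]complex_ReIm Re_addc Im_addc.
move=> x x0; have [_ E1] := HRe x x0; have [_ E2] := HIm x x0.
rewrite /cderive E1 E2; apply/eqP; rewrite eq_complex/= /cRe /cIm.
case: (W x) => c d /=.
by rewrite !mul0r !subr0 !addr0 !eqxx.
Unshelve. all: by end_near. Qed.

(** The two divisors in one step of [coef0] multiply to $4(k+1)(l+\frac32+k)$: the factor $k+1$ goes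
    into the factorial, the rest is one step of $4^k(l+\frac32)_k$. *)
Lemma Cphi_coef0 l k : - (1 / 2) < l -> Cphi l k = k`!%:R * coef0 (2 * l + 1) k.
Proof.
move=> l12; elim: k => [|k IH].
  by rewrite /Cphi /pochhammer big_ord0 !expr0 mulr1 divr1.
have poc0 : pochhammer (l + 3 / 2) k != 0.
  rewrite /pochhammer; apply/prodf_neq0 => i _; rewrite gt_eqF//.
  by apply: ltr_wpDr => //; lra.
have -> : Cphi l k.+1 = Cphi l k * (- 1 / (4 * (l + 3 / 2 + k%:R))).
  rewrite /Cphi /pochhammer big_ord_recr/= -/(pochhammer _ k) !exprS.
  have h : l + 3 / 2 + k%:R != 0 by rewrite gt_eqF// ltr_wpDr//; lra.
  have h4 : (4 : R) ^+ k != 0 by rewrite expf_neq0.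
  move: (pochhammer _ _) poc0 ((4 : R) ^+ k) h4 ((- 1 : R) ^+ k) => P P0 F F0 S.
  move: (k%:R : R) h => K h; field; rewrite P0 F0/=; move: h; lra.
rewrite IH factS natrM /=.
have -> : (2 * k.+1).-1%:R = 2 * k%:R + 1 :> R by rewrite (_ : (2 * k.+1).-1 = (2 * k).+1) ?mulnS// -natr1 natrM.
have -> : (2 * k.+1)%:R = 2 * (k%:R + 1) :> R by rewrite natrM -[k.+1%:R]natr1.
rewrite -[k.+1%:R]natr1; have k0 : 0 <= k%:R :> R by exact: ler0n.
move: (k%:R : R) k0 (k`!%:R : R) (coef0 _ _) => K K0 F c.
have h1 : 2 * l + 1 + (2 * K + 1) + 1 != 0 by rewrite gt_eqF//; lra.
have h2 : K + 1 != 0 by rewrite gt_eqF//; lra.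
by field; rewrite h2 h1.
Qed.

End solution_to_volterra.

(** * Sobolev regularity and boundary behaviour *)

Section coefficient_functions.
Context {R : realType}.
Implicit Types (c : R) (p : \bar R) (f g : R -> cplx R).

Lemma cW1p01_cprim p c f g : clocint g -> cLp01 p g -> f 0 = c%:C%C ->
  (forall x, 0 < x -> f x = c%:C%C + cprim g x) -> cW1p01 p f.
Proof.
move=> [l1 l2] [L1 L2] f0 fE; split.
  apply: (W1p01_prim (c := c) l1 L1) => x /andP[x0 _].
  move: x0; rewrite le_eqVlt => /predU1P[<-|x0].
    by rewrite /cRe f0 /= (prim_le0 _ (lexx 0)) addr0.
  by rewrite /cRe fE.
apply: (W1p01_prim (c := 0) l2 L2) => x /andP[x0 _].
move: x0; rewrite le_eqVlt => /predU1P[<-|x0].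
  by rewrite /cIm f0 /= (prim_le0 _ (lexx 0)) addr0.
by rewrite /cIm fE.
Qed.

(** [chardy b g] is continuous on the open half-line even where [g] is not, so its primitive is
    differentiable at every point. *)
Lemma cprim_chardy_derive b c f g x : 0 < b -> clocint g ->
  (forall x, 0 < x -> f x = c%:C%C + cprim (chardy b g) x) -> 0 < x ->
  cderivable f x /\ cderive f x = chardy b g x.
Proof.
move=> b0 [l1 l2] fE x0.
have d (F : R -> R) a h : locint h ->
    (forall y, 0 < y -> F y = a + prim (hardy b h) y) -> is_derive x (1 : R) F (hardy b h x).
  move=> lh FE; have dp := prim_derive_continuous (locint_hardy b0 lh) x0
    (continuous_hardy (ltW b0) lh x0).
  have dd := is_deriveD (is_derive_cst a x 1) dp; rewrite add0r in dd.
  apply: near_eq_is_derive dd; near=> y.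
  by rewrite /= FE//; near: y; exact: lt_nbhsr.
have dRe : is_derive x (1 : R) (cRe f) (hardy b (cRe g) x).
  by apply: (d _ c) => // y y0; rewrite /cRe fE.
have dIm : is_derive x (1 : R) (cIm f) (hardy b (cIm g) x).
  by apply: (d _ 0) => // y y0; rewrite /cIm fE.
split; first by split; [case: dRe|case: dIm].
by rewrite /cderive (is_derive_derive1 dRe) (is_derive_derive1 dIm).
Unshelve. all: by end_near. Qed.

(** The derivative is [chardy b g], and $x$ times it is at most $\int_0^x|g|$. *)
Lemma mulr_cderive_cvg0 b c f g : 0 < b -> clocint g ->
  (forall x, 0 < x -> f x = c%:C%C + cprim (chardy b g) x) ->
  x%:C%C * cderive f x @[x --> 0^'+] --> (0 : cplx R).
Proof.
move=> b0 lg fE; apply: cvg_norm1.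
apply: norm1_squeeze (prim_cvg0 (locint_norm1 lg)); near=> x.
have x0 : 0 < x by [].
rewrite norm1_ge0/= subr0 (cprim_chardy_derive b0 lg fE x0).2.
exact: norm1_mulr_chardy (ltW b0) lg x0.
Unshelve. all: by end_near. Qed.

End coefficient_functions.

(** * Assembly of the representation *)

Unset Implicit Arguments.
Set Strict Implicit.

Theorem lemma3p6 (R : realType) (l : R) (q : R -> R) (p : \bar R)
    (phi : cplx R -> R -> cplx R) :
  - (1 / 2) < l ->
  locally_integrable `]0, +oo[%classic q ->
  exponent_range l p ->
  Lp01 p (fun x : R => x * q x) ->
  is_phi l q phi ->
  forall z0 : cplx R, exists phit phih : nat -> R -> cplx R,
    [/\ forall (z : cplx R) (x : R), 0 < x ->
          ((x `^ (l + 1))%:C)%C *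
            (\sum_(0 <= k < n)
               ((x ^+ (2 * k))%:C)%C * phit k x / k`!%:R * (z - z0) ^+ k)
            @[n --> \oo] --> phi z x,
        forall (z : cplx R) (x : R), 0 < x ->
          ((x `^ l)%:C)%C *
            (\sum_(0 <= k < n)
               ((x ^+ (2 * k))%:C)%C * phih k x / k`!%:R * (z - z0) ^+ k)
            @[n --> \oo] --> cderive (phi z) x
      & forall k : nat,
        [/\ cW1p01 p (phit k) /\ cW1p01 p (phih k),
            phit k 0 = ((Cphi l k)%:C)%C,
            phih k 0 = (((l + 1 + (2 * k)%:R) * Cphi l k)%:C)%C,
            (\forall x \near 0^'+, cderivable (phit k) x)
          & ((x%:C)%C : cplx R) * cderive (phit k) x @[x --> 0^'+]
              --> (0 : cplx R)]].
Proof.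
move=> l12 qloc prange Lh [sol _ asy] z0.
have p1 : (1 <= p)%E.
  move: prange; rewrite /exponent_range; case: ifPn => // _.
  by case: ifPn => _ /= /andP[].
have lh := locint_potential p1 qloc Lh.
pose al := 2 * l + 1; have al0 : 0 < al by rewrite /al; lra.
pose m := shifted_potential q z0; have lm : clocint m by exact: clocint_shifted_potential.
have Lm : cLp01 p m by exact: cLp01_shifted_potential.
have [a [la ab a0E aE]] := coef_exists al0 lm.
have reg k := coef_regular al0 lm p1 Lm la a0E aE k.
have C0 k : Cphi l k = k`!%:R * coef0 al k by exact: Cphi_coef0.
pose fct k : cplx R := (k`!%:R : R)%:C%C.
have fctE k : fct k = k`!%:R by rewrite /fct rmorph_nat.
have fct0 k : (k`!%:R : cplx R) != 0 by rewrite pnatr_eq0 -lt0n fact_gt0.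
(* The coefficients are controlled for [x > 0] only, so the value at 0 is set to the limit, which
   makes [phit k] and [phih k] continuous there. The factor $k!$ offsets the $1/k!$ in the
   expansion. *)
pose phit k x : cplx R := if x == 0 then (Cphi l k)%:C%C else fct k * a k x.
pose phih k x : cplx R := if x == 0 then ((l + 1 + (2 * k)%:R) * Cphi l k)%:C%C
  else fct k * (dcoef al m a k x + (l + 1)%:C%C * a k x).
exists phit, phih.
have phitE k x : 0 < x -> phit k x = fct k * a k x by move=> x0; rewrite /phit gt_eqF.
have phihE k x : 0 < x -> phih k x = fct k * (dcoef al m a k x + (l + 1)%:C%C * a k x).
  by move=> x0; rewrite /phih gt_eqF.
have conv z : exists W : R -> cplx R, [/\ clocbnd W,
    forall x, 0 < x -> phi z x = (x `^ (l + 1))%:C%C * W x,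
    forall x, 0 < x -> W x = 1 + J al (fun y => shifted_potential q z y * W y) x &
    forall x, 0 < x -> cderive (phi z) x = (x `^ l)%:C%C *
      (x%:C%C * chardy al (fun y => shifted_potential q z y * W y) x + (l + 1)%:C%C * W x)].
  have [r r0 ur] := asy z.
  have [h1 h2 h3 h4] := solution_volterra l12 lh (sol z) r0 ur.
  by eexists; split; [exact: h1|exact: h2|exact: h3|exact: h4].
have potentialE z y : shifted_potential q z y = m y - (z - z0) * y%:C%C by rewrite /m /shifted_potential; ring.
have cancel (A B F Z : cplx R) : F != 0 -> A * (F * B) / F * Z = Z * (A * B).
  by move=> F0; field.
have termE k z x : 0 < x -> (x ^+ (2 * k))%:C%C * phit k x / k`!%:R * (z - z0) ^+ k =
    (z - z0) ^+ k * ((x ^+ (2 * k))%:C%C * a k x).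
  by move=> x0; rewrite phitE// fctE cancel.
have dterm k x : 0 < x -> (x ^+ (2 * k))%:C%C * dcoef al m a k x =
    x%:C%C * chardy al (coef_source m a k) x.
  move=> x0; rewrite /dcoef [LHS]mulrA -rmorphM/= mulfV ?mul1r//.
  by rewrite expf_neq0// gt_eqF.
(* Each term splits in accordance with $\phi'=x^l(xW'+(l+1)W)$, so the second expansion follows from
   the two convergence results. *)
have dtermE k z x : 0 < x -> (x ^+ (2 * k))%:C%C * phih k x / k`!%:R * (z - z0) ^+ k =
    (z - z0) ^+ k * (x%:C%C * chardy al (coef_source m a k) x) +
    (l + 1)%:C%C * ((z - z0) ^+ k * ((x ^+ (2 * k))%:C%C * a k x)).
  by move=> x0; rewrite phihE// fctE cancel// mulrDr dterm//; ring.
split.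
- move=> z x x0; have [W [lW uW WE _]] := conv z.
  have cv := expansion_cvg al0 lm lW (potentialE z) WE la ab a0E aE x0.
  have H : x `^ (l + 1) * norm1 (W x - \sum_(0 <= k < n)
      (z - z0) ^+ k * ((x ^+ (2 * k))%:C%C * a k x)) @[n --> \oo] --> x `^ (l + 1) * 0.
    by apply: cvgM => //; exact: cvg_cst.
  rewrite mulr0 in H.
  apply: cvg_norm1; apply: norm1_squeeze H; apply: nearW => n; rewrite norm1_ge0/=.
  rewrite (uW x x0) (eq_bigr _ (fun k _ => termE k z x x0)) -mulrBr norm1_Zreal powR_norm.
  by rewrite ler_wpM2l ?powR_ge0// -norm1N opprB.
- move=> z x x0; have [W [lW uW WE dW]] := conv z.
  have cv := expansion_cvg al0 lm lW (potentialE z) WE la ab a0E aE x0.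
  have dcv := expansion_derive_cvg al0 lm lW (potentialE z) WE la ab a0E aE x0.
  have H : x `^ l * (norm1 (x%:C%C * chardy al (fun y => shifted_potential q z y * W y) x -
      \sum_(0 <= k < n) (z - z0) ^+ k * (x%:C%C * chardy al (coef_source m a k) x)) +
      `|l + 1| * norm1 (W x - \sum_(0 <= k < n)
        (z - z0) ^+ k * ((x ^+ (2 * k))%:C%C * a k x)))
      @[n --> \oo] --> x `^ l * (0 + `|l + 1| * 0).
    apply: cvgM; first exact: cvg_cst.
    by apply: cvgD => //; apply: cvgM => //; exact: cvg_cst.
  rewrite mulr0 addr0 mulr0 in H.
  apply: cvg_norm1; apply: norm1_squeeze H; apply: nearW => n.
  rewrite norm1_ge0/= (dW x x0) (eq_bigr _ (fun k _ => dtermE k z x x0)) big_split/=.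
  rewrite -mulr_sumr -mulrBr norm1_Zreal powR_norm ler_wpM2l ?powR_ge0//.
  rewrite opprD addrACA -mulrBr; apply: le_trans (norm1D _ _) _.
  by rewrite norm1_Zreal -[leLHS]/(_ + _) -norm1N opprB lerD2l -norm1N opprB.
- move=> k; have [[b [g [b0 lg Lg akE]]] [e [le Le dkE]]] := reg k.
  have lg' : clocint (fun y => fct k * g y) by exact: clocintZ.
  have Lg' : cLp01 p (fun y => fct k * g y) by exact: cLp01Z.
  have phitP x : 0 < x ->
      phit k x = (Cphi l k)%:C%C + cprim (chardy b (fun y => fct k * g y)) x.
    move=> x0; rewrite phitE// akE// C0 mulrDr rmorphM/=; congr (_ + _).
    rewrite -(cprimZ _ _ (clocint_chardy b0 lg)); apply: eq_cprim => y _.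
    by rewrite chardyZ// ltW.
  (* The derivative of [phih k]: $k!$ times the sum of [e], the derivative of [dcoef], and $l+1$
     times that of [a k]. *)
  pose s y : cplx R := fct k * (e y + (l + 1)%:C%C * chardy b g y).
  have lb := clocint_chardy b0 lg.
  have lb' := clocintZ (l + 1)%:C%C lb.
  have ls : clocint s by apply: clocintZ; exact: clocintD.
  have Ls : cLp01 p s.
    apply: cLp01Z => //; apply: cLp01D => //; apply: cLp01Z => //.
    exact: cLp01_chardy.
  have phihP x : 0 < x ->
      phih k x = ((l + 1 + (2 * k)%:R) * Cphi l k)%:C%C + cprim s x.
    move=> x0; rewrite phihE// akE// dkE// C0 /s (cprimZ _ _ (clocintD le lb')).
    rewrite (cprimD _ le lb') (cprimZ _ _ lb) !rmorphM/= !rmorphD/= /fct; ring.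
  split.
  + split; first by apply: cW1p01_cprim phitP => //;
      [exact: clocint_chardy|exact: cLp01_chardy|rewrite /phit eqxx].
    by apply: cW1p01_cprim phihP => //; rewrite /phih eqxx.
  + by rewrite /phit eqxx.
  + by rewrite /phih eqxx.
  + near=> x; have x0 : 0 < x by [].
    exact: (cprim_chardy_derive b0 lg' phitP x0).1.
  + exact: mulr_cderive_cvg0 b0 lg' phitP.
Unshelve. all: by end_near. Qed.
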